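(* Let $T$ be an ergodic automorphism of a standard probability space $(X,\mathcal B,\mu)$ which has the AOP property, let $G$ be a locally compact second countable Abelian group, and let $\varphi\colon X\to G$ be an ergodic cocycle. Assume that for every pair of distinct primes $r\neq s$ and every ergodic joining $\eta\in J^e(T^r,T^s)$: (E4) the transformation $(x,g,x')\mapsto (T^rx,\varphi^{(r)}(x)+g,T^sx')$ of $(X\times G\times X)$, considered with the measure obtained from $\eta\otimes\lambda_G$ (i.e. the group extension $(T_\varphi)^r\times T^s$ over $(T^r\times T^s,\eta)$), is ergodic; (E5) the Mackey action of the $G\times G$-valued cocycle $(x,x')\mapsto(\varphi^{(r)}(x),\varphi^{(s)}(x'))$ over the automorphism $(T^r\times T^s,\eta)$ is weakly mixing. Then for every ergodic measure-preserving $G$-action $\mathcal S=(S_g)_{g\in G}$ on a standard probability space $(Y,\mathcal C,\nu)$, the Rokhlin extension $T_{\varphi,\mathcal S}$ has the AOP property.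
   Context: For a cocycle $\varphi\colon X\to G$ over $T$, $\varphi^{(n)}(x)=\varphi(x)+\varphi(Tx)+\dots+\varphi(T^{n-1}x)$ for $n\ge1$, $\varphi^{(0)}=0$. The group extension $T_\varphi$ is $T_\varphi(x,g)=(Tx,\varphi(x)+g)$ on $(X\times G,\mu\otimes\lambda_G)$ ($\lambda_G$ Haar measure); $\varphi$ is ergodic if $T_\varphi$ is ergodic. The Mackey action of $\varphi$ is the non-singular $G$-action induced by the translations $\tau_g(x,g')=(x,g+g')$ on the space of ergodic components of $T_\varphi$ (with $\lambda_G$ replaced by an equivalent probability measure). A non-singular ergodic $G$-action $(W_g)$ on $(C,\kappa)$ is weakly mixing if the only character $\chi\in\widehat G$ admitting $0\ne f\in L^\infty(\kappa)$ with $f\circ W_g=\chi(g)f$ for all $g$ is the trivial one. $J^e(T^r,T^s)$ denotes the set of ergodic joinings of $T^r$ and $T^s$ (i.e. $T^r\times T^s$-invariant ergodic probability measures on $X\times X$ with both marginals $\mu$). An ergodic $T$ has the AOP property if for all $f,g\in L^2_0(X,\mu)$, $\limsup_{r\ne s,\ r,s \text{ prime},\ r,s\to\infty}\sup_{\kappa\in J^e(T^r,T^s)}\left|\int f\otimes g\,d\kappa\right|=0$. The Rokhlin extension is $T_{\varphi,\mathcal S}(x,y)=(Tx,S_{\varphi(x)}y)$ on $(X\times Y,\mu\otimes\nu)$. *)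

(* Defs.v *)
From HB Require Import structures.
From mathcomp Require Import all_boot all_order all_algebra.
From mathcomp Require Import all_classical all_reals all_analysis.

Set Implicit Arguments.
Unset Strict Implicit.
Unset Printing Implicit Defensive.

Import Order.TTheory GRing.Theory Num.Theory.
Import numFieldNormedType.Exports.

Local Open Scope classical_set_scope.
Local Open Scope ring_scope.

Definition Borel (G : topologicalZmodType) : Type := G.
HB.instance Definition _ (G : topologicalZmodType) :=
  GRing.Zmodule.on (Borel G).
HB.instance Definition _ (G : topologicalZmodType) :=
  TopologicalZmodule.on (Borel G).
HB.instance Definition _ (G : topologicalZmodType) :=
  isPointed.Build (Borel G) (0 : G).
HB.instance Definition _ (G : topologicalZmodType) :=
  @isMeasurable.Build (sigma_display (@open (Borel G))) (Borel G)
  <<s (@open (Borel G)) >> (@sigma_algebra0 _ setT (@open (Borel G)))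
  (@sigma_algebraC _ (@open (Borel G)))
  (@sigma_algebra_bigcup _ setT (@open (Borel G))).

Section Defs.
Context (R : realType).

(* Standard Borel space: Borel isomorphic to a Borel subset of R (Kuratowski). *)
Definition standard_borel d (X : measurableType d) :=
  exists f : X -> R, injective f /\ measurable_fun setT f /\
    forall A, measurable A -> measurable (f @` A).

Definition automorphism d (X : measurableType d) (mu : set X -> \bar R)
    (T : X -> X) :=
  bijective T /\ measurable_fun setT T /\
  (forall A, measurable A -> measurable (T @` A)) /\
  (forall A, measurable A -> mu (T @^-1` A) = mu A).

(* Ergodicity of a transformation T with respect to the measure m
   (m may be infinite, e.g. a product with Haar measure). *)
Definition ergodic d (W : measurableType d) (m : set W -> \bar R)
    (T : W -> W) :=
  forall A, measurable A -> T @^-1` A = A -> m A = 0%E \/ m (~` A) = 0%E.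

Definition L2_0 d (X : measurableType d) (mu : set X -> \bar R) (f : X -> R) :=
  measurable_fun setT f /\ mu.-integrable setT (fun x => (f x ^+ 2)%:E) /\
  (\int[mu]_x (f x)%:E = 0)%E.

Definition joining d (X : measurableType d) (mu : set X -> \bar R)
    (T1 T2 : X -> X) (k : probability (X * X)%type R) :=
  (forall A, measurable A ->
     k ((fun z : X * X => (T1 z.1, T2 z.2)) @^-1` A) = k A) /\
  (forall A, measurable A -> k (A `*` setT) = mu A) /\
  (forall A, measurable A -> k (setT `*` A) = mu A).

Definition ergodic_joining d (X : measurableType d) (mu : set X -> \bar R)
    (T1 T2 : X -> X) (k : probability (X * X)%type R) :=
  joining mu T1 T2 k /\ ergodic k (fun z : X * X => (T1 z.1, T2 z.2)).

Definition AOP d (X : measurableType d) (mu : set X -> \bar R) (T : X -> X) :=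
  ergodic mu T /\
  forall f g : X -> R, L2_0 mu f -> L2_0 mu g ->
  forall eps : R, 0 < eps -> exists N : nat,
    forall r s : nat, prime r -> prime s -> r != s -> (N <= r)%N -> (N <= s)%N ->
    forall k : probability (X * X)%type R,
      ergodic_joining mu (iter r T) (iter s T) k ->
      (`| \int[k]_z (f z.1 * g z.2)%:E | <= eps%:E)%E.

Definition ae_on d (W : measurableType d) (m : set W -> \bar R) (P : W -> Prop) :=
  exists N, measurable N /\ m N = 0%E /\ forall w, ~ P w -> N w.

Definition haar (G : topologicalZmodType)
    (lam : set (Borel G) -> \bar R) :=
  (forall (g : G) (A : set (Borel G)), measurable A ->
     lam ((fun x : G => g + x) @^-1` A) = lam A) /\
  (forall K : set G, compact K -> (lam K < +oo)%E) /\
  (forall U : set G, open U -> U !=set0 -> (0 < lam U)%E).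

(* Characters of G x G, written with real and imaginary parts:
   chi = c + i s, continuous homomorphism into the unit circle. *)
Definition character2 (G : topologicalZmodType) (c s : (G * G)%type -> R) :=
  continuous c /\ continuous s /\
  (forall h, c h ^+ 2 + s h ^+ 2 = 1) /\
  (forall h h', c (h + h') = c h * c h' - s h * s h') /\
  (forall h h', s (h + h') = s h * c h' + c h * s h').

(* Weak mixing of the Mackey action of a G x G-valued cocycle over the
   transformation U on (Z, m).  The Mackey action is the action of G x G by
   translations on the space of ergodic components of the skew product
   U_psi(z, h) = (U z, psi z + h) on (Z x (G x G), m (x) lam (x) lam); its
   L^infty-space is the space of bounded U_psi-invariant functions with the
   translation action.  Complex functions are written as pairs (u, v). *)
Definition mackey_weakly_mixing (G : topologicalZmodType)
    (lam : {sigma_finite_measure set (Borel G) -> \bar R})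
    d (Z : measurableType d) (m : set Z -> \bar R) (U : Z -> Z)
    (psi : Z -> (G * G)%type) :=
  let W := (Z * (Borel G * Borel G))%type in
  let M : set W -> \bar R := (m \x (lam \x lam))%E in
  let Upsi : W -> W := fun w =>
    (U w.1, ((psi w.1).1 + w.2.1, (psi w.1).2 + w.2.2) : G * G) in
  let tau (h : G * G) : W -> W := fun w =>
    (w.1, (h.1 + w.2.1, h.2 + w.2.2) : G * G) in
  forall c s : (G * G)%type -> R, character2 c s ->
  (exists u v : W -> R,
     measurable_fun setT u /\ measurable_fun setT v /\
     (exists B : R, forall w, `|u w| <= B /\ `|v w| <= B) /\
     ~ ae_on M (fun w => u w = 0 /\ v w = 0) /\
     ae_on M (fun w => u (Upsi w) = u w /\ v (Upsi w) = v w) /\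
     (forall h : G * G, ae_on M (fun w =>
        u (tau h w) = c h * u w - s h * v w /\
        v (tau h w) = s h * u w + c h * v w))) ->
  forall h, c h = 1.

End Defs.

Definition cocycle_sum (X : Type) (G : zmodType) (phi : X -> G) (T : X -> X)
    (n : nat) (x : X) : G :=
  (\sum_(i < n) phi (iter i T x))%R.

Definition rokhlin (X Y : Type) (G : Type) (T : X -> X) (phi : X -> G)
    (S : G -> Y -> Y) : (X * Y)%type -> (X * Y)%type :=
  fun p => (T p.1, S (phi p.1) p.2).

(* Main.v *)
(* Write T' for the Rokhlin extension.  An ergodic joining k of T'^r and T'^s
   projects to an ergodic joining eta of T^r and T^s, and k turns out to be the
   relatively independent extension of eta: the law of (x, x', y', y) is
   eta (x) nu (x) nu.  Hence the integral of f (x) g against k is the integral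
   against eta of the product of the fibre averages of f and g, which have mean
   zero and are square integrable, and the AOP property of T applies.

   Relative independence comes from one criterion, used twice.  Assume that the
   skew product (v, g) |-> (U v, psi v + g) is ergodic, and let k on V x Y be
   invariant under (v, y) |-> (U v, S_(psi v) y) with marginals m and nu.  For D
   in Y, the measure C |-> (k (x) lam){(v, g) in C, S_(-g) y in D} has an
   invariant, hence constant, density with respect to m (x) lam; so
   (v, S_(-g) y, g) has law m (x) nu (x) lam, and k = m (x) nu.  The point y' is
   adjoined to (x, x') by (E4) with r and s exchanged; then y is adjoined to
   (x, x', y'), for which (z, y', g) |-> (U z, S_(psi2 z) y', psi1 z + g) has to
   be ergodic, where z = (x, x') and psi1, psi2 are the two cocycles of (E5).

   An invariant set B of that map gives a(z, g1, g2, y) = 1_B(z, S_g2 y, g1),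
   invariant in (z, g1, g2) under the G x G-extension and equivariant in y.  If a
   is not constant, some average of a over a set of triples (z, g1, g2) is not
   S-invariant in y.  Two quadratic forms on the equivariant functions then
   detect an approximate eigenvector for any finite set of elements of G: if an
   element is nearly an eigenvector of S_(2b), then it is the half sum of two
   orthogonal near eigenvectors of S_b, and one of them keeps the forms positive.
   Pairing it with its own averages gives approximate eigenfunctions on triples,
   and a weak limit along an ultrafilter gives a genuine eigenfunction of the
   second copy of G with a nontrivial eigenvalue.  By (E4) it is an eigenfunction
   of G x G, which contradicts (E5). *)

Require Import Defs.
From HB Require Import structures.
From mathcomp Require Import all_boot all_order all_algebra.
From mathcomp Require Import ring lra.
From mathcomp Require Import all_classical all_reals all_analysis.
From mathcomp Require Import measurable_realfun.

Import Order.TTheory GRing.Theory Num.Theory.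
Import numFieldNormedType.Exports.
Local Open Scope classical_set_scope.
Local Open Scope ring_scope.

(** * Localizing quadratic forms at a character *)

(** The obstacle is that the Mackey action is only non-singular, and that [S] may have continuous
    spectrum. An invariant function on triples times [Y] therefore does not give a Hilbert-Schmidt
    operator with finite dimensional eigenspaces, while (E5) excludes only exact bounded
    eigenfunctions. What rescues the argument: the norm over [Y] of an equivariant function is
    invariant under [U] and under the second copy of [G], hence constant on triples. Estimates
    between integrals thus become uniform ones, and a vector localized near a character pairs to a
    bounded function with a uniformly small error. The localization rests on the parallelogram law
    alone, in place of a spectral theorem. The first form is penalized by [K] times the second one
    at the defect, and remains invariant; so the elements of [G] can be treated one after the other.
    The lower bound [r] depends neither on the finite set nor on the precision, which keeps the weak
    limit nontrivial. The limit eigenvalue is a bare function on the group; its continuity comes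
    from that of translations in Haar measure. *)

Section Localization.
Variables (R : realType) (G V : zmodType) (D : V -> Prop).
Variables (rot : R -> V -> V) (S : G -> V -> V).
Hypothesis DD : forall x y, D x -> D y -> D (x + y).
Hypothesis DN : forall x, D x -> D (- x).
Hypothesis Drot : forall t x, D x -> D (rot t x).
Hypothesis DS : forall b x, D x -> D (S b x).
Hypothesis rotD : forall t x y, rot t (x + y) = rot t x + rot t y.
Hypothesis rotN : forall t x, rot t (- x) = - rot t x.
Hypothesis rot0 : forall x, rot 0 x = x.
Hypothesis rot_add : forall s t x, rot (s + t) x = rot s (rot t x).
Hypothesis rot_pi : forall x, rot pi x = - x.
Hypothesis SD : forall b x y, S b (x + y) = S b x + S b y.
Hypothesis SN : forall b x, S b (- x) = - S b x.
Hypothesis S_add : forall b c x, S (b + c) x = S b (S c x).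
Hypothesis Srot : forall b t x, S b (rot t x) = rot t (S b x).

(** The parallelogram law on [D] is all that is kept of a quadratic form. In a Hilbert space such a
    [J] would come from a self-adjoint operator that commutes with the action. *)
Definition invariant_form (J : V -> R) :=
  [/\ forall x y, D x -> D y -> J (x + y) + J (x - y) = 2 * (J x + J y),
      forall t x, D x -> J (rot t x) = J x &
      forall b x, D x -> J (S b x) = J x].

(** The defect map [x |-> S b x - rot t x] is additive and commutes with rotations and, [G] being
    commutative, with every [S c]; so composition with it keeps a form invariant. *)
Lemma invariant_form_penalized (J q : V -> R) K b t : invariant_form J -> invariant_form q ->
  invariant_form (fun x => J x - K * q (S b x - rot t x)).
Proof.
have DE x : D x -> D (S b x - rot t x).
  by move=> Dx; apply: DD; [exact: DS | apply: DN; exact: Drot].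
move=> [J1 J2 J3] [q1 q2 q3]; split.
- move=> x y Dx Dy; have := J1 _ _ Dx Dy; have := q1 _ _ (DE _ Dx) (DE _ Dy).
  have -> : S b x - rot t x + (S b y - rot t y) = S b (x + y) - rot t (x + y).
    by rewrite SD rotD opprD addrACA.
  have -> : S b x - rot t x - (S b y - rot t y) = S b (x - y) - rot t (x - y).
    by rewrite SD rotD SN rotN opprD addrACA -opprD.
  by move=> e1 e2; rewrite addrACA -opprD -mulrDr e1 e2; ring.
- move=> s x Dx; rewrite J2//; congr (_ - _ * _).
  rewrite -(q2 s (S b x - rot t x)) ?rotD ?rotN; last exact: DE.
  by rewrite Srot -!rot_add (addrC t).
- move=> c x Dx; rewrite J3//; congr (_ - _ * _).
  rewrite -(q3 c (S b x - rot t x)) ?SD ?SN; last exact: DE.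
  by rewrite Srot -!S_add (addrC b).
Qed.

(* With [u = S (b *+ 2 ^ m)] and [y = rot (- t / 2) (u x)], the two vectors
   [x +- y] split [x] orthogonally according to the two square roots of the
   approximate eigenvalue [rot t] of [u ^ 2]. *)
Lemma localize_halving (J q : V -> R) K b m x t : invariant_form J -> invariant_form q -> D x ->
  0 < J x - K / 2 ^+ m.+1 * q (S (b *+ (2 ^ m.+1)) x - rot t x) ->
  exists x' t', D x' /\
    0 < J x' - K / 2 ^+ m * q (S (b *+ (2 ^ m)) x' - rot t' x').
Proof.
move=> [J1 J2 J3] [q1 q2 q3] Dx.
set u := b *+ (2 ^ m).
have -> : b *+ (2 ^ m.+1) = u + u by rewrite expnS mul2n -addnn mulrnDr.
set E := q _ => h.
pose leaf t1 := x + rot (- t1) (S u x).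
have Dleaf t1 : D (leaf t1) by apply: DD => //; apply: Drot; exact: DS.
(* With [z = exp (i t1)] this is [(u - z) (x + u x / z) = (u ^ 2 - z ^ 2) x / z]: both leaves have
   the defect of [x] up to a rotation. *)
have qleaf t1 : rot (t1 + t1) x = rot t x ->
    q (S u (leaf t1) - rot t1 (leaf t1)) = E.
  move=> t1E; rewrite /leaf SD rotD -rot_add subrr rot0 Srot -S_add.
  rewrite (addrC (rot t1 x)) opprD addrA (addrC (S u x)) addrK.
  have -> : rot t1 x = rot (- t1) (rot t x).
    by rewrite -t1E -rot_add addKr.
  rewrite -rotN -rotD q2//; apply: DD; first exact: DS.
  by apply: DN; exact: Drot.
have tE1 : rot (t / 2 + t / 2) x = rot t x by congr (rot _ x); lra.
have tE2 : rot (t / 2 + pi + (t / 2 + pi)) x = rot t x.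
  have -> : t / 2 + pi + (t / 2 + pi) = pi + (pi + t) :> R by lra.
  by rewrite (rot_add pi) (rot_add pi) !rot_pi opprK.
have leaf2 : leaf (t / 2 + pi) = x - rot (- (t / 2)) (S u x).
  have -> : - (t / 2) = pi + - (t / 2 + pi) :> R by ring.
  by rewrite (rot_add pi) rot_pi opprK.
have Jsum : J (leaf (t / 2)) + J (leaf (t / 2 + pi)) = 4 * J x.
  rewrite leaf2 /leaf J1//; last by apply: Drot; exact: DS.
  rewrite J2 ?J3//; [lra | exact: DS].
have KE : K / 2 ^+ m.+1 = K / 2 ^+ m / 2.
  by rewrite exprSr invfM mulrA.
rewrite KE in h; set c := K / _ in h *.
(* The two values add up to [4 * (J x - c / 2 * E)], which is positive by [h]; halving the element
   thus doubles the weight of the penalty. *)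
have /orP[hp|hp] : (0 < J (leaf (t / 2)) - c * E)
    || (0 < J (leaf (t / 2 + pi)) - c * E).
  rewrite -implyNb -leNgt; apply/implyP => le0; nra.
- by exists (leaf (t / 2)), (t / 2); rewrite qleaf.
- by exists (leaf (t / 2 + pi)), (t / 2 + pi); rewrite qleaf.
Qed.

(** The multiple [b *+ 2 ^ m] comes first: its defect at angle 0 has [q] at most [4 * q x], so for
    large [m] the penalty with weight [K / 2 ^ m] stays below [J x]. Then [m] halvings lead to [b]
    with the full weight [K]. *)
Lemma localize1 (J q : V -> R) K b x : invariant_form J -> invariant_form q ->
  (forall y, D y -> 0 <= q y) -> 0 <= K -> D x -> 0 < J x ->
  exists x' t, D x' /\ 0 < J x' - K * q (S b x' - rot t x').
Proof.
move=> fJ fq q0 K0 Dx Jx; have [q1 q2 q3] := fq.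
have qle y : D y -> forall c, q (S c y - rot 0 y) <= 4 * q y.
  move=> Dy c; have := q1 _ _ (DS c _ Dy) (Drot 0 _ Dy).
  rewrite q2// q3//; have := q0 _ (DD _ _ (DS c _ Dy) (Drot 0 _ Dy)).
  by move=> *; lra.
have [m mP] : exists m, K * (4 * q x) < J x * 2 ^+ m.
  pose r := K * (4 * q x) / J x.
  exists (Num.bound r); rewrite -ltr_pdivrMl// mulrC.
  apply: lt_le_trans (_ : (Num.bound r)%:R <= _).
    apply: archi_boundP; apply: divr_ge0; last exact: ltW.
    by apply: mulr_ge0 => //; apply: mulr_ge0 => //; exact: q0.
  by rewrite -natrX ler_nat ltnW// ltn_expl.
have {mP} : 0 < J x - K / 2 ^+ m * q (S (b *+ (2 ^ m)) x - rot 0 x).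
  rewrite subr_gt0; apply: le_lt_trans (_ : K / 2 ^+ m * (4 * q x) < _).
    by apply: ler_wpM2l; [rewrite divr_ge0// exprn_ge0 | exact: qle].
  by rewrite mulrAC ltr_pdivrMr ?exprn_gt0.
move: (X in rot X x) => t; elim: m x t {Jx} Dx => [|m IHm] x t Dx.
  by rewrite expr0 divr1 => h; exists x, t.
move=> h; have [x' [t' [Dx' /IHm]]] := localize_halving _ _ _ _ _ _ _ fJ fq Dx h.
exact.
Qed.

(** Each element of [F] adds its penalty to the form before the next one is treated. The penalties
    are non-negative, so positivity of the last form bounds each of them by [J x']. *)
Lemma localize (J q : V -> R) K (F : seq G) x : invariant_form J -> invariant_form q ->
  (forall y, D y -> 0 <= q y) -> 0 <= K -> D x -> 0 < J x ->
  exists x', [/\ D x', 0 < J x' &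
    forall b, b \in F -> exists t, K * q (S b x' - rot t x') < J x'].
Proof.
move=> fJ fq q0 K0; elim: F J x fJ => [|b F IH] J x fJ Dx Jx.
  by exists x; split.
have [x1 [t [Dx1 Jx1]]] := localize1 _ _ K b _ fJ fq q0 K0 Dx Jx.
have [x' [Dx' Jx' Fx']] := IH _ _ (invariant_form_penalized _ _ K b t fJ fq) Dx1 Jx1.
have Kq : 0 <= K * q (S b x' - rot t x').
  rewrite mulr_ge0// q0//; apply: DD; [exact: DS | apply: DN; exact: Drot].
exists x'; split => //; first by lra.
move=> c; rewrite inE => /predU1P[-> | /Fx' [s hs]].
  by exists t; lra.
by exists s; lra.
Qed.

End Localization.

Set Implicit Arguments.
Unset Strict Implicit.

(** * Bounded functions and their integrals *)

Section BoundedMeasurable.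
Context {d} {W : measurableType d} {R : realType}.
Implicit Types (f g : W -> R) (A : set W).

(** The bound holds at every point, so that sections and compositions with arbitrary measurable maps
    stay in the class. *)
Definition bmf f := measurable_fun setT f /\ exists C, forall x, `|f x| <= C.

Lemma bmf_cst (c : R) : bmf (fun=> c).
Proof. by split => //; exists `|c|. Qed.

Lemma bmfD f g : bmf f -> bmf g -> bmf (fun x => f x + g x).
Proof.
move=> [mf [C Cf]] [mg [E Eg]]; split; first exact: measurable_funD.
by exists (C + E) => x; rewrite (le_trans (ler_normD _ _))// lerD.
Qed.

Lemma bmfN f : bmf f -> bmf (fun x => - f x).
Proof.
move=> [mf [C Cf]]; split; first exact: measurableT_comp.
by exists C => x; rewrite normrN.
Qed.

Lemma bmfB f g : bmf f -> bmf g -> bmf (fun x => f x - g x).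
Proof. by move=> bf bg; apply: bmfD => //; exact: bmfN. Qed.

Lemma bmfM f g : bmf f -> bmf g -> bmf (fun x => f x * g x).
Proof.
move=> [mf [C Cf]] [mg [E Eg]]; split; first exact: measurable_funM.
by exists (C * E) => x; rewrite normrM ler_pM.
Qed.

Lemma bmfZ c f : bmf f -> bmf (fun x => c * f x).
Proof. by move=> bf; apply: bmfM => //; exact: bmf_cst. Qed.

Lemma bmf_sqr f : bmf f -> bmf (fun x => f x ^+ 2).
Proof. by move=> bf; exact: bmfM. Qed.

Lemma bmf_indic A : measurable A -> bmf (\1_A).
Proof.
move=> mA; split => //; exists 1 => x.
by rewrite indicE; case: (_ \in _); rewrite /= ?normr1 ?normr0.
Qed.

Definition fin_meas (M : set W -> \bar R) A := measurable A /\ (M A < +oo)%E.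

Section measure.
Variable M : {measure set W -> \bar R}.

Lemma fin_measI A B : fin_meas M A -> measurable B -> fin_meas M (A `&` B).
Proof.
move=> [mA fA] mB; have mAB := measurableI _ _ mA mB; split => //.
by apply: le_lt_trans fA; apply: le_measure; rewrite ?inE.
Qed.

Lemma fin_measD A B : fin_meas M A -> measurable B -> fin_meas M (A `\` B).
Proof. by move=> fA mB; rewrite setDE; apply: fin_measI => //; exact: measurableC. Qed.

Lemma fin_measU A B : fin_meas M A -> fin_meas M B -> fin_meas M (A `|` B).
Proof.
move=> [mA fA] [mB fB]; split; first exact: measurableU.
by apply: le_lt_trans (lte_add_pinfty fA fB); exact: measureU2.
Qed.

Lemma fin_meas_fineK A : fin_meas M A -> (fine (M A))%:E = M A.
Proof. by move=> [mA fA]; rewrite fineK// ge0_fin_numE. Qed.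

Lemma bmf_integrable A f : fin_meas M A -> bmf f -> M.-integrable A (EFin \o f).
Proof.
move=> [mA fA] [mf [C Cf]]; apply: measurable_bounded_integrable => //.
  exact: measurable_funTS.
exists C; split; first exact: num_real.
by move=> x Cx y _ /=; exact: le_trans (Cf y) (ltW Cx).
Qed.

Lemma Rint_le_bound A f C : fin_meas M A -> bmf f -> (forall x, A x -> f x <= C) ->
  \int[M]_(x in A) f x <= C * fine (M A).
Proof.
move=> fA bf fC; rewrite -Rintegral_cst; last exact: fA.1.
apply: le_Rintegral => //; [exact: fA.1 | exact: bmf_integrable|].
by apply: bmf_integrable => //; exact: bmf_cst.
Qed.

Lemma Rint_norm_bound A f C : fin_meas M A -> bmf f ->
  (forall x, A x -> `|f x| <= C) ->
  `|\int[M]_(x in A) f x| <= C * fine (M A).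
Proof.
move=> fA bf fC; apply: le_trans (le_normr_Rintegral _ _) _; first exact: fA.1.
  exact: bmf_integrable.
apply: Rint_le_bound => //; case: bf => mf [E Ef]; split.
  exact: measurableT_comp.
by exists E => x; rewrite normr_id.
Qed.

Lemma Rint_setU A B f : fin_meas M A -> fin_meas M B -> A `&` B = set0 -> bmf f ->
  \int[M]_(x in A `|` B) f x = \int[M]_(x in A) f x + \int[M]_(x in B) f x.
Proof.
move=> fA fB AB bf; apply: Rintegral_setU; [exact: fA.1|exact: fB.1| |exact/disj_set2P].
by apply: bmf_integrable => //; exact: fin_measU.
Qed.

Lemma RintD A f g : fin_meas M A -> bmf f -> bmf g ->
  \int[M]_(x in A) (f x + g x) = \int[M]_(x in A) f x + \int[M]_(x in A) g x.
Proof. by move=> fA bf bg; apply: RintegralD; [exact: fA.1|exact: bmf_integrable..]. Qed.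

Lemma RintB A f g : fin_meas M A -> bmf f -> bmf g ->
  \int[M]_(x in A) (f x - g x) = \int[M]_(x in A) f x - \int[M]_(x in A) g x.
Proof. by move=> fA bf bg; apply: RintegralB; [exact: fA.1|exact: bmf_integrable..]. Qed.

Lemma RintZ A c f : fin_meas M A -> bmf f ->
  \int[M]_(x in A) (c * f x) = c * \int[M]_(x in A) f x.
Proof. by move=> fA bf; apply: RintegralZl; [exact: fA.1|exact: bmf_integrable]. Qed.

Lemma Rint_le A f g : fin_meas M A -> bmf f -> bmf g -> (forall x, A x -> f x <= g x) ->
  \int[M]_(x in A) f x <= \int[M]_(x in A) g x.
Proof.
by move=> fA bf bg fg; apply: le_Rintegral => //; [exact: fA.1|exact: bmf_integrable..].
Qed.

Lemma Rint_ae A f g : measurable A -> measurable_fun setT f -> measurable_fun setT g ->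
  {ae M, forall x, f x = g x} -> \int[M]_(x in A) f x = \int[M]_(x in A) g x.
Proof.
move=> mA mf mg fg; congr fine; apply: ae_eq_integral => //.
- by apply/measurable_funTS/measurable_EFinP.
- by apply/measurable_funTS/measurable_EFinP.
- by apply: filterS fg => x -> _.
Qed.

Lemma ae_le_of_Rint A f g : fin_meas M A -> bmf f -> bmf g ->
  (forall E, measurable E -> E `<=` A -> \int[M]_(x in E) f x <= \int[M]_(x in E) g x) ->
  {ae M, forall x, A x -> f x <= g x}.
Proof.
move=> fA bf bg fg; pose h x := f x - g x.
have bh : bmf h by exact: bmfB.
pose B := A `&` [set x | 0 < h x].
have mB : measurable B.
  apply: measurableI; first exact: fA.1.
  have -> : [set x | 0 < h x] = setT `&` h @^-1` `]0, +oo[.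
    by apply/seteqP; split => x /=; rewrite in_itv/= andbT => // -[].
  by apply: bh.1.
have BA : B `<=` A by move=> x [].
have fB : fin_meas M B by apply: fin_measI => //; rewrite (_ : [set x | 0 < h x] = setT `&` h @^-1` `]0, +oo[); [exact: bh.1|apply/seteqP; split => x /=; rewrite in_itv/= andbT => // -[]].
have : ae_eq M B (EFin \o h) (EFin \o cst 0).
  apply: integral_ae_eq => //; [exact: bmf_integrable|exact/measurable_EFinP/measurable_cst|].
  move=> E EB mE; have fE : fin_meas M E.
    split => //; apply: le_lt_trans fB.2; apply: le_measure; rewrite ?inE//.
  rewrite [RHS]integral0_eq// -(fineK (integrable_fin_num _ (bmf_integrable fE bh)))//.
  congr (_%:E); apply/eqP; rewrite eq_le; apply/andP; split.
    have := RintB fE bf bg; rewrite /Rintegral => ->.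
    by rewrite subr_le0; apply: fg => //; exact: subset_trans EB BA.
  by apply: fine_ge0; apply: integral_ge0 => x /EB[_ /ltW]; rewrite lee_fin.
apply: filterS => x hx Ax; rewrite leNgt; apply/negP => gf.
have Bx : B x by split => //=; rewrite subr_gt0.
by move: (hx Bx) Bx.2 => /= -[->]; rewrite ltxx.
Qed.

Lemma ae_eq_of_Rint A f g : fin_meas M A -> bmf f -> bmf g ->
  (forall E, measurable E -> E `<=` A -> \int[M]_(x in E) f x = \int[M]_(x in E) g x) ->
  {ae M, forall x, A x -> f x = g x}.
Proof.
move=> fA bf bg fg.
have h1 : {ae M, forall x, A x -> f x <= g x}.
  by apply: ae_le_of_Rint => // E mE EA; rewrite fg.
have h2 : {ae M, forall x, A x -> g x <= f x}.
  by apply: ae_le_of_Rint => // E mE EA; rewrite fg.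
by apply: filterS2 h1 h2 => x h1 h2 Ax; apply/eqP; rewrite eq_le h1// h2.
Qed.

Lemma Rint_preimage (T : W -> W) A f : measurable_fun setT T ->
  (forall B, measurable B -> M (T @^-1` B) = M B) -> fin_meas M A -> bmf f ->
  \int[M]_(x in T @^-1` A) f (T x) = \int[M]_(x in A) f x.
Proof.
move=> mT MT fA bf; congr fine.
have mTA : measurable (T @^-1` A) by rewrite -[X in measurable X]setTI; apply: mT => //; exact: fA.1.
have bfT : bmf (f \o T).
  by case: bf => mf [C Cf]; split; [exact: measurableT_comp | exists C => x; exact: Cf].
rewrite -[LHS](@integral_pushforward _ _ _ _ _ T mT M A (EFin \o f)).
- by apply: eq_measure_integral => B mB _; exact: MT.
- by apply/measurable_EFinP; exact: bf.1.
- by apply: (bmf_integrable _ bfT); split => //; rewrite MT//; [exact: fA.2|exact: fA.1].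
- exact: fA.1.
Qed.

End measure.

Section sigma_finite.
Variable M : {sigma_finite_measure set W -> \bar R}.

Lemma ae_of_fin_meas (P : W -> Prop) :
  (forall A, fin_meas M A -> {ae M, forall x, A x -> P x}) -> {ae M, forall x, P x}.
Proof.
move=> AP; have /sigma_finiteP[F [FT _ Ff]] := sigma_finiteT M.
have /ae_foralln : forall n, {ae M, forall x, F n x -> P x} by move=> n; exact/AP/Ff.
apply: filterS => x h; have : [set: W] x by [].
by rewrite FT => -[n _ /h].
Qed.

End sigma_finite.
End BoundedMeasurable.

(** * Densities of bounded set functions *)

Section Density.
Context {d} {W : measurableType d} {R : realType}.
Variable M : {sigma_finite_measure set W -> \bar R}.

Definition fin_additive (nu : set W -> R) := forall A B,
  fin_meas M A -> fin_meas M B -> A `&` B = set0 -> nu (A `|` B) = nu A + nu B.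

Definition bounded_by_measure (nu : set W -> R) (C : R) :=
  forall A, fin_meas M A -> `|nu A| <= C * fine (M A).

(** Domination by [M] upgrades finite to countable additivity, because the tails [T n] decrease to
    the empty set. Both hypotheses pass to limits along an ultrafilter, which countable additivity
    alone would not do. *)
Lemma fin_additive_series (nu : set W -> R) C U (E : nat -> set W) :
  fin_additive nu -> bounded_by_measure nu C -> fin_meas M U ->
  (forall k, measurable (E k)) -> trivIset setT E -> U `<=` \bigcup_k E k ->
  (fun n => \sum_(k < n) nu (U `&` E k)) @ \oo --> nu U.
Proof.
move=> nuD nuC fU mE tE UE.
pose T n := U `\` \bigcup_(k in `I_n) E k.
have fT n : fin_meas M (T n).
  by apply: fin_measD => //; apply: bigcup_measurable => k _.
have nuT n : nu U = \sum_(k < n) nu (U `&` E k) + nu (T n).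
  elim: n => [|n IH].
    by rewrite big_ord0 add0r /T II0 bigcup_set0 setD0.
  rewrite big_ord_recr/= IH -addrA; congr (_ + _).
  rewrite -nuD//.
  - congr nu; apply/seteqP; split => x.
      move=> [Ux nEx]; have [Enx|nEnx] := pselect (E n x); first by left.
      right; split => // -[k /=]; rewrite ltnS leq_eqVlt => /orP[/eqP -> //|kn Ekx].
      by apply: nEx; exists k.
    move=> [[Ux Enx]|[Ux nEx]]; split => //.
      move=> [k /= kn Ekx]; have := tE k n I I.
      by move=> /(_ (ex_intro _ x (conj Ekx Enx))) kE; rewrite kE ltnn in kn.
    by move=> [k /= kn Ekx]; apply: nEx; exists k => //=; exact: ltnW.
  - exact: fin_measI.
  - rewrite /T; apply/seteqP; split => // x [[_ Enx] [_ []]].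
    by exists n => //=.
have Tcvg : (fun n => M (T n)) @ \oo --> M (\bigcap_n T n).
  apply: nonincreasing_cvg_mu.
  - exact: (fT 0%N).2.
  - by move=> n; exact: (fT n).1.
  - by apply: bigcap_measurable => // n _; exact: (fT n).1.
  - move=> n m nm; apply/subsetPset => x [Ux nEx]; split => // -[k /= kn Ekx].
    by apply: nEx; exists k => //=; exact: leq_trans kn nm.
have T0 : \bigcap_n T n = set0.
  apply/seteqP; split => // x Tx; have [Ux _] := Tx 0%N I.
  have [k _ Ekx] := UE x Ux.
  by have [_ []] := Tx k.+1 I; exists k => /=.
rewrite T0 measure0 in Tcvg.
have fTcvg : (fun n => fine (M (T n))) @ \oo --> (0 : R).
  by apply: fine_cvg.
have nuTcvg : (fun n => nu (T n)) @ \oo --> (0 : R).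
  apply/norm_cvg0P; apply: (@squeeze_cvgr _ _ _ _ (cst 0) (fun n => C * fine (M (T n)))).
  - by apply: nearW => n /=; rewrite normr_ge0/= nuC.
  - exact: cvg_cst.
  - by rewrite -[X in _ --> X](mulr0 C); apply: cvgMr.
have -> : (fun n => \sum_(k < n) nu (U `&` E k)) = (fun n => nu U - nu (T n)).
  by apply/funext => n; rewrite (nuT n) addrK.
by rewrite -[X in _ --> X]subr0; apply: cvgB => //; exact: cvg_cst.
Qed.

Section charge_on_finite_set.
Variables (nu : set W -> R) (C : R) (D : set W).
Hypotheses (nuD : fin_additive nu) (nuC : bounded_by_measure nu C) (fD : fin_meas M D).

Let nuDom A := if pselect (measurable A) then (nu (A `&` D))%:E else 0%E.

Let fAD A : measurable A -> fin_meas M (A `&` D).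
Proof. by move=> mA; rewrite setIC; exact: fin_measI. Qed.

Lemma bounded_by_measure_set0 : nu set0 = 0.
Proof.
have := @nuC set0; rewrite measure0 mulr0 normr_le0 => /(_ _)/eqP; apply.
by split => //; rewrite measure0.
Qed.

Let nuDom0 : nuDom set0 = 0%E.
Proof. by rewrite /nuDom; case: pselect => //= _; rewrite set0I bounded_by_measure_set0. Qed.

Let nuDom_fin A : measurable A -> nuDom A \is a fin_num.
Proof. by move=> mA; rewrite /nuDom; case: pselect. Qed.

Let nuDom_sigma : semi_sigma_additive nuDom.
Proof.
move=> E mE tE mUE; rewrite /nuDom; case: pselect => //= _.
have -> : (fun n => \sum_(0 <= i < n) (if pselect (measurable (E i)) then (nu (E i `&` D))%:E else 0))%E
   = (fun n => (\sum_(k < n) nu ((\bigcup_k E k `&` D) `&` E k))%:E).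
  apply/funext => n; rewrite big_mkord -sumEFin; apply: eq_bigr => i _.
  case: pselect => //= _; congr (nu _)%:E.
  apply/seteqP; split => x; first by move=> [Ex Dx]; split => //; split => //; exists i.
  by move=> [[_ Dx] Ex].
apply/fine_cvgP; split.
  by apply: nearW.
by apply: (fin_additive_series nuD nuC _ mE tE); [exact: fAD | move=> x []].
Qed.

HB.instance Definition _ := @isCharge.Build _ _ _ nuDom nuDom0 nuDom_fin nuDom_sigma.

Lemma density_on_fin_meas : 0 <= C -> exists e : W -> R, [/\ measurable_fun setT e,
  (forall x, `|e x| <= C) &
  forall A, measurable A -> A `<=` D -> nu A = \int[M]_(x in A) e x].
Proof.
move=> C0.
have dom : nuDom `<< M.
  move=> A A0 B mB BA; rewrite /nuDom; case: pselect => //= _.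
  have := nuC (fAD mB).
  have -> : M (B `&` D) = 0%E.
    by apply: A0 => //; [exact: (fAD mB).1 | move=> x [/BA]].
  by rewrite mulr0 normr_le0 => /eqP ->.
have fi := Radon_Nikodym_integrable dom.
have ff x := Radon_Nikodym_fin_num x dom.
have fE A := @Radon_Nikodym_integral _ _ _ nuDom M A dom.
set f := Radon_Nikodym _ _ in fi ff fE.
have mf : measurable_fun setT (fine \o f).
  by apply: measurableT_comp => //; exact: measurable_int fi.
have nuE A : measurable A -> A `<=` D -> (nu A)%:E = (\int[M]_(x in A) (fine (f x))%:E)%E.
  move=> mA AD; transitivity (nuDom A).
    by rewrite /nuDom; case: pselect => //= _; rewrite (_ : A `&` D = A)//; apply/setIidPl.
  by rewrite fE//; apply: eq_integral => x _; rewrite fineK.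
have fint A : measurable A -> M.-integrable A (EFin \o (fine \o f)).
  move=> mA; apply: (integrableS measurableT) => //.
  by apply: eq_integrable fi => // x _ /=; rewrite fineK.
have mlt (c : R) (g : W -> R) : measurable_fun setT g -> measurable [set x | c < g x].
  move=> mg; have -> : [set x | c < g x] = setT `&` g @^-1` `]c, +oo[.
    by apply/seteqP; split => x /=; rewrite in_itv/= andbT => // -[].
  by apply: mg.
(* Where [s * f] exceeds [C], the integral of [s * f - C] over any subset is non-negative, and
   non-positive by domination. The signs [s = 1] and [s = -1] treat the two sides of the bound. *)
have null_gt s : (s = 1) \/ (s = -1) -> M (D `&` [set x | C < s * fine (f x)]) = 0%E.
  move=> s1; set A := _ `&` _.
  have fA : fin_meas M A.
    by apply: fin_measI => //; apply: mlt; exact: measurable_funM.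
  have AD : A `<=` D by move=> x [].
  have : ae_eq M A (fun x => (s * fine (f x) - C)%:E) (EFin \o cst 0).
    apply: integral_ae_eq => //; first exact: fA.1.
    - have -> : (fun x => (s * fine (f x) - C)%:E) =
          (fun x => s%:E * (EFin \o (fine \o f)) x - (EFin \o cst C) x)%E.
        by apply/funext => x; rewrite /= EFinB EFinM.
      apply: integrableB; first exact: fA.1.
        by apply: integrableZl; [exact: fA.1|apply: fint; exact: fA.1].
      by apply: (bmf_integrable fA); exact: bmf_cst.
    - exact/measurable_EFinP/measurable_cst.
    - move=> E EA mE; rewrite [RHS]integral0_eq//.
      have fE' : fin_meas M E.
        by split => //; apply: le_lt_trans fA.2; apply: le_measure; rewrite ?inE//; exact: fA.1.
      apply/eqP; rewrite eq_le; apply/andP; split; last first.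
        by apply: integral_ge0 => x /EA[_ /ltW]; rewrite lee_fin subr_ge0.
      under eq_integral do rewrite EFinB EFinM.
      rewrite integralB//; last 2 first.
        by apply: integrableZl => //; apply: fint.
        by apply: (bmf_integrable fE'); exact: bmf_cst.
      rewrite integralZl//; last exact: fint.
      rewrite -nuE//; last exact: subset_trans EA AD.
      rewrite integral_cst// -(fin_meas_fineK fE') -EFinM -EFinM -EFinB lee_fin subr_le0.
      apply: le_trans (nuC fE'); rewrite -[leRHS]mul1r.
      have -> : (1 : R) = `|s| by case: s1 => ->; rewrite ?normrN normr1.
      by rewrite -normrM ler_norm.
  move=> AA; apply/negligibleP; first exact: fA.1.
  apply: negligibleS AA => x Ax /= /(_ Ax) [].
  by apply/eqP; rewrite gt_eqF// subr_gt0; exact: Ax.2.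
(* The Radon-Nikodym derivative obeys the bound only almost everywhere; the value 0 on the
   exceptional set makes it hold at every point. *)
pose e x := if `|fine (f x)| <= C then fine (f x) else 0.
have me : measurable_fun setT e.
  apply: measurable_fun_ifT => //=.
  by apply: measurable_fun_ler => //; exact: measurableT_comp.
exists e; split => //.
  by move=> x; rewrite /e; case: ifP => // _; rewrite normr0.
move=> A mA AD; apply: EFin_inj; rewrite nuE//.
rewrite fineK; last first.
  have fA : fin_meas M A.
    by split => //; apply: le_lt_trans fD.2; apply: le_measure; rewrite ?inE//; exact: fD.1.
  apply: integrable_fin_num => //; apply: (bmf_integrable fA); split => //.
  by exists C => x; rewrite /e; case: ifP => // _; rewrite normr0.
apply: ae_eq_integral => //.
- exact/measurable_funTS/measurable_EFinP.
- exact/measurable_funTS/measurable_EFinP.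
- have n1 : M.-negligible (D `&` [set x | C < 1 * fine (f x)]).
    apply/negligibleP; last by apply: null_gt; left.
    by apply: measurableI; [exact: fD.1|apply: mlt; exact: measurable_funM].
  have n2 : M.-negligible (D `&` [set x | C < -1 * fine (f x)]).
    apply/negligibleP; last by apply: null_gt; right.
    by apply: measurableI; [exact: fD.1|apply: mlt; exact: measurable_funM].
  apply: negligibleS (negligibleU n1 n2) => x /= /not_implyP[Ax].
  rewrite /e; case: ifPn => // ; rewrite -ltNge ltr_normr => /orP[h|h] _.
    by left; split; [exact: AD|rewrite /= mul1r].
  by right; split; [exact: AD|rewrite /= mulN1r].
Qed.
End charge_on_finite_set.

(** The local densities are glued along a partition into sets of finite measure. By
    [fin_additive_series] both [nu] and the integral of the glued function are sums over the pieces,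
    where they agree. *)
Theorem density_of_bounded (nu : set W -> R) C : 0 <= C ->
  fin_additive nu -> bounded_by_measure nu C ->
  exists e : W -> R, [/\ measurable_fun setT e, (forall x, `|e x| <= C) &
    forall A, fin_meas M A -> nu A = \int[M]_(x in A) e x].
Proof.
move=> C0 nuD nuC; have /sigma_finiteP[F [FT _ Ff]] := sigma_finiteT M.
pose E := seqDU F.
have tE : trivIset setT E by exact: trivIset_seqDU.
have ET : \bigcup_k E k = setT by rewrite -seqDU_bigcup_eq -FT.
have fE k : fin_meas M (E k).
  rewrite /E /seqDU; apply: fin_measD; first exact: Ff.
  by rewrite -bigcup_mkord; apply: bigcup_measurable => i _; exact: (Ff i).1.
have /choice[f fP] := fun k => density_on_fin_meas nuD nuC (fE k) C0.
have /choice[n nP] x : exists k, E k x.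
  by have : [set: W] x by []; rewrite -ET => -[k _ Ekx]; exists k.
pose e x := f (n x) x.
have eE k x : E k x -> e x = f k x.
  by move=> Ekx; have /= := tE (n x) k I I (ex_intro _ x (conj (nP x) Ekx)); rewrite /e => ->.
have eC x : `|e x| <= C by have [_ h _] := fP (n x); exact: h.
have me : measurable_fun setT e.
  move=> _ B mB; rewrite setTI.
  have -> : e @^-1` B = \bigcup_k (E k `&` (f k @^-1` B)).
    apply/seteqP; split => x.
      by move=> Bx; exists (n x) => //; split.
    by move=> [k _ [Ekx Bx]]; rewrite /preimage/= (eE k).
  apply: bigcup_measurable => k _; apply: measurableI; first exact: (fE k).1.
  by rewrite -[X in measurable X]setTI; have [mfk _ _] := fP k; exact: mfk.
have be : bmf e by split => //; exists C.
exists e; split => // A fA.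
pose rho A := \int[M]_(x in A) e x.
have rhoD : fin_additive rho by move=> A1 A2 f1 f2 A12; exact: Rint_setU.
have rhoC : bounded_by_measure rho C by move=> A1 f1; exact: Rint_norm_bound.
have mE k : measurable (E k) := (fE k).1.
have AE : A `<=` \bigcup_k E k by rewrite ET.
have c1 := fin_additive_series nuD nuC fA mE tE AE.
have c2 := fin_additive_series rhoD rhoC fA mE tE AE.
have eqE : (fun m => \sum_(k < m) nu (A `&` E k)) = (fun m => \sum_(k < m) rho (A `&` E k)).
  apply/funext => m; apply: eq_bigr => k _; have [_ _ h] := fP k.
  rewrite h; [ | exact: (measurableI _ _ fA.1 (mE k)) | by move=> x []].
  by apply: eq_Rintegral => x; rewrite inE => -[_ /eE ->].
by rewrite eqE in c1; exact: cvg_unique c1 c2.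
Qed.
End Density.

(** * Zero-one laws *)

Section AlmostEverywhere.
Context {R : realType}.

Lemma ae_measure0 {d} {W : measurableType d} (M : {measure set W -> \bar R})
    (A : set W) : measurable A -> M A = 0%E <-> {ae M, forall x, ~ A x}.
Proof.
move=> mA; split.
  by move=> A0; exists A; split => // x /contrapT.
move=> h; apply/negligibleP => //; apply: negligibleS h => x Ax /=; exact.
Qed.

Lemma ae_comp {d d'} {W : measurableType d} {V : measurableType d'}
    (M : {measure set W -> \bar R}) (M' : {measure set V -> \bar R})
    (T : W -> V) (P : V -> Prop) : measurable_fun setT T ->
  (forall A, measurable A -> M' A = 0%E -> M (T @^-1` A) = 0%E) ->
  {ae M', forall y, P y} -> {ae M, forall x, P (T x)}.
Proof.
move=> mT MT [N [mN N0 PN]]; exists (T @^-1` N); split.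
- by rewrite -[X in measurable X]setTI; exact: mT.
- exact: MT.
- by move=> x nP; exact: PN.
Qed.

Section product.
Context {d1 d2} {W1 : measurableType d1} {W2 : measurableType d2}.
Variables (m1 : {sigma_finite_measure set W1 -> \bar R}).
Variables (m2 : {sigma_finite_measure set W2 -> \bar R}).

Let null_xsection (N : set (W1 * W2)) : measurable N ->
  (m1 \x m2)%E N = 0%E <-> {ae m1, forall x, m2 (xsection N x) = 0%E}.
Proof.
move=> mN; have mf := measurable_fun_xsection m2 mN.
have -> : (m1 \x m2)%E N = (\int[m1]_x `|(m2 \o xsection N) x|)%E.
  by apply: eq_integral => x _; rewrite gee0_abs.
split.
  move/(ae_eq_integral_abs m1 measurableT mf) => h.
  by apply: filterS h => x /(_ I).
move=> h; apply/(ae_eq_integral_abs m1 measurableT mf).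
by apply: filterS h => x hx _.
Qed.

Let null_ysection (N : set (W1 * W2)) : measurable N ->
  (m1 \x m2)%E N = 0%E <-> {ae m2, forall y, m1 (ysection N y) = 0%E}.
Proof.
move=> mN; have mf := measurable_fun_ysection m1 mN.
have -> : (m1 \x m2)%E N = (\int[m2]_y `|(m1 \o ysection N) y|)%E.
  rewrite (product_measure_unique (m1 := m1) (m2 := m2) (m' := (m1 \x^ m2)%E))//.
    by apply: eq_integral => x _; rewrite gee0_abs.
  by move=> A B mA mB; rewrite /= product_measure2E.
split.
  move/(ae_eq_integral_abs m2 measurableT mf) => h.
  by apply: filterS h => x /(_ I).
move=> h; apply/(ae_eq_integral_abs m2 measurableT mf).
by apply: filterS h => x hx _.
Qed.

Lemma ae_fubini1 (P : W1 * W2 -> Prop) : {ae (m1 \x m2)%E, forall z, P z} ->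
  {ae m1, forall x, {ae m2, forall y, P (x, y)}}.
Proof.
move=> [N [mN N0 PN]]; have := (null_xsection mN).1 N0; apply: filterS => x Nx0.
exists (xsection N x); split => //; first exact: measurable_xsection.
by move=> y nP; rewrite /xsection/= inE; exact: PN.
Qed.

Lemma ae_fubini2 (P : W1 * W2 -> Prop) : {ae (m1 \x m2)%E, forall z, P z} ->
  {ae m2, forall y, {ae m1, forall x, P (x, y)}}.
Proof.
move=> [N [mN N0 PN]]; have := (null_ysection mN).1 N0; apply: filterS => x Nx0.
exists (ysection N x); split => //; first exact: measurable_ysection.
by move=> y nP; rewrite /ysection/= inE; exact: PN.
Qed.

Lemma ae_prod1 (P : W1 * W2 -> Prop) : measurable [set z | P z] ->
  {ae m1, forall x, {ae m2, forall y, P (x, y)}} -> {ae (m1 \x m2)%E, forall z, P z}.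
Proof.
move=> mP h; have mN : measurable (~` [set z | P z]) by exact: measurableC.
exists (~` [set z | P z]); split => //; apply/null_xsection => //.
apply: filterS h => x hx; apply/ae_measure0; first exact: measurable_xsection.
by apply: filterS hx => y Pxy; rewrite /xsection/= inE; exact.
Qed.

Lemma ae_prod2 (P : W1 * W2 -> Prop) : measurable [set z | P z] ->
  {ae m2, forall y, {ae m1, forall x, P (x, y)}} -> {ae (m1 \x m2)%E, forall z, P z}.
Proof.
move=> mP h; have mN : measurable (~` [set z | P z]) by exact: measurableC.
exists (~` [set z | P z]); split => //; apply/null_ysection => //.
apply: filterS h => x hx; apply/ae_measure0; first exact: measurable_ysection.
by apply: filterS hx => y Pxy; rewrite /ysection/= inE; exact.
Qed.

End product.
End AlmostEverywhere.

Section Ergodic.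
Context {d} {W : measurableType d} {R : realType}.
Variable M : {measure set W -> \bar R}.

Lemma measurable_lt_cst (u : W -> R) r : measurable_fun setT u ->
  measurable [set x | u x < r].
Proof.
move=> mu; have -> : [set x | u x < r] = setT `&` u @^-1` `]-oo, r[.
  by apply/seteqP; split => x /=; rewrite in_itv/= => // -[].
exact: mu.
Qed.

Lemma ae_const_of_zero_one (u : W -> R) : bmf u ->
  (forall r, M [set x | u x < r] = 0%E \/ M (~` [set x | u x < r]) = 0%E) ->
  exists c, {ae M, forall x, u x = c}.
Proof.
move=> [mu [C uC]] h01.
have mlt r : measurable [set x | u x < r] by exact: measurable_lt_cst.
pose P := [set r | M [set x | u x < r] = 0%E].
(* As [u < C + 1] everywhere, the first case means that [M] is zero and any constant will do; in the
   second, [C + 1] bounds [P], and the constant is [sup P]. *)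
have [PC|nPC] := pselect (P (C + 1)).
  exists 0; have /(ae_measure0 _ (mlt _)) := PC; apply: filterS => x h; exfalso; apply: h => /=.
  by have := uC x; rewrite ler_norml => /andP[] *; lra.
have Pmono r s : P s -> r <= s -> P r.
  move=> /(ae_measure0 _ (mlt s)) hs rs; apply/(ae_measure0 _ (mlt r)).
  by apply: filterS hs => x h /= ur; apply: h; exact: lt_le_trans rs.
have supP : has_sup P.
  split.
    exists (- C); rewrite /P /= (_ : [set _ | _] = set0) ?measure0//.
    apply/seteqP; split => // x /=.
    by have := uC x; rewrite ler_norml => /andP[] *; lra.
  exists (C + 1) => r Pr; rewrite leNgt; apply/negP => Cr.
  by apply: nPC; apply: Pmono Pr (ltW Cr).
pose c := sup P; exists c.
have lo n : {ae M, forall x, ~ (u x < c - n.+1%:R^-1)}.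
  apply/(ae_measure0 _ (mlt _)).
  have [r Pr cr] := @sup_adherent _ P n.+1%:R^-1 (ltac:(by rewrite invr_gt0)) supP.
  by apply: Pmono Pr (ltW cr).
have hi n : {ae M, forall x, u x < c + n.+1%:R^-1}.
  case: (h01 (c + n.+1%:R^-1)) => [Pc|].
    have := sup_upper_bound supP Pc.
    by rewrite gerDl leNgt invr_gt0 ltr0n.
  move/(ae_measure0 _ (measurableC (mlt _))); apply: filterS => x /=.
  by rewrite /= => /contrapT.
have {}lo := ae_foralln lo; have {}hi := ae_foralln hi.
apply: filterS2 lo hi => x lox hix.
apply/eqP; rewrite eq_le; apply/andP; split; rewrite leNgt; apply/negP => ux.
  have [n nP] := ltr_add_invr ux.
  by have := lt_trans nP (hix n); rewrite ltxx.
have [n nP] := ltr_add_invr ux.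
by apply: (lox n); rewrite ltrBrDr.
Qed.

Variable T : W -> W.
Hypotheses (mT : measurable_fun setT T)
  (MT : forall A, measurable A -> M (T @^-1` A) = M A) (eT : ergodic M T).

Lemma ae_iter (P : W -> Prop) :
  {ae M, forall x, P x} -> {ae M, forall x n, P (iter n T x)}.
Proof.
move=> h; apply: ae_foralln; elim=> [//|n IH].
have := @ae_comp R _ _ W W M M T (fun x => P (iter n T x)) mT _ IH.
have NT A : measurable A -> M A = 0%E -> M (T @^-1` A) = 0%E by move=> mA; rewrite MT.
by move=> /(_ NT); apply: filterS => x; rewrite iterSr.
Qed.

(* The set of points that visit [A] infinitely often is strictly invariant. *)
Lemma ergodic_ae_zero_one (A : set W) : measurable A ->
  {ae M, forall x, A (T x) <-> A x} -> M A = 0%E \/ M (~` A) = 0%E.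
Proof.
move=> mA hA; pose E := \bigcap_n \bigcup_(k in [set k | (n <= k)%N]) (iter k T @^-1` A).
have mTk k : measurable_fun setT (iter k T).
  elim: k => [|k IH]; first exact: measurable_id.
  by rewrite (_ : iter k.+1 T = T \o iter k T)//; exact: measurableT_comp.
have mE : measurable E.
  apply: bigcap_measurable => // n _; apply: bigcup_measurable => k _.
  by rewrite -[X in measurable X]setTI; exact: mTk.
have TE : T @^-1` E = E.
  apply/seteqP; split => x Ex n _.
    have [k /= nk Ak] := Ex n I; exists k.+1; first exact: leqW.
    by rewrite /preimage/= -iterS iterSr.
  have [[//|k] /= nk Ak] := Ex n.+1 I; exists k => //.
  by move: Ak; rewrite /preimage/= -iterS iterSr.
have EA : {ae M, forall x, E x <-> A x}.
  apply: filterS (ae_iter hA) => x hx.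
  have hk k : A (iter k T x) <-> A x.
    by elim: k => // k IH; rewrite iterS hx.
  split.
    by move=> /(_ 0%N I)[k _] /hk.
  by move=> Ax n _; exists n => //=; rewrite /preimage/= hk.
case: (eT mE TE) => E0; [left|right].
  apply/(ae_measure0 _ mA); move/(ae_measure0 _ mE) : E0 => E0.
  by apply: filterS2 E0 EA => x nE EAx /EAx.
apply/(ae_measure0 _ (measurableC mA)); move/(ae_measure0 _ (measurableC mE)) : E0 => E0.
by apply: filterS2 E0 EA => x nE EAx nA; apply: nE => /EAx.
Qed.

Lemma ergodic_ae_const (u : W -> R) : bmf u -> {ae M, forall x, u (T x) = u x} ->
  exists c, {ae M, forall x, u x = c}.
Proof.
move=> bu hu; apply: ae_const_of_zero_one => // r.
apply: ergodic_ae_zero_one; first by apply: measurable_lt_cst; exact: bu.1.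
by apply: filterS hu => x /= ->.
Qed.

End Ergodic.

Section HaarAction.
Context {R : realType} {G : topologicalZmodType}.
Variable lam : {sigma_finite_measure set (Borel G) -> \bar R}.
Hypothesis lam_haar : haar lam.
Context {d} {Y : measurableType d} {nu : probability Y R}.
Variable S : Borel G -> Y -> Y.
Hypotheses (mS : measurable_fun setT (fun p : Borel G * Y => S p.1 p.2))
  (S_add : forall g h y, S (g + h) y = S g (S h y))
  (S_ergodic : forall A, measurable A -> (forall g, S g @^-1` A = A) ->
     nu A = 0%E \/ nu (~` A) = 0%E).

Lemma haar_setT_neq0 : lam setT != 0%E.
Proof.
have [_ [_ lamU]] := lam_haar; rewrite gt_eqF//; apply: lamU; first exact: openT.
by exists (0 : G).
Qed.

Lemma haar_translate (g : Borel G) (A : set (Borel G)) : measurable A ->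
  lam ((fun x => x + g) @^-1` A) = lam A.
Proof.
move=> mA; have [lamg _] := lam_haar; rewrite -[RHS](lamg g)//.
by congr (lam _); apply/seteqP; split => x; rewrite /preimage/= addrC.
Qed.

(** [S_ergodic] concerns strictly invariant sets, while here every [g] has its own exceptional set.
    The set [D] of the points [y] with [S g y] in [E] for almost all [g] is strictly invariant, as
    [lam] is invariant under translations, and agrees with [E] almost everywhere by Fubini. *)
Lemma action_ae_zero_one (E : set Y) : measurable E ->
  (forall g, {ae nu, forall y, E (S g y) <-> E y}) -> nu E = 0%E \/ nu (~` E) = 0%E.
Proof.
move=> mE SE.
pose N := [set p : Y * Borel G | ~ E (S p.2 p.1)].
have mN : measurable N.
  rewrite (_ : N = ~` (setT `&` (fun p : Y * Borel G => S p.2 p.1) @^-1` E)).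
    apply: measurableC.
    have mf : measurable_fun setT (fun p : Y * Borel G => (p.2, p.1)).
      exact: measurable_fun_pair.
    by have := measurableT_comp mS mf; apply.
  by rewrite setTI.
pose D := [set y | lam (xsection N y) = 0%E].
have mD : measurable D.
  have := measurable_fun_xsection lam mN measurableT (emeasurable_set1 0%E).
  by rewrite setTI.
have DS g : S g @^-1` D = D.
  have SNg y : lam (xsection N (S g y)) = lam (xsection N y).
    rewrite -(haar_translate g (measurable_xsection y mN)).
    by congr (lam _); apply/seteqP; split => h;
      rewrite /preimage /xsection/= !inE /N/= S_add.
  by apply/seteqP; split => y; rewrite /D /preimage/= SNg.
have : {ae (nu \x lam)%E, forall p, E (S p.2 p.1) <-> E p.1}.
  apply: ae_prod2; last by apply: aeW => g; exact: SE.
  rewrite (_ : [set _ | _] = (N `&` (~` E `*` setT)) `|` (~` N `&` (E `*` setT))).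
    by apply: measurableU; apply: measurableI => //; try exact: measurableC;
       apply: measurableX => //; exact: measurableC.
  apply/seteqP; split => -[y g] /=; rewrite /N/=.
    move=> h; have [Ey|nEy] := pselect (E y).
      by right; split => //; rewrite /= notK => //; exact/h.
    by left; split => //= /h.
  by move=> [[nE [nEy _]]|[/contrapT EE [Ey _]]].
move=> /ae_fubini1 h.
have DE : {ae nu, forall y, D y <-> E y}.
  apply: filterS h => y [B [mB B0 hB]]; split.
    move=> Dy; apply: contrapT => nEy.
    have : (lam setT <= lam B + lam (xsection N y))%E.
      rewrite (_ : setT = B `|` xsection N y).
        by apply: measureU2 => //; exact: measurable_xsection.
      apply/seteqP; split => // g _; have [Bg|nBg] := pselect (B g); first by left.
      right; rewrite /xsection/= inE /N/= => ES; apply: nBg; apply: hB => -[/(_ ES)]//.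
    by rewrite B0 Dy adde0 leNgt lt0e haar_setT_neq0 measure_ge0.
  move=> Ey; apply/eqP; rewrite eq_le measure_ge0 andbT -B0.
  apply: le_measure; rewrite ?inE//; first exact: measurable_xsection.
  by move=> g; rewrite /xsection/= inE /N/= => nE; apply: hB => -[_ /(_ Ey)].
case: (S_ergodic mD DS) => D0; [left|right].
  apply/(ae_measure0 _ mE); move/(ae_measure0 _ mD) : D0 => D0.
  by apply: filterS2 D0 DE => x nD DEx /DEx.
apply/(ae_measure0 _ (measurableC mE)); move/(ae_measure0 _ (measurableC mD)) : D0 => D0.
by apply: filterS2 D0 DE => x nD DEx nE; apply: nD => /DEx.
Qed.

Lemma action_ae_const (t : Y -> R) : bmf t ->
  (forall g, {ae nu, forall y, t (S g y) = t y}) -> exists c, {ae nu, forall y, t y = c}.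
Proof.
move=> bt ht; apply: ae_const_of_zero_one => // r.
apply: action_ae_zero_one; first by apply: measurable_lt_cst; exact: bt.1.
by move=> g; apply: filterS (ht g) => x /= ->.
Qed.

End HaarAction.

(** * Partial integrals, skew products and mean square estimates *)

Lemma bmf_comp {d d'} {W : measurableType d} {V : measurableType d'} {R : realType}
    (f : V -> R) (g : W -> V) : bmf f -> measurable_fun setT g -> bmf (fun x => f (g x)).
Proof.
move=> [mf [C Cf]] mg; split; last by exists C => x; exact: Cf.
exact: measurableT_comp mf mg.
Qed.

Section PartialIntegrals.
Context {R : realType} {d1 d2} {W : measurableType d1} {Y : measurableType d2}.
Variables (M : {sigma_finite_measure set W -> \bar R}) (nu : probability Y R).
Implicit Type f : W * Y -> R.

Lemma bmf_section1 f w : bmf f -> bmf (fun y => f (w, y)).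
Proof. by move=> bf; apply: bmf_comp bf _; exact: pair1_measurable. Qed.

Lemma bmf_section2 f y : bmf f -> bmf (fun w => f (w, y)).
Proof. by move=> bf; apply: bmf_comp bf _; exact: pair2_measurable. Qed.

Lemma fin_meas_probability (A : set Y) : measurable A -> fin_meas nu A.
Proof. by move=> mA; split => //; rewrite (le_lt_trans (probability_le1 _ _)) ?ltry. Qed.

Let fT := fin_meas_probability measurableT.

Lemma Rint_probability_cst (c : R) : \int[nu]_y c = c.
Proof.
rewrite Rintegral_cst// -[RHS]mulr1; congr (_ * _).
exact: (congr1 fine (probability_setT nu)).
Qed.

Lemma Rint_probability_norm_le (g : Y -> R) C : bmf g -> (forall y, `|g y| <= C) ->
  `|\int[nu]_y g y| <= C.
Proof.
move=> bg gC; apply: le_trans (Rint_norm_bound fT bg (fun y _ => gC y)) _.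
rewrite -[leRHS]mulr1 le_eqVlt; apply/orP; left; apply/eqP; congr (_ * _).
exact: (congr1 fine (probability_setT nu)).
Qed.

Lemma bmf_int2 f : bmf f -> bmf (fun w => \int[nu]_y f (w, y)).
Proof.
move=> bf; have [mf [C Cf]] := bf; split; last first.
  by exists C => w; apply: Rint_probability_norm_le => //; exact: bmf_section1.
(* Adding the bound [C] makes the integrand non-negative, as the measurability part of Tonelli's
   theorem requires. *)
have -> : (fun w => \int[nu]_y f (w, y)) = (fun w => \int[nu]_y (f (w, y) + C) - C).
  apply/funext => w; rewrite RintD//; [|exact: bmf_section1|exact: bmf_cst].
  by rewrite Rint_probability_cst addrK.
apply: measurable_funB => //; apply: measurableT_comp => //.
apply: (measurable_fun_fubini_tonelli_F (m2 := nu) (fun p => (f p + C)%:E)).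
  by apply/measurable_EFinP; apply: measurable_funD.
by move=> p; rewrite lee_fin; have := Cf p; rewrite ler_norml => /andP[] *; lra.
Qed.

Variable A : set W.
Hypothesis fA : fin_meas M A.

Lemma bmf_int1 f : bmf f -> bmf (fun y => \int[M]_(w in A) f (w, y)).
Proof.
move=> bf; have [mf [C Cf]] := bf; split; last first.
  exists (C * fine (M A)) => y; apply: (Rint_norm_bound fA (bmf_section2 y bf)).
  by move=> w _; exact: Cf.
have -> : (fun y => \int[M]_(w in A) f (w, y)) =
    (fun y => \int[M]_(w in A) (f (w, y) + C) - C * fine (M A)).
  apply/funext => y; rewrite RintD//; [|exact: bmf_section2|exact: bmf_cst].
  by rewrite Rintegral_cst ?addrK//; exact: fA.1.
apply: measurable_funB => //; apply: measurableT_comp => //.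
pose g (p : W * Y) := (\1_A p.1 * (f p + C))%:E.
have -> : (fun y => \int[M]_(w in A) (f (w, y) + C)%:E)%E = fubini_G M g.
  apply/funext => y; rewrite integral_mkcond; apply: eq_integral => w _.
  rewrite patchE /g/= indicE; case: (w \in A); first by rewrite mul1r.
  by rewrite mul0r.
apply: measurable_fun_fubini_tonelli_G.
  apply/measurable_EFinP; apply: measurable_funM; last exact: measurable_funD.
  by apply: measurableT_comp => //; apply: measurable_indic; exact: fA.1.
move=> p; rewrite /g lee_fin mulr_ge0//.
by have := Cf p; rewrite ler_norml => /andP[] *; lra.
Qed.

Lemma fin_meas_strip : fin_meas (M \x nu)%E (A `*` [set: Y]).
Proof.
split; first by apply: measurableX => //; exact: fA.1.
have [mA Aoo] := fA; rewrite product_measure1E// lte_mul_pinfty//.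
  by rewrite ge0_fin_numE.
exact: fT.2.
Qed.

Let strip_integrable f : bmf f ->
  (M \x nu)%E.-integrable setT ((EFin \o f) \_ (A `*` [set: Y])).
Proof.
move=> bf; apply: (integrable_mkcond (EFin \o f) fin_meas_strip.1).1.
exact: (bmf_integrable (M := (M \x nu)%E) fin_meas_strip bf).
Qed.

Let integral_strip f : bmf f ->
  (\int[M]_w \int[nu]_y ((EFin \o f) \_ (A `*` [set: Y])) (w, y))%E =
  (\int[M]_(w in A) (\int[nu]_y f (w, y))%:E)%E.
Proof.
move=> bf; rewrite [RHS]integral_mkcond; apply: eq_integral => w _; rewrite patchE.
have [wA|wA] := boolP (w \in A).
  rewrite fineK; last first.
    by apply: integrable_fin_num => //; apply: (bmf_integrable fT); exact: bmf_section1.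
  apply: eq_integral => y _; rewrite patchE ifT//.
  by rewrite in_setX wA in_setT.
rewrite integral0_eq// => y _; rewrite patchE ifF//.
by apply/negbTE; rewrite in_setX negb_and wA.
Qed.

Lemma Rint_strip f : bmf f ->
  \int[(M \x nu)%E]_(p in A `*` [set: Y]) f p = \int[M]_(w in A) (\int[nu]_y f (w, y)).
Proof.
move=> bf; congr fine; rewrite -integral_strip// integral12_prod_meas1.
  by rewrite [LHS]integral_mkcond.
exact: strip_integrable.
Qed.

Lemma Rint_fubini f : bmf f ->
  \int[M]_(w in A) (\int[nu]_y f (w, y)) = \int[nu]_y (\int[M]_(w in A) f (w, y)).
Proof.
move=> bf; congr fine; rewrite -integral_strip// Fubini; last exact: strip_integrable.
apply: eq_integral => y _; rewrite fineK; last first.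
  apply: integrable_fin_num; first exact: fA.1.
  by apply: (bmf_integrable fA); exact: bmf_section2.
rewrite [RHS]integral_mkcond; apply: eq_integral => w _.
by rewrite !patchE in_setX in_setT andbT.
Qed.

End PartialIntegrals.

Lemma skew_product_preserves {R : realType} {d1 d2} {W : measurableType d1}
    {Y : measurableType d2} (M : {sigma_finite_measure set W -> \bar R})
    (nu : {sigma_finite_measure set Y -> \bar R}) (U : W -> W) (s : W -> Y -> Y) :
  measurable_fun setT U -> (forall A, measurable A -> M (U @^-1` A) = M A) ->
  measurable_fun setT (fun p : W * Y => s p.1 p.2) ->
  (forall w A, measurable A -> nu (s w @^-1` A) = nu A) ->
  forall E, measurable E ->
    (M \x nu)%E ((fun p : W * Y => (U p.1, s p.1 p.2)) @^-1` E) = (M \x nu)%E E.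
Proof.
move=> mU MU ms nus E mE; rewrite /product_measure1.
transitivity (\int[M]_x ((nu \o xsection E) \o U) x)%E.
  apply: eq_integral => w _ /=.
  rewrite -(nus w (xsection E (U w))); last exact: measurable_xsection.
  by congr (nu _); apply/seteqP; split => y; rewrite /xsection/preimage/= !inE.
have := @ge0_integral_pushforward _ _ W W R U mU M setT (nu \o xsection E) measurableT.
rewrite preimage_setT => <-//.
- by apply: eq_measure_integral => A mA _; exact: MU.
- exact: measurable_fun_xsection.
Qed.

Section SquareIntegrals.
Context {R : realType} {d} {W : measurableType d} (M : {measure set W -> \bar R}).

(** Cauchy-Schwarz against the constant 1, obtained from the square of [f - c] with [c = I / m]. *)
Lemma Rint_sqr_le (A : set W) (f : W -> R) : fin_meas M A -> bmf f ->
  (\int[M]_(w in A) f w) ^+ 2 <= fine (M A) * \int[M]_(w in A) (f w ^+ 2).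
Proof.
move=> fA bf; set m := fine (M A); set I := \int[M]_(w in A) f w.
have m0 : 0 <= m by apply: fine_ge0.
have key c : 0 <= \int[M]_(w in A) (f w ^+ 2) - 2 * c * I + c ^+ 2 * m.
  have <- : \int[M]_(w in A) ((f w ^+ 2 - 2 * c * f w) + c ^+ 2) =
      \int[M]_(w in A) (f w ^+ 2) - 2 * c * I + c ^+ 2 * m.
    rewrite RintD//; [|by apply: bmfB; [exact: bmf_sqr|exact: bmfZ]|exact: bmf_cst].
    rewrite RintB//; [|exact: bmf_sqr|exact: bmfZ].
    by rewrite RintZ// Rintegral_cst//; exact: fA.1.
  apply: Rintegral_ge0 => w _.
  have -> : f w ^+ 2 - 2 * c * f w + c ^+ 2 = (f w - c) ^+ 2 by ring.
  exact: sqr_ge0.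
have [m00|m_neq0] := eqVneq m 0.
  have [mf [C Cf]] := bf.
  have := Rint_norm_bound fA bf (fun x _ => Cf x).
  by rewrite -/m -/I m00 mulr0 normr_le0 => /eqP ->; rewrite expr0n/= mul0r.
have m_gt0 : 0 < m by rewrite lt_neqAle eq_sym m_neq0.
have := key (I / m); rewrite -(pmulr_rge0 _ m_gt0).
have -> : m * (\int[M]_(w in A) f w ^+ 2 - 2 * (I / m) * I + (I / m) ^+ 2 * m) =
   m * (\int[M]_(w in A) f w ^+ 2) - I ^+ 2 by field.
by rewrite subr_ge0.
Qed.

Lemma Rint_norm_le_ae (A : set W) (f : W -> R) C : fin_meas M A -> bmf f -> 0 <= C ->
  {ae M, forall w, `|f w| <= C} -> `|\int[M]_(w in A) f w| <= C * fine (M A).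
Proof.
move=> fA bf C0 fC; pose g w := Num.max (- C) (Num.min C (f w)).
have gC w : `|g w| <= C.
  by rewrite /g ler_norml le_max lexx/= ge_max ge_min lexx/= andbT ge0_cp.
have mg : measurable_fun setT g.
  by apply: measurable_maxr => //; apply: measurable_minr => //; exact: bf.1.
rewrite (_ : \int[M]_(w in A) f w = \int[M]_(w in A) g w).
  by apply: Rint_norm_bound => //; split => //; exists C.
apply: Rint_ae => //; [exact: fA.1|exact: bf.1|].
apply: filterS fC => w; rewrite ler_norml /g => /andP[lo hi].
by rewrite min_r// max_r.
Qed.

End SquareIntegrals.

Section PreimageIntegrals.
Context {R : realType} {d} {W : measurableType d}.
Variable M : {sigma_finite_measure set W -> \bar R}.

(** This form suits weak limits, which are known only through integrals over sets. With the
    measurable left inverse [Ti], every measurable set is a preimage under [T], so the preimages are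
    enough to test equality. *)
Lemma ae_eq_of_preimages (T Ti : W -> W) (f g : W -> R) :
  measurable_fun setT T -> measurable_fun setT Ti -> cancel T Ti ->
  (forall A, measurable A -> M (T @^-1` A) = M A) -> bmf f -> bmf g ->
  (forall C, fin_meas M C -> \int[M]_(w in C) f w = \int[M]_(w in T @^-1` C) g w) ->
  {ae M, forall w, f (T w) = g w}.
Proof.
move=> mT mTi TTi MT bf bg fg; apply: ae_of_fin_meas => A fA.
apply: (ae_eq_of_Rint fA) => //; first exact: bmf_comp bf mT.
move=> E mE EA; pose C := Ti @^-1` E.
have mC : measurable C by rewrite -[X in measurable X]setTI; exact: mTi.
have TC : T @^-1` C = E by apply/seteqP; split => x; rewrite /C /preimage/= TTi.
have fE : fin_meas M E.
  by split => //; apply: le_lt_trans fA.2; apply: le_measure; rewrite ?inE//; exact: fA.1.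
have fC : fin_meas M C by split => //; rewrite -MT// TC; exact: fE.2.
by rewrite -{2}TC -fg// -[E in LHS]TC (Rint_preimage mT MT fC bf).
Qed.

End PreimageIntegrals.

(** * Approximate eigenfunctions *)

Section Eigenfunctions.
Context {R : realType} {d1 d2} {W : measurableType d1} {Y : measurableType d2}.
Variables (M : {sigma_finite_measure set W -> \bar R}) (nu : probability Y R).
Variables (G : zmodType) (U Ui : W -> W) (tau : G -> W -> W) (S : G -> Y -> Y).
Hypotheses (mU : measurable_fun setT U) (mUi : measurable_fun setT Ui)
  (UK : cancel U Ui) (MU : forall A, measurable A -> M (U @^-1` A) = M A).
Hypotheses (mtau : forall b, measurable_fun setT (tau b))
  (Mtau : forall b A, measurable A -> M (tau b @^-1` A) = M A)
  (tau0 : forall w, tau 0 w = w)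
  (tau_add : forall b c w, tau (b + c) w = tau b (tau c w)).
Hypotheses (mS : forall b, measurable_fun setT (S b))
  (nuS : forall b A, measurable A -> nu (S b @^-1` A) = nu A)
  (S_add : forall b c y, S (b + c) y = S b (S c y)).
Hypothesis inv_const : forall u : W -> R, bmf u -> {ae M, forall w, u (U w) = u w} ->
  (forall b, {ae M, forall w, u (tau b w) = u w}) -> exists c, {ae M, forall w, u w = c}.

(** The identities hold at every point, because the function of interest is built from the indicator
    of a strictly invariant set; integrals over [Y] can then be rewritten for each single [w]. *)
Definition equivariant (a : W * Y -> R) :=
  [/\ bmf a, forall w y, a (U w, y) = a (w, y) &
      forall b w y, a (tau b w, y) = a (w, S b y)].

Let V := ((W * Y -> R) * (W * Y -> R))%type.
Let D (x : V) := equivariant x.1 /\ equivariant x.2.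
Let act (b : G) (a : W * Y -> R) (p : W * Y) := a (p.1, S b p.2).
(* A pair of real functions encodes a complex one, and [rot t] multiplies it by
   [exp (i t)]. *)
Let rot (t : R) (x : V) : V :=
  ((fun p => cos t * x.1 p - sin t * x.2 p), (fun p => sin t * x.1 p + cos t * x.2 p)).
Let Sop (b : G) (x : V) : V := (act b x.1, act b x.2).

Let mSpair b : measurable_fun setT (fun p : W * Y => (p.1, S b p.2)).
Proof. by apply: measurable_fun_pair => //; exact: measurableT_comp. Qed.

Lemma equivariantD a a' : equivariant a -> equivariant a' ->
  equivariant (fun p => a p + a' p).
Proof.
move=> [a1 a2 a3] [b1 b2 b3]; split; first exact: bmfD.
  by move=> w y; rewrite a2 b2.
by move=> b w y; rewrite a3 b3.
Qed.

Lemma equivariantZ c a : equivariant a -> equivariant (fun p => c * a p).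
Proof.
move=> [a1 a2 a3]; split; first exact: bmfZ.
  by move=> w y; rewrite a2.
by move=> b w y; rewrite a3.
Qed.

Lemma equivariantN a : equivariant a -> equivariant (fun p => - a p).
Proof.
move=> [a1 a2 a3]; split; first exact: bmfN.
  by move=> w y; rewrite a2.
by move=> b w y; rewrite a3.
Qed.

Lemma equivariant_act b a : equivariant a -> equivariant (act b a).
Proof.
move=> [a1 a2 a3]; split; first exact: bmf_comp a1 (mSpair b).
  by move=> w y; rewrite /act/= a2.
by move=> c w y; rewrite /act/= a3 -!S_add addrC.
Qed.

Let DD x y : D x -> D y -> D (x + y).
Proof. by move=> [x1 x2] [y1 y2]; split; exact: equivariantD. Qed.

Let DN x : D x -> D (- x).
Proof. by move=> [x1 x2]; split; exact: equivariantN. Qed.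

Let Drot t x : D x -> D (rot t x).
Proof.
move=> [x1 x2]; split; apply: equivariantD; do ?exact: equivariantZ.
by apply: equivariantN; exact: equivariantZ.
Qed.

Let DS b x : D x -> D (Sop b x).
Proof. by move=> [x1 x2]; split; exact: equivariant_act. Qed.

Let pairE (x y : V) : (forall p, x.1 p = y.1 p) -> (forall p, x.2 p = y.2 p) -> x = y.
Proof. by case: x y => [x1 x2] [y1 y2] /= /funext -> /funext ->. Qed.

Let rotD t x y : rot t (x + y) = rot t x + rot t y.
Proof. by apply: pairE => p; rewrite /= !fctE; ring. Qed.

Let rotN t x : rot t (- x) = - rot t x.
Proof. by apply: pairE => p; rewrite /= !fctE; ring. Qed.

Let rot0 x : rot 0 x = x.
Proof. by apply: pairE => p; rewrite /= cos0 sin0; ring. Qed.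

Let rot_add s t x : rot (s + t) x = rot s (rot t x).
Proof. by apply: pairE => p; rewrite /= cosD sinD; ring. Qed.

Let rot_pi x : rot pi x = - x.
Proof. by apply: pairE => p; rewrite /= !fctE cospi sinpi; ring. Qed.

Let SD b x y : Sop b (x + y) = Sop b x + Sop b y.
Proof. by []. Qed.

Let SN b x : Sop b (- x) = - Sop b x.
Proof. by []. Qed.

Let Sop_add b c x : Sop (b + c) x = Sop b (Sop c x).
Proof. by apply: pairE => p; rewrite /= /act/= addrC S_add. Qed.

Let Srot b t x : Sop b (rot t x) = rot t (Sop b x).
Proof. by []. Qed.

Let isform := @invariant_form R G _ D rot Sop.

(** The form is the squared norm of the complex function [L x.1 + i L x.2]. It serves twice: with
    [L] the identity, and with [L] the coboundary [Tf] of an average. *)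
Lemma form_Rint {d} {T : measurableType d} (N : {measure set T -> \bar R}) (E : set T)
    (L : (W * Y -> R) -> T -> R) : fin_meas N E ->
  (forall a, equivariant a -> bmf (L a)) ->
  (forall r s a a' v, equivariant a -> equivariant a' ->
     L (fun p => r * a p + s * a' p) v = r * L a v + s * L a' v) ->
  (forall b a, equivariant a ->
     \int[N]_(v in E) (L (act b a) v ^+ 2) = \int[N]_(v in E) (L a v ^+ 2)) ->
  isform (fun x => \int[N]_(v in E) (L x.1 v ^+ 2) + \int[N]_(v in E) (L x.2 v ^+ 2)).
Proof.
move=> fE bL linL LS.
have intL r s a a' : equivariant a -> equivariant a' ->
    \int[N]_(v in E) (L (fun p => r * a p + s * a' p) v ^+ 2) =
    r ^+ 2 * (\int[N]_(v in E) (L a v ^+ 2)) + s ^+ 2 * (\int[N]_(v in E) (L a' v ^+ 2))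
    + (r * s) * (2 * \int[N]_(v in E) (L a v * L a' v)).
  move=> ea ea'.
  have b1 := bL _ ea; have b2 := bL _ ea'; have b11 := bmf_sqr b1; have b22 := bmf_sqr b2.
  have b12 := bmfM b1 b2.
  rewrite -!RintZ//; last exact: bmfZ.
  rewrite -!RintD//; do ?[exact: bmfZ|apply: bmfD|apply: bmfZ].
  by apply: eq_Rintegral => v _; rewrite linL//; ring.
have LD a a' : (fun p => 1 * a p + 1 * a' p) = a + a' :> (W * Y -> R).
  by apply/funext => p; rewrite !mul1r.
have LB a a' : (fun p => 1 * a p + (-1) * a' p) = a - a' :> (W * Y -> R).
  by apply/funext => p; rewrite !fctE; ring.
split.
- move=> x y [x1 x2] [y1 y2].
  rewrite -[(x + y).1]/(x.1 + y.1) -[(x + y).2]/(x.2 + y.2).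
  rewrite -[(x - y).1]/(x.1 - y.1) -[(x - y).2]/(x.2 - y.2).
  by rewrite -!LB -!LD !intL//; ring.
- move=> t x [x1 x2] /=.
  have -> : (fun p => cos t * x.1 p - sin t * x.2 p) =
      (fun p => cos t * x.1 p + (- sin t) * x.2 p).
    by apply/funext => p; ring.
  have cs := cos2Dsin2 t.
  rewrite !intL// (_ : cos t ^+ 2 = 1 - sin t ^+ 2); last by rewrite -cs; ring.
  by ring.
- by move=> b x [x1 x2] /=; rewrite !LS.
Qed.


Let fYT : fin_meas nu [set: Y]. Proof. exact: fin_meas_probability. Qed.

Let Rint_S b (g : Y -> R) : bmf g -> \int[nu]_y g (S b y) = \int[nu]_y g y.
Proof.
move=> bg; rewrite -(Rint_preimage (mS b) (nuS b) fYT bg).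
by rewrite preimage_setT.
Qed.

(** The squared norm over the fibre is invariant because [S] preserves [nu]. The conclusion links
    its value [p] at almost every [w] to the integral over the strip, and so turns mean square
    bounds into pointwise ones. *)
Lemma equivariant_norm_const A x : fin_meas M A -> D x ->
  exists p, {ae M, forall w, \int[nu]_y (x.1 (w, y) ^+ 2 + x.2 (w, y) ^+ 2) = p} /\
    \int[(M \x nu)%E]_(p in A `*` [set: Y]) (x.1 p ^+ 2) +
    \int[(M \x nu)%E]_(p in A `*` [set: Y]) (x.2 p ^+ 2) = fine (M A) * p.
Proof.
move=> fA [[b1 U1 T1] [b2 U2 T2]].
pose g p := x.1 p ^+ 2 + x.2 p ^+ 2.
have bg : bmf g by apply: bmfD; exact: bmf_sqr.
have [p hp] : exists p, {ae M, forall w, \int[nu]_y g (w, y) = p}.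
  apply: inv_const; first exact: bmf_int2.
    by apply: aeW => w; apply: eq_Rintegral => y _; rewrite /g U1 U2.
  move=> b; apply: aeW => w.
  rewrite -[RHS](Rint_S b (bmf_section1 w bg)).
  by apply: eq_Rintegral => y _; rewrite /g T1 T2.
exists p; split => //.
have fAY := fin_meas_strip nu fA.
rewrite -(RintD (M := (M \x nu)%E) fAY); [|exact: bmf_sqr..].
rewrite -/g (Rint_strip nu fA bg).
rewrite (@Rint_ae _ _ _ M A _ (cst p))//; [|exact: fA.1|exact: (bmf_int2 nu bg).1].
by rewrite Rintegral_cst 1?mulrC//; exact: fA.1.
Qed.

(** Cauchy-Schwarz for a complex pairing in its arithmetic-geometric form: the free weight [c]
    replaces square roots and is chosen later to balance the two terms. *)
Lemma Rint_amgm (E : set Y) (f1 f2 g1 g2 : Y -> R) c : measurable E -> 0 < c ->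
  bmf f1 -> bmf f2 -> bmf g1 -> bmf g2 ->
  `|\int[nu]_(y in E) (f1 y * g1 y + f2 y * g2 y)| <=
    (c * (\int[nu]_(y in E) (f1 y ^+ 2 + f2 y ^+ 2)) +
     c^-1 * (\int[nu]_(y in E) (g1 y ^+ 2) + \int[nu]_(y in E) (g2 y ^+ 2))) / 2.
Proof.
move=> mE c0 bf1 bf2 bg1 bg2; have fE := fin_meas_probability nu mE.
have bf : bmf (fun y => f1 y ^+ 2 + f2 y ^+ 2) by apply: bmfD; exact: bmf_sqr.
have bg : bmf (fun y => g1 y ^+ 2 + g2 y ^+ 2) by apply: bmfD; exact: bmf_sqr.
have bfg : bmf (fun y => f1 y * g1 y + f2 y * g2 y) by apply: bmfD; exact: bmfM.
rewrite -RintD//; [|exact: bmf_sqr..].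
rewrite -!RintZ// -RintD//; [|exact: bmfZ..].
rewrite [leRHS]mulrC -RintZ//; last by apply: bmfD; exact: bmfZ.
have bh : bmf (fun y => 2^-1 * (c * (f1 y ^+ 2 + f2 y ^+ 2) + c^-1 * (g1 y ^+ 2 + g2 y ^+ 2))).
  by apply: bmfZ; apply: bmfD; exact: bmfZ.
have c_neq0 : c != 0 by rewrite gt_eqF.
have ci0 : 0 <= c^-1 by rewrite invr_ge0 ltW.
have le0 s : s ^+ 2 = 1 -> forall y, s * (f1 y * g1 y + f2 y * g2 y) <=
    2^-1 * (c * (f1 y ^+ 2 + f2 y ^+ 2) + c^-1 * (g1 y ^+ 2 + g2 y ^+ 2)).
  move=> s1 y; rewrite -subr_ge0.
  rewrite (_ : _ - _ = 2^-1 * c^-1 * ((c * f1 y - s * g1 y) ^+ 2 + (c * f2 y - s * g2 y) ^+ 2)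
     + 2^-1 * c^-1 * (1 - s ^+ 2) * (g1 y ^+ 2 + g2 y ^+ 2)); last by field.
  rewrite s1 subrr mulr0 mul0r addr0 mulr_ge0//; first by rewrite mulr_ge0.
  by rewrite addr_ge0 ?sqr_ge0.
rewrite ler_norml; apply/andP; split.
  rewrite lerNl -mulN1r -RintZ//; apply: Rint_le => // [|y _]; first exact: bmfZ.
  by apply: le0; rewrite sqrrN expr1n.
rewrite -[leLHS]mul1r -RintZ//; apply: Rint_le => // [|y _]; first exact: bmfZ.
by apply: le0; rewrite expr1n.
Qed.

Section approximate.
Variables (A : set W) (a0 : W * Y -> R) (b0 : G).
Hypotheses (fA : fin_meas M A) (ea0 : equivariant a0).
Let m := fine (M A).
Let t (a : W * Y -> R) y := \int[M]_(w in A) a (w, y).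
(** This vanishes almost everywhere exactly when the average [t a] is invariant under [b0]; [qT]
    measures the failure of invariance, and [qp] the size of the vector. *)
Let Tf (a : W * Y -> R) y := t a y - t a (S b0 y).
Let E := A `*` [set: Y].
Let qp (x : V) := \int[(M \x nu)%E]_(p in E) (x.1 p ^+ 2) +
  \int[(M \x nu)%E]_(p in E) (x.2 p ^+ 2).
Let qT (x : V) := \int[nu]_y (Tf x.1 y ^+ 2) + \int[nu]_y (Tf x.2 y ^+ 2).

Let m_ge0 : 0 <= m. Proof. exact: fine_ge0. Qed.

Let bmf_t a : bmf a -> bmf (t a). Proof. exact: bmf_int1. Qed.

Let bmf_Tf a : bmf a -> bmf (Tf a).
Proof. by move=> ba; apply: bmfB; [|apply: bmf_comp (mS b0)]; exact: bmf_t. Qed.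

Let qp_form : isform qp.
Proof.
apply: (@form_Rint _ _ (M \x nu)%E E (fun a => a)) => //.
- exact: fin_meas_strip.
- by move=> a [].
- move=> b a [ba _ _].
  have mp B : measurable B ->
      (M \x nu)%E ((fun p : W * Y => (p.1, S b p.2)) @^-1` B) = (M \x nu)%E B.
    apply: (@skew_product_preserves _ _ _ _ _ M nu id (fun _ => S b)) => //.
      by apply: measurableT_comp => //; exact: mS.
    by move=> _; exact: nuS.
  by have := Rint_preimage (mSpair b) mp (fin_meas_strip nu fA) (bmf_sqr ba).
Qed.

Let qT_form : isform qT.
Proof.
apply: form_Rint => //.
- by move=> a [ba _ _]; exact: bmf_Tf.
- move=> r s a a' y [ba _ _] [ba' _ _].
  have tlin z : t (fun p => r * a p + s * a' p) z = r * t a z + s * t a' z.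
    rewrite /t RintD//; [|by apply: bmfZ; exact: bmf_section2..].
    by rewrite !RintZ//; exact: bmf_section2.
  by rewrite /Tf !tlin; ring.
- move=> b a [ba _ _]; rewrite -[RHS](Rint_S b (bmf_sqr (bmf_Tf ba))).
  by apply: eq_Rintegral => y _; rewrite /Tf /t /act/= -!S_add (addrC b).
Qed.

Let qp_ge0 x : 0 <= qp x.
Proof. by apply: addr_ge0; apply: Rintegral_ge0 => p _; exact: sqr_ge0. Qed.

(** Cauchy-Schwarz over [A] gives the factor [m], and the two terms of the coboundary give the
    factor 4. *)
Let qT_le x : D x -> qT x <= 4 * m * qp x.
Proof.
have one a : equivariant a -> \int[nu]_y (Tf a y ^+ 2) <=
    4 * m * \int[(M \x nu)%E]_(p in E) (a p ^+ 2).
  move=> [ba _ _]; have bt := bmf_t ba; have b2 := bmf_sqr bt.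
  apply: (@le_trans _ _ (4 * \int[nu]_y (t a y ^+ 2))).
    have -> : 4 * \int[nu]_y (t a y ^+ 2) =
        \int[nu]_y (2 * t a y ^+ 2 + 2 * t a (S b0 y) ^+ 2).
      rewrite RintD//; [|exact: bmfZ|by apply: bmfZ; exact: bmf_comp b2 (mS b0)].
      rewrite !RintZ//; last exact: bmf_comp b2 (mS b0).
      by rewrite (Rint_S b0 b2); ring.
    apply: Rint_le => //; first by apply: bmf_sqr; exact: bmf_Tf.
      by apply: bmfD; apply: bmfZ => //; exact: bmf_comp b2 (mS b0).
    move=> y _; rewrite /Tf -subr_ge0.
    rewrite (_ : _ - _ = (t a y + t a (S b0 y)) ^+ 2) ?sqr_ge0//; ring.
  rewrite -mulrA ler_wpM2l// (Rint_strip nu fA (bmf_sqr ba)).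
  rewrite (Rint_fubini nu fA (bmf_sqr ba)) -RintZ//; last first.
    exact: (bmf_int1 fA (bmf_sqr ba)).
  apply: Rint_le => //; first by apply: bmfZ; exact: (bmf_int1 fA (bmf_sqr ba)).
  move=> y _; exact: (Rint_sqr_le fA (bmf_section2 y ba)).
by move=> [x1 x2]; rewrite /qT mulrDr lerD// one.
Qed.


Hypothesis HT : 0 < \int[nu]_y (Tf a0 y ^+ 2).

(** Localization has to preserve the positivity of [qT - rho * qp]: it bounds the coboundary of the
    average from below relative to the size of the vector, whatever the near eigenvalues are. *)
Lemma approximate_eigenfunction : exists2 r, 0 < r &
  forall (F : seq G) (n : nat), exists e1 e2 : W -> R,
  [/\ bmf e1 /\ bmf e2,
      forall w, e1 (U w) = e1 w /\ e2 (U w) = e2 w,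
      {ae M, forall w, `|e1 w| <= 2 * m /\ `|e2 w| <= 2 * m},
      r <= \int[M]_(w in A) e1 w - \int[M]_(w in A) e1 (tau b0 w) &
      forall b, b \in F -> exists s, {ae M, forall w,
        `|e1 (tau b w) - (cos s * e1 w - sin s * e2 w)| <= 2 * m / n.+1%:R /\
        `|e2 (tau b w) - (sin s * e1 w + cos s * e2 w)| <= 2 * m / n.+1%:R}].
Proof.
pose x0 : V := (a0, a0); have Dx0 : D x0 by [].
have qT0 : 0 < qT x0 by rewrite /qT addr_gt0.
have m_gt0 : 0 < m.
  rewrite lt_neqAle m_ge0 andbT eq_sym; apply/eqP => m0.
  by have := qT_le Dx0; rewrite m0 mulr0 mul0r leNgt qT0.
(* The factor 2 leaves [J x0] positive, and the [+ 1] keeps the denominator away from 0. *)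
pose rho := qT x0 / (2 * (qp x0 + 1)).
have q1 : 0 < 2 * (qp x0 + 1) by have := qp_ge0 x0; lra.
have rho0 : 0 < rho by rewrite divr_gt0.
exists (rho * m); first exact: mulr_gt0.
move=> F n; pose J x := qT x - rho * qp x.
have fJ : isform J.
  have [T1 T2 T3] := qT_form; have [P1 P2 P3] := qp_form; split.
  - move=> x y Dx Dy; have := T1 x y Dx Dy; have := P1 x y Dx Dy => e1 e2.
    by rewrite /J addrACA -opprD -mulrDr e1 e2; ring.
  - by move=> s x Dx; rewrite /J T2// P2.
  - by move=> b x Dx; rewrite /J T3// P3.
have J0 : 0 < J x0.
  rewrite /J /rho; have -> : qT x0 - qT x0 / (2 * (qp x0 + 1)) * qp x0 =
      qT x0 * (qp x0 + 2) / (2 * (qp x0 + 1)).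
    by field; rewrite gt_eqF//; have := qp_ge0 x0; lra.
  by rewrite divr_gt0// mulr_gt0//; have := qp_ge0 x0; lra.
(* With [qp = m * pd] for the defect and [qT x <= (2 * m) ^+ 2 * p], this [K] yields
   [pd * n.+1%:R ^+ 2 <= p]: in the fibre norm the defect is at most [1 / n.+1] times [x]. *)
pose K := 4 * m * n.+1%:R ^+ 2.
have K0 : 0 < K by rewrite !mulr_gt0// exprn_gt0.
have [x [Dx Jx Fx]] := localize _ _ _ _ _ _ DD DN Drot DS rotD rotN rot0 rot_add rot_pi
  SD SN Sop_add Srot _ _ _ F _ fJ qp_form (fun y _ => qp_ge0 y) (ltW K0) Dx0 J0.
have [p [px qpx]] := equivariant_norm_const fA Dx; rewrite -/(qp x) -/m in qpx.
have qTx : rho * qp x < qT x by rewrite -subr_gt0.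
have qpx0 : 0 < qp x.
  rewrite lt_neqAle qp_ge0 andbT eq_sym; apply/eqP => qp0.
  have := qT_le Dx; rewrite qp0 mulr0 leNgt => /negP; apply.
  by apply: le_lt_trans qTx; rewrite qp0 mulr0.
have p0 : 0 < p by move: qpx0; rewrite qpx pmulr_rgt0.
have qTp : qT x <= (2 * m) ^+ 2 * p.
  by have := qT_le Dx; rewrite qpx (_ : 4 * m * (m * p) = (2 * m) ^+ 2 * p)//; ring.
pose T1 := Tf x.1; pose T2 := Tf x.2.
have [bx1 bx2] : bmf x.1 /\ bmf x.2 by case: Dx => -[? _ _] [].
have bT1 : bmf T1 by exact: bmf_Tf.
have bT2 : bmf T2 by exact: bmf_Tf.
have bNT2 : bmf (fun y => - T2 y) by exact: bmfN.
(* [I1] and [I2] are the real and imaginary parts of the pairing of [f1 + i f2] with [T1 + i T2],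
   conjugated in the second argument. *)
pose I1 (f1 f2 : Y -> R) := \int[nu]_y (f1 y * T1 y + f2 y * T2 y).
pose I2 (f1 f2 : Y -> R) := \int[nu]_y (f2 y * T1 y + f1 y * - T2 y).
have bound f1 f2 P c : bmf f1 -> bmf f2 -> 0 < c ->
    \int[nu]_y (f1 y ^+ 2 + f2 y ^+ 2) = P ->
    `|p^-1 * I1 f1 f2| <= p^-1 * ((c * P + c^-1 * qT x) / 2) /\
    `|p^-1 * I2 f1 f2| <= p^-1 * ((c * P + c^-1 * qT x) / 2).
  move=> bf1 bf2 c0 <-; have pi0 : 0 <= p^-1 by rewrite invr_ge0 ltW.
  rewrite !normrM (ger0_norm pi0); split; apply: ler_wpM2l => //.
    exact: Rint_amgm.
  apply: le_trans (Rint_amgm measurableT c0 bf2 bf1 bT1 bNT2) _.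
  rewrite le_eqVlt; apply/orP; left; apply/eqP; congr ((_ * _ + _ * (_ + _)) / _).
    by apply: eq_Rintegral => y _; rewrite addrC.
  by apply: eq_Rintegral => y _; rewrite sqrrN.
(* [e1 + i e2] is [x] paired over [Y] with the coboundary of its own average. *)
pose e1 w := p^-1 * I1 (fun y => x.1 (w, y)) (fun y => x.2 (w, y)).
pose e2 w := p^-1 * I2 (fun y => x.1 (w, y)) (fun y => x.2 (w, y)).
have bsnd (f : Y -> R) : bmf f -> bmf (fun q : W * Y => f q.2).
  by move=> bf; exact: bmf_comp bf (@measurable_snd _ _ W Y).
have be1 : bmf e1.
  apply: bmfZ; apply: (@bmf_int2 _ _ _ _ _ nu (fun q => x.1 q * T1 q.2 + x.2 q * T2 q.2)).
  by apply: bmfD; apply: bmfM => //; exact: bsnd.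
have be2 : bmf e2.
  apply: bmfZ; apply: (@bmf_int2 _ _ _ _ _ nu (fun q => x.2 q * T1 q.2 + x.1 q * - T2 q.2)).
  by apply: bmfD; apply: bmfM => //; [exact: bsnd|exact: (bsnd _ bNT2)].
have [[_ U1 tau1] [_ U2 tau2]] := Dx.
exists e1, e2; split => //.
- by move=> w; split; congr (_ * _); apply: eq_Rintegral => y _; rewrite U1 U2.
(* Since [qT x <= (2 * m) ^+ 2 * p], the weight [2 * m] makes each of the two terms at most
   [2 * m * p]. *)
- apply: filterS px => w pw; have c0 : 0 < 2 * m by lra.
  have := bound _ _ _ _ (bmf_section1 w bx1) (bmf_section1 w bx2) c0 pw.
  suff h : p^-1 * ((2 * m * p + (2 * m)^-1 * qT x) / 2) <= 2 * m.
    by move=> [h1 h2]; split; [exact: le_trans h1 h|exact: le_trans h2 h].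
  rewrite ler_pdivrMl// ler_pdivrMr//.
  have : (2 * m)^-1 * qT x <= 2 * m * p.
    by rewrite ler_pdivrMl// mulrA -expr2.
  lra.
(* By Fubini, integration over [A] turns [x] back into its average [t], and the translate by [b0]
   into [t] at [S b0 y]. The difference is [qT x / p], more than [rho * qp x / p = rho * m]. *)
- have -> : \int[M]_(w in A) e1 w - \int[M]_(w in A) e1 (tau b0 w) = p^-1 * qT x.
    have b1 : bmf (fun q : W * Y => x.1 q * T1 q.2 + x.2 q * T2 q.2).
      by apply: bmfD; apply: bmfM => //; exact: bsnd.
    have b2 : bmf (fun q : W * Y => x.1 (q.1, S b0 q.2) * T1 q.2 + x.2 (q.1, S b0 q.2) * T2 q.2).
      by apply: bmfD; apply: bmfM; do ?[exact: bsnd|exact: bmf_comp (mSpair b0)].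
    have e1E : (fun w => e1 (tau b0 w)) = (fun w => p^-1 *
        \int[nu]_y (x.1 (w, S b0 y) * T1 y + x.2 (w, S b0 y) * T2 y)).
      by apply/funext => w; congr (_ * _); apply: eq_Rintegral => y _; rewrite tau1 tau2.
    rewrite e1E !RintZ//; [|exact: (bmf_int2 nu b2)|exact: (bmf_int2 nu b1)].
    rewrite -[\int[M]_(w in A) I1 _ _]/(\int[M]_(w in A) \int[nu]_y (x.1 (w, y) * T1 y + x.2 (w, y) * T2 y)).
    rewrite (Rint_fubini nu fA b1) (Rint_fubini nu fA b2) -mulrBr; congr (_ * _).
    rewrite -RintB//; [|exact: (bmf_int1 fA b1)|exact: (bmf_int1 fA b2)].
    rewrite /qT -RintD//; [|exact: bmf_sqr..].
    apply: eq_Rintegral => y _.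
    have lin z (f := fun w => x.1 (w, z) * T1 y + x.2 (w, z) * T2 y) :
        \int[M]_(w in A) f w = t x.1 z * T1 y + t x.2 z * T2 y.
      rewrite /f RintD//; do ?[by apply: bmfM; [exact: bmf_section2|exact: bmf_cst]].
      rewrite (mulrC (t x.1 z)) (mulrC (t x.2 z)) -!RintZ//; try exact: bmf_section2.
      by congr (_ + _); apply: eq_Rintegral => w _; rewrite mulrC.
    by rewrite /= !lin /T1 /T2 /Tf; ring.
  by rewrite ler_pdivlMl// (_ : p * (rho * m) = rho * qp x) ?ltW// qpx; ring.
- move=> b /Fx[s hs]; exists s.
  have Dd : D (Sop b x - rot s x) by apply: DD; [exact: DS|apply: DN; exact: Drot].
  have [pd [pdx qpd]] := equivariant_norm_const fA Dd.
  rewrite -/(qp _) -/m in qpd.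
  have pdp : pd * n.+1%:R ^+ 2 <= p.
    have : K * qp (Sop b x - rot s x) <= (2 * m) ^+ 2 * p.
      apply: le_trans (ltW hs) _; apply: le_trans qTp.
      by rewrite /J gerBl mulr_ge0// ltW.
    have -> : K * qp (Sop b x - rot s x) = (2 * m) ^+ 2 * (pd * n.+1%:R ^+ 2).
      by rewrite qpd /K; ring.
    by rewrite ler_pM2l// exprn_gt0// mulr_gt0.
  apply: filterS pdx => w pw.
  have N0 : 0 < n.+1%:R :> R by [].
  (* The defect is [n.+1] times smaller than [x], hence a weight [n.+1] times larger than in the
     bound for [e1] and [e2] themselves. *)
  have c0 : 0 < 2 * m * n.+1%:R by rewrite !mulr_gt0.
  have [[bd1 _ _] [bd2 _ _]] := Dd.
  have := bound _ _ _ _ (bmf_section1 w bd1) (bmf_section1 w bd2) c0 pw.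
  have h : p^-1 * ((2 * m * n.+1%:R * pd + (2 * m * n.+1%:R)^-1 * qT x) / 2) <=
      2 * m / n.+1%:R.
    have h1 : 2 * m * n.+1%:R * pd <= 2 * m / n.+1%:R * p.
      have -> : 2 * m / n.+1%:R * p = 2 * m * (p / n.+1%:R) by ring.
      rewrite -mulrA ler_pM2l ?mulr_gt0// ler_pdivlMr//.
      by rewrite mulrC mulrA -expr2 mulrC.
    have h2 : (2 * m * n.+1%:R)^-1 * qT x <= 2 * m / n.+1%:R * p.
      rewrite ler_pdivrMl//.
      have -> : 2 * m * n.+1%:R * (2 * m / n.+1%:R * p) = (2 * m) ^+ 2 * p.
        by field; rewrite gt_eqF.
      exact: qTp.
    rewrite ler_pdivrMl// ler_pdivrMr//.
    by rewrite (_ : p * _ * 2 = 2 * m / n.+1%:R * p + 2 * m / n.+1%:R * p) ?lerD//; ring.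
  have bx1w := bmf_section1 w bx1; have bx2w := bmf_section1 w bx2.
  have bS1 : bmf (fun y => x.1 (w, S b y)) by exact: bmf_comp bx1w (mS b).
  have bS2 : bmf (fun y => x.2 (w, S b y)) by exact: bmf_comp bx2w (mS b).
  have bI (f1 f2 g1 g2 : Y -> R) : bmf f1 -> bmf f2 -> bmf g1 -> bmf g2 ->
      bmf (fun y => f1 y * g1 y + f2 y * g2 y).
    by move=> *; apply: bmfD; exact: bmfM.
  (* By equivariance, the error in the eigenvalue equation is the pairing of the defect of [x] with
     the same [T1] and [T2]. *)
  move=> [le1 le2]; split.
    rewrite (_ : _ - _ = p^-1 * I1 (fun y => (Sop b x - rot s x).1 (w, y))
        (fun y => (Sop b x - rot s x).2 (w, y))); first exact: le_trans le1 h.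
    rewrite /e1 /e2 /I1 /I2; under eq_Rintegral do rewrite tau1 tau2.
    rewrite mulrCA (mulrCA (sin s)) -!mulrBr; congr (_ * _).
    rewrite -!RintZ//; [|exact: bI..].
    rewrite -!RintB//; do ?[exact: bI|apply: bmfB|apply: bmfZ].
    by apply: eq_Rintegral => y _; rewrite /= !fctE /act/=; ring.
  rewrite (_ : _ - _ = p^-1 * I2 (fun y => (Sop b x - rot s x).1 (w, y))
      (fun y => (Sop b x - rot s x).2 (w, y))); first exact: le_trans le2 h.
  rewrite /e1 /e2 /I1 /I2; under eq_Rintegral do rewrite tau1 tau2.
  rewrite mulrCA (mulrCA (cos s)) -!mulrDr -!mulrBr; congr (_ * _).
  rewrite -!RintZ//; [|exact: bI..].
  rewrite -!RintD//; [|by apply: bmfZ; exact: bI..].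
  rewrite -!RintB//; do ?[exact: bI|apply: bmfD|apply: bmfZ].
  by apply: eq_Rintegral => y _; rewrite /= !fctE /act/=; ring.
Qed.

End approximate.
End Eigenfunctions.

(** * Weak limits of approximate eigenfunctions along an ultrafilter *)

Lemma ultrafilter_bounded_cvg {R : realType} {I : Type} (F : set_system I)
    (x : I -> R) C : UltraFilter F -> (forall i, `|x i| <= C) -> cvg (x @ F).
Proof.
move=> FU xC; have : UltraFilter (x @ F).
  split=> [|H HF xH]; first exact: fmap_proper_filter.
  rewrite predeqE => A; split; last exact: xH.
  move=> HA; have [//|FnA] := in_ultra_setVsetC (x @^-1` A) FU.
  have HnA : H (~` A) by apply: xH.
  by have /filter_ex [? []] : H (A `&` ~` A) by exact: filterI.
have := @segment_compact R (- C) C; rewrite compact_ultra => /(_ (x @ F)) h xU.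
have hx : (x @ F) `[- C, C]%classic.
  suff : F [set i | x i \in `[- C, C]] by [].
  by apply: filterE => i /=; rewrite in_itv/= -ler_norml.
by have [l [_ xl]] := h xU hx; apply/cvg_ex; exists l.
Qed.

Section WeakLimit.
Context {R : realType} {d} {W : measurableType d}.
Variables (M : {sigma_finite_measure set W -> \bar R}) (G : zmodType).
Variables (U Ui : W -> W) (tau : G -> W -> W).
Hypotheses (mU : measurable_fun setT U) (mUi : measurable_fun setT Ui)
  (UK : cancel U Ui) (MU : forall A, measurable A -> M (U @^-1` A) = M A).
Hypotheses (mtau : forall b, measurable_fun setT (tau b))
  (Mtau : forall b A, measurable A -> M (tau b @^-1` A) = M A)
  (tau0 : forall w, tau 0 w = w)
  (tau_add : forall b c w, tau (b + c) w = tau b (tau c w)).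
Variables (A : set W) (b0 : G) (kap r : R).
Hypotheses (fA : fin_meas M A) (kap0 : 0 <= kap) (r0 : 0 < r).
Hypothesis approx : forall (F : seq G) (n : nat), exists e1 e2 : W -> R,
  [/\ bmf e1 /\ bmf e2,
      forall w, e1 (U w) = e1 w /\ e2 (U w) = e2 w,
      {ae M, forall w, `|e1 w| <= kap /\ `|e2 w| <= kap},
      r <= \int[M]_(w in A) e1 w - \int[M]_(w in A) e1 (tau b0 w) &
      forall b, b \in F -> exists s, {ae M, forall w,
        `|e1 (tau b w) - (cos s * e1 w - sin s * e2 w)| <= kap / n.+1%:R /\
        `|e2 (tau b w) - (sin s * e1 w + cos s * e2 w)| <= kap / n.+1%:R}].

(** An ultrafilter replaces a sequence because [G] may be uncountable and the limit must satisfy an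
    equation for every single [b]. The limit is taken of the integrals over each set of finite
    measure, and [density_of_bounded] recovers functions from them. *)
Lemma eigenfunction_of_approximate : exists e1 e2 : W -> R,
  [/\ bmf e1 /\ bmf e2,
      {ae M, forall w, e1 (U w) = e1 w /\ e2 (U w) = e2 w},
      forall b, exists c s, c ^+ 2 + s ^+ 2 = 1 /\ {ae M, forall w,
        e1 (tau b w) = c * e1 w - s * e2 w /\ e2 (tau b w) = s * e1 w + c * e2 w} &
      ~ {ae M, forall w, e1 (tau b0 w) = e1 w}].
Proof.
pose I := (seq G * nat)%type.
have /choice[e eP] : forall i : I, exists e : (W -> R) * (W -> R) * (G -> R),
  [/\ bmf e.1.1 /\ bmf e.1.2,
      forall w, e.1.1 (U w) = e.1.1 w /\ e.1.2 (U w) = e.1.2 w,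
      {ae M, forall w, `|e.1.1 w| <= kap /\ `|e.1.2 w| <= kap},
      r <= \int[M]_(w in A) e.1.1 w - \int[M]_(w in A) e.1.1 (tau b0 w) &
      forall b, b \in i.1 -> {ae M, forall w,
        `|e.1.1 (tau b w) - (cos (e.2 b) * e.1.1 w - sin (e.2 b) * e.1.2 w)|
           <= kap / i.2.+1%:R /\
        `|e.1.2 (tau b w) - (sin (e.2 b) * e.1.1 w + cos (e.2 b) * e.1.2 w)|
           <= kap / i.2.+1%:R}].
  move=> [F n]; have [e1 [e2 [P1 P2 P3 P4 P5]]] := approx F n.
  have /choice[s sP] : forall b, exists s, b \in F -> {ae M, forall w,
        `|e1 (tau b w) - (cos s * e1 w - sin s * e2 w)| <= kap / n.+1%:R /\
        `|e2 (tau b w) - (sin s * e1 w + cos s * e2 w)| <= kap / n.+1%:R}.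
    move=> b; have [/P5[s hs]|_] := boolP (b \in F); last by exists 0.
    by exists s.
  by exists (e1, e2, s); split.
(* These are the final segments for inclusion and precision: along an ultrafilter that contains
   them, every [b] eventually belongs to the finite set and the error tends to 0. *)
pose base (i : I) := [set j : I | {subset i.1 <= j.1} /\ (i.2 <= j.2)%N].
have [F [FU baseF]] : exists F, UltraFilter F /\ filter_from [set: I] base `<=` F.
  apply: ultraFilterLemma; apply: filter_from_proper; last first.
    by move=> i _; exists i; split.
  apply: filter_from_filter; first by exists ([::], 0%N).
  move=> i j _ _; exists (i.1 ++ j.1, maxn i.2 j.2) => // k [/= sk nk].
  split; split.
  - by move=> b bi; apply: sk; rewrite mem_cat bi.
  - by apply: leq_trans nk; exact: leq_maxl.
  - by move=> b bi; apply: sk; rewrite mem_cat bi orbT.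
  - by apply: leq_trans nk; exact: leq_maxr.
have inF b n : F [set j : I | b \in j.1 /\ (n <= j.2)%N].
  apply: baseF; exists ([:: b], n) => // j [/= sj nj]; split => //.
  by apply: sj; rewrite mem_head.
pose x1 C i := \int[M]_(w in C) (e i).1.1 w.
pose x2 C i := \int[M]_(w in C) (e i).1.2 w.
have x1C C i : fin_meas M C -> `|x1 C i| <= kap * fine (M C).
  move=> fC; have [[b1 _] _ eb _ _] := eP i.
  by apply: Rint_norm_le_ae => //; apply: filterS eb => w [].
have x2C C i : fin_meas M C -> `|x2 C i| <= kap * fine (M C).
  move=> fC; have [[_ b2] _ eb _ _] := eP i.
  by apply: Rint_norm_le_ae => //; apply: filterS eb => w [].
have limit (x : set W -> I -> R) : (forall C i, fin_meas M C -> `|x C i| <= kap * fine (M C)) ->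
    (forall C D i, fin_meas M C -> fin_meas M D -> C `&` D = set0 ->
      x (C `|` D) i = x C i + x D i) ->
    exists f : W -> R, bmf f /\
      forall C, fin_meas M C -> x C @ F --> (\int[M]_(w in C) f w).
  move=> xC xD; pose l C := lim (x C @ F).
  have xl C : fin_meas M C -> x C @ F --> l C.
    by move=> fC; apply: (ultrafilter_bounded_cvg FU (C := kap * fine (M C))) => i; exact: xC.
  have lD : fin_additive M l.
    move=> C D fC fD CD; apply/cvg_lim => //.
    have -> : x (C `|` D) = (fun i => x C i + x D i).
      by apply/funext => i; rewrite xD.
    by apply: cvgD; exact: xl.
  have lC : bounded_by_measure M l kap.
    move=> C fC; have lc := xl C fC.
    have h : (fun i => `|x C i|) @ F --> `|l C| by exact: cvg_norm.
    by apply: (cvgr_to_le h); apply: nearW => i; exact: xC.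
  have [f [mf fC fE]] := density_of_bounded kap0 lD lC.
  exists f; split; first by split => //; exists kap.
  by move=> C fC'; rewrite -fE//; exact: xl.
have [f1 [bf1 f1E]] : exists f : W -> R, bmf f /\
      forall C, fin_meas M C -> x1 C @ F --> (\int[M]_(w in C) f w).
  apply: limit => // C D i fC fD CD; apply: Rint_setU => //.
  by have [[]] := eP i.
have [f2 [bf2 f2E]] : exists f : W -> R, bmf f /\
      forall C, fin_meas M C -> x2 C @ F --> (\int[M]_(w in C) f w).
  apply: limit => // C D i fC fD CD; apply: Rint_setU => //.
  by have [[]] := eP i.
have cvg_eq (x : I -> R) (a b : R) : x @ F --> a -> x @ F --> b -> a = b.
  by move=> xa xb; exact: (@cvg_unique _ (@Rhausdorff R) (x @ F) _ a b xa xb).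
have pre (T : W -> W) C : measurable_fun setT T ->
    (forall B, measurable B -> M (T @^-1` B) = M B) -> fin_meas M C ->
    fin_meas M (T @^-1` C).
  move=> mT MT [mC Coo]; split; last by rewrite MT.
  by rewrite -[X in measurable X]setTI; exact: mT.
have tauK b : cancel (tau b) (tau (- b)) by move=> w; rewrite -tau_add addNr tau0.
exists f1, f2; split => //.
- have h1 : {ae M, forall w, f1 (U w) = f1 w}.
    apply: (ae_eq_of_preimages mU mUi UK MU bf1 bf1) => C fC.
    apply: (cvg_eq _ _ _ (f1E _ fC)).
    have -> : x1 C = x1 (U @^-1` C).
      apply/funext => i; have [[b1 _] eU _ _ _] := eP i.
      rewrite /x1 -(Rint_preimage mU MU fC b1).
      by apply: eq_Rintegral => w _; rewrite (eU w).1.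
    by apply: f1E; exact: pre mU MU fC.
  have h2 : {ae M, forall w, f2 (U w) = f2 w}.
    apply: (ae_eq_of_preimages mU mUi UK MU bf2 bf2) => C fC.
    apply: (cvg_eq _ _ _ (f2E _ fC)).
    have -> : x2 C = x2 (U @^-1` C).
      apply/funext => i; have [[_ b2] eU _ _ _] := eP i.
      rewrite /x2 -(Rint_preimage mU MU fC b2).
      by apply: eq_Rintegral => w _; rewrite (eU w).2.
    by apply: f2E; exact: pre mU MU fC.
  by apply: filterS2 h1 h2 => w ? ?.
- move=> b.
  (* The cosines and sines converge along the ultrafilter, being bounded, even where the angles do
     not. *)
  have cc : cvg ((fun i => cos ((e i).2 b)) @ F).
    apply: (ultrafilter_bounded_cvg FU (C := 1)) => i.
    by rewrite ler_norml cos_geN1 cos_le1.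
  have cs : cvg ((fun i => sin ((e i).2 b)) @ F).
    apply: (ultrafilter_bounded_cvg FU (C := 1)) => i.
    by rewrite ler_norml sin_geN1 sin_le1.
  move: cc cs; set c := lim _ => cc; set s := lim _ => cs.
  exists c, s; split.
    apply: (cvg_eq (fun i => cos ((e i).2 b) ^+ 2 + sin ((e i).2 b) ^+ 2)).
      by apply: cvgD; apply: cvgM.
    rewrite (_ : (fun _ => _) = cst 1); first exact: cvg_cst.
    by apply/funext => i; rewrite cos2Dsin2.
  have small C (y : I -> R) : fin_meas M C ->
      (forall i, b \in i.1 -> `|y i| <= kap / i.2.+1%:R * fine (M C)) -> y @ F --> 0.
    move=> fC yC; apply/cvgr0Pnorm_le => eps eps0.
    pose q := kap * fine (M C) / eps.
    have q0 : 0 <= q by rewrite divr_ge0 ?mulr_ge0 ?fine_ge0// ltW.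
    apply: filterS (inF b (Num.bound q)) => i [bi ni].
    apply: le_trans (yC i bi) _; rewrite mulrAC ler_pdivrMr// (mulrC eps) -ler_pdivrMr// -/q.
    apply: le_trans (ltW (archi_boundP q0)) _.
    by rewrite ler_nat; exact: leqW.
  have pC C : fin_meas M C -> fin_meas M (tau b @^-1` C).
    exact: pre (mtau b) (Mtau b).
  have h1 : {ae M, forall w, f1 (tau b w) = c * f1 w - s * f2 w}.
    apply: (ae_eq_of_preimages (mtau b) (mtau (- b)) (tauK b) (Mtau b) bf1).
      by apply: bmfB; exact: bmfZ.
    move=> C fC; have fC' := pC C fC.
    rewrite RintB//; [|exact: bmfZ..]; rewrite !RintZ//.
    apply/eqP; rewrite -subr_eq0; apply/eqP.
    pose y i := x1 C i - (cos ((e i).2 b) * x1 (tau b @^-1` C) i -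
        sin ((e i).2 b) * x2 (tau b @^-1` C) i).
    apply: (cvg_eq y).
      apply: cvgB; first exact: f1E.
      by apply: cvgB; apply: cvgM => //; [exact: f1E|exact: f2E].
    apply: (small (tau b @^-1` C)) => // i bi.
    have [[b1 b2] _ _ _ /(_ b bi) ei] := eP i.
    have b1t : bmf (fun w => (e i).1.1 (tau b w)) by exact: bmf_comp b1 (mtau b).
    have -> : y i = \int[M]_(w in tau b @^-1` C) ((e i).1.1 (tau b w) -
        (cos ((e i).2 b) * (e i).1.1 w - sin ((e i).2 b) * (e i).1.2 w)).
      rewrite RintB//; last by apply: bmfB; exact: bmfZ.
      rewrite RintB//; [|exact: bmfZ..]; rewrite !RintZ//.
      by rewrite (Rint_preimage (mtau b) (Mtau b) fC b1).
    apply: Rint_norm_le_ae => //; last by apply: filterS ei => w [].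
      by apply: bmfB => //; apply: bmfB; exact: bmfZ.
    by rewrite divr_ge0.
  have h2 : {ae M, forall w, f2 (tau b w) = s * f1 w + c * f2 w}.
    apply: (ae_eq_of_preimages (mtau b) (mtau (- b)) (tauK b) (Mtau b) bf2).
      by apply: bmfD; exact: bmfZ.
    move=> C fC; have fC' := pC C fC.
    rewrite RintD//; [|exact: bmfZ..]; rewrite !RintZ//.
    apply/eqP; rewrite -subr_eq0; apply/eqP.
    pose y i := x2 C i - (sin ((e i).2 b) * x1 (tau b @^-1` C) i +
        cos ((e i).2 b) * x2 (tau b @^-1` C) i).
    apply: (cvg_eq y).
      apply: cvgB; first exact: f2E.
      by apply: cvgD; apply: cvgM => //; [exact: f1E|exact: f2E].
    apply: (small (tau b @^-1` C)) => // i bi.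
    have [[b1 b2] _ _ _ /(_ b bi) ei] := eP i.
    have b2t : bmf (fun w => (e i).1.2 (tau b w)) by exact: bmf_comp b2 (mtau b).
    have -> : y i = \int[M]_(w in tau b @^-1` C) ((e i).1.2 (tau b w) -
        (sin ((e i).2 b) * (e i).1.1 w + cos ((e i).2 b) * (e i).1.2 w)).
      rewrite RintB//; last by apply: bmfD; exact: bmfZ.
      rewrite RintD//; [|exact: bmfZ..]; rewrite !RintZ//.
      by rewrite (Rint_preimage (mtau b) (Mtau b) fC b2).
    apply: Rint_norm_le_ae => //; last by apply: filterS ei => w [].
      by apply: bmfB => //; apply: bmfD; exact: bmfZ.
    by rewrite divr_ge0.
  by apply: filterS2 h1 h2 => w ? ?.
(* Invariance under [b0] would give [A] and its translate [A'] equal integrals, but the gap [r]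
   persists in the limit. *)
- move=> inv; pose A' := tau (- b0) @^-1` A.
  have fA' : fin_meas M A' by exact: pre (mtau _) (Mtau _) fA.
  have A'A : tau b0 @^-1` A' = A.
    by apply/seteqP; split => w; rewrite /A' /preimage/= tauK.
  have : r <= \int[M]_(w in A) f1 w - \int[M]_(w in A') f1 w.
    have lim : (fun i => x1 A i - x1 A' i) @ F --> \int[M]_(w in A) f1 w - \int[M]_(w in A') f1 w.
      by apply: cvgB; exact: f1E.
    apply: (cvgr_to_ge lim); apply: nearW => i; have [[b1 _] _ _ re _] := eP i.
    apply: le_trans re _; rewrite /x1.
    by have := Rint_preimage (mtau b0) (Mtau b0) fA' b1; rewrite A'A => ->.
  have := Rint_preimage (mtau b0) (Mtau b0) fA' bf1; rewrite A'A => <-.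
  rewrite (@Rint_ae _ _ _ M A (fun w => f1 (tau b0 w)) f1)//.
  - by rewrite subrr leNgt r0.
  - exact: fA.1.
  - exact: (bmf_comp bf1 (mtau b0)).1.
  - exact: bf1.1.
Qed.

End WeakLimit.

Section SigmaFiniteProduct.
Context {R : realType} {d1 d2} {T1 : measurableType d1} {T2 : measurableType d2}.
Variables (m1 : {sigma_finite_measure set T1 -> \bar R}).
Variables (m2 : {sigma_finite_measure set T2 -> \bar R}).

(* A copy of [m1 \x m2] that canonically is a sigma-finite measure: the instance
   found for [\x] itself only covers subprobabilities. *)
Definition sigma_finite_product : set (T1 * T2) -> \bar R := (m1 \x m2)%E.

HB.instance Definition _ := Measure.on sigma_finite_product.

Let sigma_finite_product_sigma_finite : sigma_finite setT sigma_finite_product.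
Proof.
have /sigma_finiteP[A [AT A_nd fA]] := sigma_finiteT m1.
have /sigma_finiteP[B [BT B_nd fB]] := sigma_finiteT m2.
exists (fun n => A n `*` B n).
  apply/seteqP; split => // -[x y] _.
  have [n _ Anx] : (\bigcup_n A n) x by rewrite -AT.
  have [k _ Bky] : (\bigcup_n B n) y by rewrite -BT.
  have /subsetPset An := A_nd _ _ (leq_maxl n k).
  have /subsetPset Bk := B_nd _ _ (leq_maxr n k).
  by exists (maxn n k) => //; split; [exact: An|exact: Bk].
move=> n; have [mA Aoo] := fA n; have [mB Boo] := fB n; split; first exact: measurableX.
by rewrite /sigma_finite_product product_measure1E// lte_mul_pinfty ?ge0_fin_numE.
Qed.

HB.instance Definition _ := Measure_isSigmaFinite.Build _ _ _ sigma_finite_product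
  sigma_finite_product_sigma_finite.

End SigmaFiniteProduct.

(** * Haar measure on a second countable group *)

Lemma second_countable_sequence (T : topologicalType) : @second_countable T ->
  exists b : nat -> set T, (forall n, open (b n)) /\
    forall x V, nbhs x V -> exists n, b n x /\ b n `<=` V.
Proof.
move=> [B cB [Bo Bx]]; have /countable_injP[f fI] := cB.
pose P n U := B U /\ f U = n.
pose b n := match pselect (exists U, P n U) with
  | left h => projT1 (cid h) | right _ => set0 end.
exists b; split.
  move=> n; rewrite /b; case: pselect => [h|_]; last exact: open0.
  by have [BU _] := projT2 (cid h); exact: Bo.
move=> x V xV; have [U [BU Ux] UV] := Bx x V xV; exists (f U); rewrite /b.
case: pselect => [h|]; last by case; exists U.
have [BU' fU'] := projT2 (cid h); suff -> : projT1 (cid h) = U by [].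
by apply: fI => //; rewrite inE.
Qed.

Section BorelGroup.
Variable G : topologicalZmodType.
Hypothesis Gsc : @second_countable G.

Lemma Borel_open (O : set (Borel G)) : open (O : set G) -> measurable O.
Proof. by move=> oO; apply: sub_sigma_algebra. Qed.

(** Addition is continuous for the product topology, whereas a pair of measurable maps is controlled
    on rectangles only; second countability writes the preimage of an open set as a countable union
    of basic rectangles. *)
Lemma measurable_Borel_add {d} {T : measurableType d} (f g : T -> Borel G) :
  measurable_fun setT f -> measurable_fun setT g ->
  measurable_fun setT (fun x => f x + g x : Borel G).
Proof.
move=> mf mg; have [b [bo bP]] := second_countable_sequence Gsc.
apply: (@measurability _ _ _ (Borel G) _ _ (@open (Borel G)) erefl).
move=> _ [V oV <-]; rewrite setTI.
pose Q p := (b p.1 `*` b p.2 : set (G * G)) `<=` (fun z : G * G => z.1 + z.2) @^-1` V.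
rewrite (_ : _ @^-1` _ = \bigcup_(p : nat * nat)
   if pselect (Q p) then f @^-1` b p.1 `&` g @^-1` b p.2 else set0).
  apply: countable_bigcupT_measurable; first exact: countableP.
  move=> p; case: pselect => [?|?]//=.
  by apply: measurableI; rewrite -[X in measurable X]setTI;
    [apply: mf|apply: mg] => //; apply: Borel_open; exact: bo.
apply/seteqP; split => x.
  move=> Vfg; have : nbhs ((f x, g x) : G * G) ((fun z : G * G => z.1 + z.2) @^-1` V).
    by apply: (@add_continuous G (f x, g x)); apply: open_nbhs_nbhs; split.
  move=> [[V1 V2] /= [V1f V2g] V12].
  have [n [nf nV]] := bP _ _ V1f; have [m [mg' mV]] := bP _ _ V2g.
  exists (n, m) => //; case: pselect => [?|[]]// z [z1 z2].
  by apply: V12; split; [exact: nV|exact: mV].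
by move=> [p _]; case: pselect => [Qp [fp gp]|//]; exact: (Qp (f x, g x)).
Qed.

Lemma measurable_Borel_opp {d} {T : measurableType d} (f : T -> Borel G) :
  measurable_fun setT f -> measurable_fun setT (fun x => - f x : Borel G).
Proof.
move=> mf; apply: (@measurability _ _ _ (Borel G) _ _ (@open (Borel G)) erefl).
move=> _ [V oV <-]; rewrite setTI.
rewrite (_ : _ @^-1` _ = setT `&` f @^-1` ((-%R : G -> G) @^-1` V)); last by rewrite setTI.
apply: mf => //; apply: Borel_open.
by apply: open_comp => // x _; exact: opp_continuous.
Qed.

End BorelGroup.

Section HaarTopology.
Context {R : realType} {G : topologicalZmodType}.
Variable lam : {sigma_finite_measure set (Borel G) -> \bar R}.
Hypotheses (Gsc : @second_countable G) (Glc : locally_compact [set: G])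
  (lam_haar : haar lam).

Definition fin_open (O : set (Borel G)) := open (O : set G) /\ (lam O < +oo)%E.

Lemma fin_open_fin_meas O : fin_open O -> fin_meas lam O.
Proof. by move=> [oO fO]; split => //; exact: Borel_open. Qed.

Lemma fin_openI O P : fin_open O -> fin_open P -> fin_open (O `&` P).
Proof.
move=> fO fP; have [oO fO'] := fO; have [oP _] := fP; split; first exact: openI.
by apply: (fin_measI (fin_open_fin_meas fO) (fin_open_fin_meas fP).1).2.
Qed.

(** By local compactness every point has a basic neighbourhood inside a compact set, so the basic
    sets of finite Haar measure cover [G]. The others are replaced by the empty set, and [E n] is a
    union of [n] terms. *)
Lemma fin_open_exhaustion : exists E : nat -> set (Borel G),
  [/\ forall n, fin_open (E n), \bigcup_n E n = setT &
      {homo E : n m / (n <= m)%N >-> n `<=` m}].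
Proof.
have [b [bo bP]] := second_countable_sequence Gsc.
pose c n : set (Borel G) := if pselect (lam (b n) < +oo)%E then b n else set0.
have fc n : fin_open (c n).
  rewrite /c; case: pselect => [?|?]//=; split => //; first exact: open0.
  by rewrite measure0.
pose E n := \bigcup_(k in `I_n) c k.
exists E; split.
- elim=> [|n [oE fE]].
    rewrite /E II0 bigcup_set0; split; first exact: open0.
    by rewrite measure0.
  have -> : E n.+1 = E n `|` c n by rewrite /E IIS bigcup_setU bigcup_set1.
  split; first by apply: openU => //; exact: (fc n).1.
  have hE : fin_meas lam (E n) by split => //; exact: Borel_open.
  exact: (fin_measU hE (fin_open_fin_meas (fc n))).2.
- apply/seteqP; split => // x _.
  have [K] := @Glc x I; rewrite withinET => Kx [cK clK].
  have [n [nx nK]] := bP _ _ Kx; exists n.+1 => //; exists n; first exact: ltnSn.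
  rewrite /c; case: pselect => // -[]; have [_ [lamK _]] := lam_haar.
  apply: le_lt_trans (lamK K cK); apply: le_measure => //; rewrite inE.
    by apply: Borel_open; exact: bo.
  have -> : K = ~` (~` K) by rewrite setCK.
  by apply: measurableC; apply: Borel_open; exact: closed_openC.
- move=> n m nm x [k /= kn ck]; exists k => //=; exact: leq_trans kn nm.
Qed.

(* Only finitely many basic open sets are needed to exhaust [O] up to [eps], and
   each of them can be translated inside [O] by all small elements. *)
Lemma fin_open_translate (O : set (Borel G)) (eps : R) : fin_open O -> 0 < eps ->
  \forall a \near (0 : G), fine (lam (O `\` (fun x : Borel G => a + x) @^-1` O)) < eps.
Proof.
move=> fO eps0; have [oO _] := fO; have [b [bo bP]] := second_countable_sequence Gsc.
pose Q n := \forall a \near (0 : G), forall x, b n x -> O (a + x).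
pose c n : set (Borel G) := if pselect (Q n) then b n else set0.
have cQ n : \forall a \near (0 : G), forall x, c n x -> O (a + x).
  by rewrite /c; case: pselect => [?|?]//=; apply: nearW.
have mc n : measurable (c n).
  by rewrite /c; case: pselect => [?|?]//=; apply: Borel_open; exact: bo.
pose T n := O `\` \bigcup_(k in `I_n) c k.
have fT n : fin_meas lam (T n).
  by apply: fin_measD; [exact: fin_open_fin_meas|apply: bigcup_measurable].
have Oc : O `<=` \bigcup_k c k.
  move=> x Ox; have : nbhs ((0, x) : G * G) ((fun z : G * G => z.1 + z.2) @^-1` O).
    apply: (@add_continuous G (0, x)); apply: open_nbhs_nbhs; split => //=.
    by rewrite add0r.
  move=> [[V1 V2] /= [V1f V2g] V12]; have [n [nx nV]] := bP _ _ V2g.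
  exists n => //; rewrite /c; case: pselect => // -[].
  by apply: filterS V1f => a V1a y /nV V2y; exact: (V12 (a, y)).
have Tcvg : (fun n => lam (T n)) @ \oo --> lam (\bigcap_n T n).
  apply: nonincreasing_cvg_mu.
  - exact: (fT 0%N).2.
  - by move=> n; exact: (fT n).1.
  - by apply: bigcap_measurable => // n _; exact: (fT n).1.
  - move=> n m nm; apply/subsetPset => x [Ux nEx]; split => // -[k /= kn Ekx].
    by apply: nEx; exists k => //=; exact: leq_trans kn nm.
have T0 : \bigcap_n T n = set0.
  apply/seteqP; split => // x Tx; have [Ox _] := Tx 0%N I.
  have [k _ ckx] := Oc x Ox.
  by have [_ []] := Tx k.+1 I; exists k => /=.
rewrite T0 measure0 in Tcvg.
have : (fun n => fine (lam (T n))) @ \oo --> (0 : R) by apply: fine_cvg.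
move=> /cvgrPdist_lt /(_ eps eps0)[n _ /(_ n (leqnn n))] /=.
rewrite sub0r normrN ger0_norm ?fine_ge0// => Tn.
have : \forall a \near (0 : G), forall k, (k < n)%N -> forall x, c k x -> O (a + x).
  elim: n {Tn} => [|n IH]; first by apply: nearW.
  apply: filterS2 IH (cQ n) => a h1 h2 k; rewrite ltnS leq_eqVlt => /orP[/eqP ->//|].
  exact: h1.
apply: filterS => a h; apply: le_lt_trans Tn.
have fD : fin_meas lam (O `\` (fun x : Borel G => a + x) @^-1` O).
  apply: fin_measD; first exact: fin_open_fin_meas.
  rewrite -[X in measurable X]setTI.
  by apply: (measurable_Borel_add Gsc) => //; exact: Borel_open.
apply: fine_le; [by rewrite ge0_fin_numE// fD.2|by rewrite ge0_fin_numE// (fT n).2|].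
apply: le_measure; rewrite ?inE; [exact: fD.1|exact: (fT n).1|].
move=> x [Ox nOx]; split => // -[k kn ck]; apply: nOx; exact: h kn x ck.
Qed.

End HaarTopology.

Section Rectangles.
Context {R : realType} {G : topologicalZmodType} {d} {Z : measurableType d}.
Variable lam : {sigma_finite_measure set (Borel G) -> \bar R}.
Hypotheses (Gsc : @second_countable G) (Glc : locally_compact [set: G])
  (lam_haar : haar lam).
Let W := (Z * (Borel G * Borel G))%type.

(** A generating pi-system whose members change little under a small translation; the openness of
    the sides is what [fin_open_translate] exploits. *)
Definition open_rectangles : set (set W) := [set C | exists D V1 V2,
  [/\ measurable D, fin_open lam V1, fin_open lam V2 & C = D `*` (V1 `*` V2)]].

Lemma open_rectanglesI : setI_closed open_rectangles.
Proof.
move=> _ _ [D [V1 [V2 [mD f1 f2 ->]]]] [E [P1 [P2 [mE g1 g2 ->]]]].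
exists (D `&` E), (V1 `&` P1), (V2 `&` P2); split; last by rewrite !setXI.
- exact: measurableI.
- exact: fin_openI.
- exact: fin_openI.
Qed.

Lemma measurable_open_rectangles : @measurable _ W = <<s open_rectangles >>.
Proof.
have [E [fE ET Eh]] := fin_open_exhaustion Gsc Glc lam_haar.
apply/seteqP; split; last first.
  apply: smallest_sub; first exact: sigma_algebra_measurable.
  move=> _ [D [V1 [V2 [mD f1 f2 ->]]]]; apply: measurableX => //.
  by apply: measurableX; [exact: (fin_open_fin_meas f1).1|exact: (fin_open_fin_meas f2).1].
(* [W'] is [W] with the sigma-algebra generated by the rectangles. The remaining inclusion is the
   measurability of the identity from [W'] to [W], which is checked on the three coordinates. *)
pose W' := g_sigma_algebraType open_rectangles.
have ETX : forall g h, exists n, E n g /\ E n h.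
  move=> g h; have [n _ ng] : (\bigcup_n E n) g by rewrite ET.
  have [m _ mh] : (\bigcup_n E n) h by rewrite ET.
  exists (maxn n m); split; [exact: (Eh _ _ (leq_maxl _ _))|exact: (Eh _ _ (leq_maxr _ _))].
have rect D (V1 V2 : set (Borel G)) : measurable D -> open (V1 : set G) -> open (V2 : set G) ->
    measurable ((D `*` (V1 `*` V2)) : set W').
  move=> mD o1 o2.
  have -> : D `*` (V1 `*` V2) = \bigcup_n (D `*` ((V1 `&` E n) `*` (V2 `&` E n))).
    apply/seteqP; split => -[z [g h]] /=.
      move=> [Dz [Vg Vh]]; have [n [ng nh]] := ETX g h.
      by exists n.
    by move=> [n _ [Dz [[Vg _] [Vh _]]]].
  apply: bigcupT_measurable => n; apply: sub_sigma_algebra.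
  have fO (V : set (Borel G)) : open (V : set G) -> fin_open lam (V `&` E n).
    move=> oV; have [oE _] := fE n; split; first exact: openI.
    by apply: le_lt_trans (fE n).2; apply: le_measure; rewrite ?inE//;
      apply: Borel_open => //; exact: openI.
  by exists D, (V1 `&` E n), (V2 `&` E n); split => //; exact: fO.
have m1 : measurable_fun [set: W'] (fun w : W' => (w : W).1).
  move=> _ D mD; rewrite setTI.
  by have := rect D setT setT mD openT openT; rewrite setXTT setXT.
have m2 : measurable_fun [set: W'] (fun w : W' => (w : W).2.1).
  apply: (@measurability _ _ _ (Borel G) _ _ (@open (Borel G)) erefl).
  move=> _ [V oV <-]; rewrite setTI.
  by have := rect setT V setT measurableT oV openT; rewrite setTX setXT.
have m3 : measurable_fun [set: W'] (fun w : W' => (w : W).2.2).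
  apply: (@measurability _ _ _ (Borel G) _ _ (@open (Borel G)) erefl).
  move=> _ [V oV <-]; rewrite setTI.
  by have := rect setT setT V measurableT openT oV; rewrite !setTX.
have mid : measurable_fun [set: W'] (fun w : W' => ((w : W).1, ((w : W).2.1, (w : W).2.2))).
  by apply: measurable_fun_pair => //; exact: measurable_fun_pair.
move=> C mC; have := mid measurableT C mC; rewrite setTI.
by rewrite (_ : _ @^-1` C = C)//; apply/seteqP; split => -[z [g h]].
Qed.

End Rectangles.

Section WeightedMeasure.
Context {R : realType} {d} {W : measurableType d} (M : {measure set W -> \bar R}).
Variable f : W -> R.
Hypotheses (mf : measurable_fun setT f) (f0 : forall w, 0 <= f w).

Definition weighted_measure (_ : measurable_fun setT f) (_ : forall w, 0 <= f w) :=
  fun A : set W => (\int[M]_(w in A) (f w)%:E)%E.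

Let wm := weighted_measure mf f0.

Let wm0 : wm set0 = 0%E. Proof. exact: integral_set0. Qed.

Let wm_ge0 A : (0 <= wm A)%E.
Proof. by apply: integral_ge0 => w _; rewrite lee_fin. Qed.

Let wm_sigma_additive : semi_sigma_additive wm.
Proof. by apply: semi_sigma_additive_nng_induced => //; exact/measurable_EFinP. Qed.

HB.instance Definition _ := isMeasure.Build _ _ _ wm wm0 wm_ge0 wm_sigma_additive.

Definition weighted : {measure set W -> \bar R} := wm.

Lemma weightedE A : fin_meas M A -> bmf f -> weighted A = (\int[M]_(w in A) f w)%:E.
Proof.
move=> fA bf; rewrite /Rintegral fineK//.
exact: (integrable_fin_num fA.1 (bmf_integrable fA bf)).
Qed.

End WeightedMeasure.

(** Adding a common bound [K] turns both functions into densities of measures, finite on the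
    pi-system [S]; uniqueness of measures then extends the equality to all measurable sets. *)
Lemma ae_eq_of_pi_system {R : realType} {d} {W : measurableType d}
    (M : {sigma_finite_measure set W -> \bar R}) (S : set (set W)) (g : nat -> set W)
    (f f' : W -> R) :
  @measurable d W = <<s S >> -> setI_closed S -> (forall n, S (g n)) ->
  \bigcup_n g n = setT -> (forall C, S C -> fin_meas M C) -> bmf f -> bmf f' ->
  (forall C, S C -> \int[M]_(w in C) f w = \int[M]_(w in C) f' w) ->
  {ae M, forall w, f w = f' w}.
Proof.
move=> mS SI Sg gT fS bf bf' ff'.
have [mf [K1 fK1]] := bf; have [mf' [K2 fK2]] := bf'; pose K := Num.max K1 K2.
have pos h : (forall w : W, `|h w| <= K) -> forall w, 0 <= h w + K.
  by move=> hK w; have := hK w; rewrite ler_norml -lerBlDr sub0r => /andP[].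
have fK : forall w, 0 <= f w + K.
  by apply: pos => w; apply: le_trans (fK1 w) _; rewrite le_max lexx.
have fK' : forall w, 0 <= f' w + K.
  by apply: pos => w; apply: le_trans (fK2 w) _; rewrite le_max lexx orbT.
have bK : bmf (fun _ : W => K) by exact: bmf_cst.
have bfK := bmfD bf bK; have bfK' := bmfD bf' bK.
pose m1 := weighted M bfK.1 fK; pose m2 := weighted M bfK'.1 fK'.
have m12 : forall C : set W, measurable C -> m1 C = m2 C.
  apply: (measure_unique S g) => //.
  - by move=> C SC; have fC := fS C SC; rewrite !weightedE// !RintD// ff'.
  - by move=> n; rewrite weightedE ?ltry//; exact: fS.
apply: ae_of_fin_meas => A fA; apply: (ae_eq_of_Rint fA bf bf') => B mB BA.
have fB : fin_meas M B.
  by split => //; apply: le_lt_trans fA.2; apply: le_measure; rewrite ?inE//; exact: fA.1.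
have := m12 B mB; rewrite !weightedE// !RintD// => -[]; exact: addIr.
Qed.

(** Only the symmetric difference contributes, and its two halves have the same measure; hence the
    factor 2. *)
Lemma Rint_diff_le {R : realType} {d} {W : measurableType d} (M : {measure set W -> \bar R})
    (A B : set W) (f : W -> R) C : fin_meas M A -> fin_meas M B -> M A = M B ->
  bmf f -> (forall w, `|f w| <= C) ->
  `|\int[M]_(w in A) f w - \int[M]_(w in B) f w| <= 2 * C * fine (M (A `\` B)).
Proof.
move=> fA fB AB bf fC.
have split_int X Y : fin_meas M X -> fin_meas M Y ->
    \int[M]_(w in X) f w = \int[M]_(w in X `&` Y) f w + \int[M]_(w in X `\` Y) f w.
  move=> fX fY; rewrite -Rint_setU//; first by rewrite setUIDK.
  - by apply: fin_measI => //; exact: fY.1.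
  - by apply: fin_measD => //; exact: fY.1.
  - by apply/seteqP; split => // w [[_ Yw] [_ nYw]].
have AD : fin_meas M (A `\` B) by apply: fin_measD => //; exact: fB.1.
have BD : fin_meas M (B `\` A) by apply: fin_measD => //; exact: fA.1.
have ABI : fin_meas M (A `&` B) by apply: fin_measI => //; exact: fB.1.
have DE : fine (M (A `\` B)) = fine (M (B `\` A)).
  have split_mu X Y : fin_meas M X -> fin_meas M Y ->
      fine (M X) = fine (M (X `&` Y)) + fine (M (X `\` Y)).
    move=> fX fY.
    have fXI := fin_measI fX fY.1; have fXD := fin_measD fX fY.1.
    rewrite -fineD; last 2 first.
      by rewrite ge0_fin_numE// fXI.2.
      by rewrite ge0_fin_numE// fXD.2.
    congr fine; rewrite -measureU//.
    - by rewrite setUIDK.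
    - exact: fXI.1.
    - exact: fXD.1.
    - by apply/seteqP; split => // w [[_ Yw] [_ nYw]].
  have := split_mu A B fA fB; rewrite AB (split_mu B A fB fA) setIC.
  by move/addrI => ->.
rewrite (split_int A B fA fB) (split_int B A fB fA) (setIC B A) opprD addrACA subrr add0r.
apply: le_trans (ler_normB _ _) _.
have := Rint_norm_bound AD bf (fun w _ => fC w).
have := Rint_norm_bound BD bf (fun w _ => fC w).
by rewrite -DE; lra.
Qed.

(** Multiplication by the nonzero complex number [x + i y] is injective; the proof multiplies by the
    conjugate. *)
Lemma rotation_inj {R : realType} (c s c' s' x y : R) : ~ (x = 0 /\ y = 0) ->
  c * x - s * y = c' * x - s' * y -> s * x + c * y = s' * x + c' * y ->
  c = c' /\ s = s'.
Proof.
move=> xy h1 h2.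
have n0 : x ^+ 2 + y ^+ 2 != 0.
  apply/eqP => /eqP; rewrite paddr_eq0 ?sqr_ge0// !sqrf_eq0 => /andP[/eqP x0 /eqP y0].
  exact: xy.
split; apply: (mulIf n0).
  have -> : c * (x ^+ 2 + y ^+ 2) = x * (c * x - s * y) + y * (s * x + c * y) by ring.
  by rewrite h1 h2; ring.
have -> : s * (x ^+ 2 + y ^+ 2) = x * (s * x + c * y) - y * (c * x - s * y) by ring.
by rewrite h1 h2; ring.
Qed.

Lemma fine_measure_sub2 {R : realType} {d} {W : measurableType d}
    (M : {measure set W -> \bar R}) (A B C : set W) : fin_meas M A -> fin_meas M B ->
  fin_meas M C -> A `<=` B `|` C -> fine (M A) <= fine (M B) + fine (M C).
Proof.
move=> fA fB fC sub; rewrite -lee_fin EFinD !fin_meas_fineK//.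
apply: (@le_trans _ _ (M (B `|` C))); last by apply: measureU2; [exact: fB.1|exact: fC.1].
apply: le_measure => //; rewrite inE.
  exact: fA.1.
by apply: measurableU; [exact: fB.1|exact: fC.1].
Qed.

(** * Measurable eigenfunctions and continuous characters *)

Section Characters.
Context {R : realType} {G : topologicalZmodType} {d} {Z : measurableType d}.
Variable lam : {sigma_finite_measure set (Borel G) -> \bar R}.
Variable m : probability Z R.
Hypotheses (Gsc : @second_countable G) (Glc : locally_compact [set: G])
  (lam_haar : haar lam).
Let W := (Z * (Borel G * Borel G))%type.
Let M := sigma_finite_product m (sigma_finite_product lam lam).

Definition translation (h : G * G) (w : W) : W := (w.1, (h.1 + w.2.1, h.2 + w.2.2)).

Lemma measurable_translation h : measurable_fun setT (translation h).
Proof.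
apply: measurable_fun_pair => //; apply: measurable_fun_pair;
  apply: measurable_Borel_add => //; exact: measurableT_comp.
Qed.

Lemma translation_preserves h (A : set W) : measurable A ->
  M (translation h @^-1` A) = M A.
Proof.
have mh (a : Borel G) : measurable_fun setT (fun x : Borel G => a + x).
  by apply: measurable_Borel_add.
have h1 (B : set (Borel G * Borel G)) : measurable B ->
    (lam \x lam)%E ((fun p => (h.1 + p.1, h.2 + p.2)) @^-1` B) = (lam \x lam)%E B.
  apply: (@skew_product_preserves _ _ _ _ _ lam lam (fun x => h.1 + x) (fun _ y => h.2 + y)) => //.
  - by move=> C mC; exact: lam_haar.1.
  - by apply: measurable_Borel_add.
  - by move=> _ C mC; exact: lam_haar.1.
apply: (@skew_product_preserves _ _ _ _ _ m (sigma_finite_product lam lam) id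
  (fun _ p => (h.1 + p.1, h.2 + p.2))) => //.
by apply: measurable_fun_pair; apply: measurable_Borel_add => //;
  apply: measurableT_comp => //; exact: measurableT_comp.
Qed.

Lemma rectangle_measure_le D (V1 V2 : set (Borel G)) : measurable D ->
  fin_meas lam V1 -> fin_meas lam V2 ->
  fin_meas M (D `*` (V1 `*` V2)) /\
  fine (M (D `*` (V1 `*` V2))) <= fine (lam V1) * fine (lam V2).
Proof.
move=> mD f1 f2; have mV := measurableX f1.1 f2.1.
have ME : M (D `*` (V1 `*` V2)) = (m D * (lam V1 * lam V2))%E.
  rewrite [LHS](@product_measure1E _ _ _ _ _ m (sigma_finite_product lam lam))//.
    by congr *%E; rewrite [LHS]product_measure1E//; [exact: f1.1|exact: f2.1].
have MV : M (D `*` (V1 `*` V2)) = ((fine (m D)) * (fine (lam V1) * fine (lam V2)))%:E.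
  by rewrite ME !EFinM !fin_meas_fineK//; exact: fin_meas_probability.
split; first by split; [exact: measurableX|rewrite MV ltry].
rewrite MV /= ler_piMl//; first by rewrite mulr_ge0 ?fine_ge0.
by rewrite -lee_fin fin_meas_fineK ?probability_le1//; exact: fin_meas_probability.
Qed.

Lemma ae_eq0_of_open_rectangles (f : W -> R) : bmf f ->
  (forall C, open_rectangles lam C -> \int[M]_(w in C) f w = 0) ->
  {ae M, forall w, f w = 0}.
Proof.
move=> bf f0.
have fC C : open_rectangles lam C -> fin_meas M C.
  move=> [D [V1 [V2 [mD v1 v2 ->]]]].
  by have [] := rectangle_measure_le mD (fin_open_fin_meas v1) (fin_open_fin_meas v2).
have [E [fE ET Eh]] := fin_open_exhaustion Gsc Glc lam_haar.
apply: (ae_eq_of_pi_system (g := fun n => setT `*` (E n `*` E n))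
  (measurable_open_rectangles Gsc Glc lam_haar) (@open_rectanglesI _ _ _ _ _) _ _ fC bf (bmf_cst 0)).
- by move=> n; exists setT, (E n), (E n).
- apply/seteqP; split => // -[z [g h]] _.
  have [n _ ng] : (\bigcup_n E n) g by rewrite ET.
  have [k _ kh] : (\bigcup_n E n) h by rewrite ET.
  exists (maxn n k) => //; split => //; split.
    exact: (Eh _ _ (leq_maxl _ _)).
  exact: (Eh _ _ (leq_maxr _ _)).
- by move=> C oC; rewrite f0// Rintegral_cst ?mul0r//; exact: (fC C oC).1.
Qed.

Section eigencharacter.
Variables (e1 e2 : W -> R) (c s : (G * G)%type -> R).
Hypotheses (be1 : bmf e1) (be2 : bmf e2)
  (e_neq0 : ~ {ae M, forall w, e1 w = 0 /\ e2 w = 0})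
  (eigen : forall h, {ae M, forall w,
    e1 (translation h w) = c h * e1 w - s h * e2 w /\
    e2 (translation h w) = s h * e1 w + c h * e2 w})
  (cs1 : forall h, c h ^+ 2 + s h ^+ 2 = 1).

(** The equations for [h + h'], for [h'], and for [h] at the translated point hold together almost
    everywhere, and a single such point with nonzero [e] determines the eigenvalue. *)
Lemma eigencharacter_add h h' : c (h + h') = c h * c h' - s h * s h' /\
  s (h + h') = s h * c h' + c h * s h'.
Proof.
have hh' : {ae M, forall w, e1 (translation h (translation h' w)) =
      c h * e1 (translation h' w) - s h * e2 (translation h' w) /\
    e2 (translation h (translation h' w)) =
      s h * e1 (translation h' w) + c h * e2 (translation h' w)}.
  apply: (ae_comp (M' := M) (measurable_translation h') _ (eigen h)) => A mA A0.
  exact: (etrans (translation_preserves h' mA) A0).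
apply: contrapT => ncs; apply: e_neq0.
move: (eigen (h + h')) (eigen h') hh'; apply: filterS3 => w [p1 p2] [q1 q2] [r1 r2].
apply: contrapT => n0; apply: ncs.
have tE : translation (h + h') w = translation h (translation h' w).
  by rewrite /translation/= !addrA.
apply: (rotation_inj n0).
  by rewrite -p1 tE r1 q1 q2; ring.
by rewrite -p2 tE r2 q1 q2; ring.
Qed.

(* On an open rectangle [C] of nonzero integral [I], the eigenvalue equation gives
   [(chi h - 1) I] as the change of the integral when [C] is translated by [h]. *)
Lemma eigencharacter_cvg0 : (c @ (0 : (G * G)%type) --> (1 : R)) /\
  (s @ (0 : (G * G)%type) --> (0 : R)).
Proof.
have [K1 K1e] := be1.2; have [K2 K2e] := be2.2; pose K := Num.max 1 (Num.max K1 K2).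
have K0 : 0 < K by rewrite lt_max ltr01.
have e1K w : `|e1 w| <= K by apply: le_trans (K1e w) _; rewrite /K !le_max lexx orbT.
have e2K w : `|e2 w| <= K by apply: le_trans (K2e w) _; rewrite /K !le_max lexx !orbT.
have [C [rC IC]] : exists C, open_rectangles lam C /\
    ~ (\int[M]_(w in C) e1 w = 0 /\ \int[M]_(w in C) e2 w = 0).
  apply: contrapT => nC; apply: e_neq0.
  have h C : open_rectangles lam C -> \int[M]_(w in C) e1 w = 0 /\ \int[M]_(w in C) e2 w = 0.
    by move=> rC; apply: contrapT => nI; apply: nC; exists C.
  have h1 := ae_eq0_of_open_rectangles be1 (fun C rC => (h C rC).1).
  have h2 := ae_eq0_of_open_rectangles be2 (fun C rC => (h C rC).2).
  by apply: filterS2 h1 h2.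
have [D [V1 [V2 [mD v1 v2 CE]]]] := rC.
have f1 := fin_open_fin_meas v1; have f2 := fin_open_fin_meas v2.
have fC : fin_meas M C by rewrite CE; exact: (rectangle_measure_le mD f1 f2).1.
set I1 := \int[M]_(w in C) e1 w in IC; set I2 := \int[M]_(w in C) e2 w in IC.
pose N := I1 ^+ 2 + I2 ^+ 2.
have N0 : 0 < N.
  rewrite lt_neqAle addr_ge0 ?sqr_ge0// andbT eq_sym; apply/eqP => /eqP.
  rewrite paddr_eq0 ?sqr_ge0// !sqrf_eq0 => /andP[/eqP x0 /eqP y0].
  exact: IC.
pose del h := fine (M (C `\` translation h @^-1` C)).
have mtC h : measurable (translation h @^-1` C).
  by rewrite -[X in measurable X]setTI; apply: measurable_translation => //; exact: fC.1.
have ftC h : fin_meas M (translation h @^-1` C).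
  by split => //; rewrite translation_preserves; [exact: fC.2|exact: fC.1].
have tr h := measurable_translation h.
have tp h := @translation_preserves h.
have change (f : W -> R) h : bmf f -> (forall w, `|f w| <= K) ->
    `|\int[M]_(w in C) f (translation h w) - \int[M]_(w in C) f w| <= 2 * K * del h.
  move=> bf fK; rewrite -(Rint_preimage (tr h) (tp h) fC bf).
  exact: (Rint_diff_le fC (ftC h) (esym (tp h _ fC.1)) (bmf_comp bf (tr h))
    (fun w => fK _)).
have d1 h : `|(c h * I1 - s h * I2) - I1| <= 2 * K * del h.
  have := change e1 h be1 e1K; rewrite (@Rint_ae _ _ _ M C _ (fun w => c h * e1 w - s h * e2 w)).
  - by rewrite RintB//; [rewrite !RintZ|exact: bmfZ..].
  - exact: fC.1.
  - exact: (bmf_comp be1 (tr h)).1.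
  - by apply: (bmfB (bmfZ (c h) be1) (bmfZ (s h) be2)).1.
  - by apply: filterS (eigen h) => w [].
have d2 h : `|(s h * I1 + c h * I2) - I2| <= 2 * K * del h.
  have := change e2 h be2 e2K; rewrite (@Rint_ae _ _ _ M C _ (fun w => s h * e1 w + c h * e2 w)).
  - by rewrite RintD//; [rewrite !RintZ|exact: bmfZ..].
  - exact: fC.1.
  - exact: (bmf_comp be2 (tr h)).1.
  - by apply: (bmfD (bmfZ (s h) be1) (bmfZ (c h) be2)).1.
  - by apply: filterS (eigen h) => w [].
pose J := `|I1| + `|I2|.
have J0 : 0 <= J by rewrite addr_ge0.
(* This divides by [I1 + i I2]: multiplication by the conjugate leaves the real factor [N]. *)
have bound (x a b y z : R) : x * N = y * a + z * b -> `|y| + `|z| <= J ->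
    forall D, `|a| <= D -> `|b| <= D -> `|x| <= J * D / N.
  move=> xE yz D' aD bD; rewrite ler_pdivlMr// -[X in `|x| * X](gtr0_norm N0) -normrM xE.
  apply: le_trans (ler_normD _ _) _; rewrite !normrM.
  have D0 : 0 <= D' by exact: le_trans aD.
  have l1 : `|y| * `|a| <= `|y| * D' by exact: ler_wpM2l.
  have l2 : `|z| * `|b| <= `|z| * D' by exact: ler_wpM2l.
  apply: le_trans (lerD l1 l2) _; rewrite -mulrDl; exact: ler_wpM2r.
have cb h : `|c h - 1| <= J * (2 * K * del h) / N.
  apply: (bound _ _ _ I1 I2 _ _ _ (d1 h) (d2 h)) => //.
  by rewrite /N; ring.
have sb h : `|s h| <= J * (2 * K * del h) / N.
  apply: (bound _ _ _ (- I2) I1 _ _ _ (d1 h) (d2 h)).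
    by rewrite /N; ring.
  by rewrite normrN addrC.
have del0 (eps : R) : 0 < eps -> \forall h \near (0 : (G * G)%type), del h <= eps.
  move=> eps0; pose L := fine (lam V1) + fine (lam V2) + 1.
  have L0 : 0 < L by rewrite ltr_wpDl// addr_ge0// fine_ge0.
  have t1 := fin_open_translate Gsc v1 (divr_gt0 eps0 L0).
  have t2 := fin_open_translate Gsc v2 (divr_gt0 eps0 L0).
  have n1 : \forall h \near (0 : (G * G)%type),
      fine (lam (V1 `\` (fun x : Borel G => h.1 + x) @^-1` V1)) < eps / L.
    exact: (@cvg_fst _ _ (nbhs (0 : G)) (nbhs (0 : G)) _ _ t1).
  have n2 : \forall h \near (0 : (G * G)%type),
      fine (lam (V2 `\` (fun x : Borel G => h.2 + x) @^-1` V2)) < eps / L.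
    exact: (@cvg_snd _ _ (nbhs (0 : G)) (nbhs (0 : G)) _ _ t2).
  apply: filterS2 n1 n2 => h n1 n2.
  have madd (a : Borel G) V : fin_open lam V -> measurable ((fun x : Borel G => a + x) @^-1` V).
    move=> [oV _]; rewrite -[X in measurable X]setTI.
    by apply: (measurable_Borel_add Gsc) => //; exact: Borel_open.
  set A1 := V1 `\` _ in n1; set A2 := V2 `\` _ in n2.
  have fA1 : fin_meas lam A1 by apply: fin_measD => //; exact: madd.
  have fA2 : fin_meas lam A2 by apply: fin_measD => //; exact: madd.
  have [g1 l1] := rectangle_measure_le mD fA1 f2.
  have [g2 l2] := rectangle_measure_le mD f1 fA2.
  (* A point of [C] leaves [C] under [h] only if one of its two group coordinates leaves its open
     side. *)
  have sub : C `\` translation h @^-1` C `<=` (D `*` (A1 `*` V2)) `|` (D `*` (V1 `*` A2)).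
    rewrite CE => -[z [x y]] /= [[Dz [/= V1x V2y]] nV].
    have [V1h|nV1h] := pselect (V1 (h.1 + x)); last by left.
    by right; split => //; split => //; split => // V2h; apply: nV.
  have fD : fin_meas M (C `\` translation h @^-1` C) := fin_measD fC (mtC h).
  apply: le_trans (fine_measure_sub2 fD g1 g2 sub) _.
  apply: le_trans (lerD l1 l2) _.
  have m1 : fine (lam A1) * fine (lam V2) <= eps / L * fine (lam V2).
    by apply: ler_wpM2r; [exact: fine_ge0|exact: ltW].
  have m2 : fine (lam V1) * fine (lam A2) <= fine (lam V1) * (eps / L).
    by apply: ler_wpM2l; [exact: fine_ge0|exact: ltW].
  apply: le_trans (lerD m1 m2) _.
  have -> : eps / L * fine (lam V2) + fine (lam V1) * (eps / L) =
    eps * ((fine (lam V1) + fine (lam V2)) / L) by ring.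
  by apply: ler_piMr; [exact: ltW|rewrite ler_pdivrMr// mul1r /L lerDl].
have small (x : (G * G)%type -> R) : (forall h, `|x h| <= J * (2 * K * del h) / N) ->
    forall eps, 0 < eps -> \forall h \near (0 : (G * G)%type), `|x h| <= eps.
  move=> xb eps eps0; pose q := (J + 1) * (2 * K) / N.
  have q0 : 0 < q by rewrite divr_gt0// mulr_gt0// ?mulr_gt0// ltr_wpDl.
  have := del0 (eps / q) (divr_gt0 eps0 q0); apply: filterS => h dh.
  apply: le_trans (xb h) _.
  have de0 : 0 <= del h by exact: fine_ge0.
  apply: (@le_trans _ _ (q * del h)).
    have -> : J * (2 * K * del h) / N = J * (2 * K / N * del h) by ring.
    have -> : q * del h = (J + 1) * (2 * K / N * del h) by rewrite /q; ring.
    by apply: ler_wpM2r; [rewrite mulr_ge0// divr_ge0// ?mulr_ge0// ltW|rewrite lerDl].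
  by rewrite mulrC -ler_pdivlMr.
split.
  apply/cvgrPdist_le => eps eps0; have := small (fun h => c h - 1) cb eps eps0.
  by apply: filterS => h; rewrite distrC.
by apply/cvgr0Pnorm_le => eps eps0; exact: small sb eps eps0.
Qed.

(** Continuity at 0 spreads to every [h0] through the addition formulas at [(h - h0) + h0]. *)
Lemma eigencharacter : character2 c s.
Proof.
have [c0 s0] := eigencharacter_cvg0.
have shift (h0 : (G * G)%type) : (fun h : (G * G)%type => h - h0) @ h0 --> (0 : (G * G)%type).
  have := @sub_continuous G (h0.1, h0.1); have := @sub_continuous G (h0.2, h0.2) => /= k2 k1.
  have e1' : (fun h : (G * G)%type => h.1 - h0.1) @ h0 --> (0 : G).
    rewrite -[X in _ --> X](subrr h0.1).
    apply: (@cvg_comp _ _ _ (fun h : (G * G)%type => (h.1, h0.1)) (fun z : G * G => z.1 - z.2) _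
       (nbhs ((h0.1, h0.1) : G * G))) => //.
    by apply: cvg_pair; [exact: cvg_fst|exact: cvg_cst].
  have e2' : (fun h : (G * G)%type => h.2 - h0.2) @ h0 --> (0 : G).
    rewrite -[X in _ --> X](subrr h0.2).
    apply: (@cvg_comp _ _ _ (fun h : (G * G)%type => (h.2, h0.2)) (fun z : G * G => z.1 - z.2) _
       (nbhs ((h0.2, h0.2) : G * G))) => //.
    by apply: cvg_pair; [exact: cvg_snd|exact: cvg_cst].
  exact: cvg_pair e1' e2'.
have cE h0 h : c h = c (h - h0) * c h0 - s (h - h0) * s h0.
  by rewrite -(eigencharacter_add _ _).1 subrK.
have sE h0 h : s h = s (h - h0) * c h0 + c (h - h0) * s h0.
  by rewrite -(eigencharacter_add _ _).2 subrK.
have cs h0 : (fun h => c (h - h0)) @ h0 --> (1 : R) := cvg_comp _ _ (shift h0) c0.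
have ss h0 : (fun h => s (h - h0)) @ h0 --> (0 : R) := cvg_comp _ _ (shift h0) s0.
split; [|split; [|split; [exact: cs1|split]]].
- move=> h0; rewrite /continuous_at.
  have : (fun h => c (h - h0) * c h0 - s (h - h0) * s h0) @ h0 --> 1 * c h0 - 0 * s h0.
    exact: cvgB (cvgMl (b := c h0) (cs h0)) (cvgMl (b := s h0) (ss h0)).
  by rewrite mul1r mul0r subr0; have /funext <- := cE h0.
- move=> h0; rewrite /continuous_at.
  have : (fun h => s (h - h0) * c h0 + c (h - h0) * s h0) @ h0 --> 0 * c h0 + 1 * s h0.
    exact: cvgD (cvgMl (b := c h0) (ss h0)) (cvgMl (b := s h0) (cs h0)).
  by rewrite mul1r mul0r add0r; have /funext <- := sE h0.
- by move=> h h'; exact: (eigencharacter_add h h').1.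
- by move=> h h'; exact: (eigencharacter_add h h').2.
Qed.

End eigencharacter.
End Characters.

(** * Skew products and the Mackey action *)

Lemma measurable_eq_set {R : realType} {d} {W : measurableType d} (f g : W -> R) :
  measurable_fun setT f -> measurable_fun setT g -> measurable [set w | f w = g w].
Proof.
move=> mf mg; have := @measurable_fun_eqr _ _ _ _ _ _ mf mg measurableT [set true] I.
rewrite setTI; congr measurable; apply/seteqP; split => w /=.
  by move/eqP.
by move=> ->; exact: eqxx.
Qed.

Lemma ae_ex {R : realType} {d} {W : measurableType d} (M : {measure set W -> \bar R})
    (P : W -> Prop) : M setT != 0%E -> {ae M, forall w, P w} -> exists w, P w.
Proof.
move=> M0 h; apply: contrapT => nP; move/eqP: M0; apply.
apply/(ae_measure0 _ measurableT); apply: filterS h => w Pw _.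
by apply: nP; exists w.
Qed.

Lemma ae_cst {R : realType} {d} {W : measurableType d} (M : {measure set W -> \bar R})
    (P : Prop) : M setT != 0%E -> {ae M, forall w, P} -> P.
Proof. by move=> M0 /(ae_ex M0)[]. Qed.

Lemma fin_meas_neq0 {R : realType} {d} {W : measurableType d}
    (M : {sigma_finite_measure set W -> \bar R}) : M setT != 0%E ->
  exists2 K, fin_meas M K & M K != 0%E.
Proof.
move=> M0; apply: contrapT => nK; apply: (ae_cst (P := False) M0).
apply: ae_of_fin_meas => A fA; apply: contrapT => nA; apply: nK; exists A => //.
by apply/eqP => /(ae_measure0 _ fA.1) h; exact: nA.
Qed.

Section SkewProducts.
Context {R : realType} {G : topologicalZmodType} {d} {Z : measurableType d}.
Variable lam : {sigma_finite_measure set (Borel G) -> \bar R}.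
Variable m : probability Z R.
Hypotheses (Gsc : @second_countable G) (Glc : locally_compact [set: G])
  (lam_haar : haar lam).
Variables (U Ui : Z -> Z) (psi1 psi2 : Z -> Borel G).
Hypotheses (mU : measurable_fun setT U) (mUi : measurable_fun setT Ui)
  (UK : cancel U Ui) (mpU : forall A, measurable A -> m (U @^-1` A) = m A)
  (mpsi1 : measurable_fun setT psi1) (mpsi2 : measurable_fun setT psi2).
Let W := (Z * (Borel G * Borel G))%type.
Let M := sigma_finite_product m (sigma_finite_product lam lam).

Definition skew1 (p : Z * Borel G) : Z * Borel G := (U p.1, psi1 p.1 + p.2).
Definition skew2 (w : W) : W := (U w.1, (psi1 w.1 + w.2.1, psi2 w.1 + w.2.2)).
Definition skew2_inv (w : W) : W :=
  (Ui w.1, (- psi1 (Ui w.1) + w.2.1, - psi2 (Ui w.1) + w.2.2)).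

Hypothesis erg1 : ergodic (m \x lam)%E skew1.

Lemma measurable_skew1 : measurable_fun setT skew1.
Proof.
apply: measurable_fun_pair; first exact: measurableT_comp.
by apply: (measurable_Borel_add Gsc) => //; exact: measurableT_comp.
Qed.

Lemma measurable_skew2 : measurable_fun setT skew2.
Proof.
apply: measurable_fun_pair; first exact: measurableT_comp.
by apply: measurable_fun_pair; apply: (measurable_Borel_add Gsc);
  do ?exact: measurableT_comp; apply: measurableT_comp => //; exact: measurableT_comp.
Qed.

Lemma measurable_skew2_inv : measurable_fun setT skew2_inv.
Proof.
have m1 : measurable_fun setT (fun w : W => Ui w.1) by exact: measurableT_comp.
apply: measurable_fun_pair => //.
apply: measurable_fun_pair; apply: (measurable_Borel_add Gsc);
  do ?[by apply: measurable_Borel_opp; exact: measurableT_comp];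
  by apply: measurableT_comp => //; exact: measurableT_comp.
Qed.

Lemma skew2K : cancel skew2 skew2_inv.
Proof. by case=> z [g h]; rewrite /skew2 /skew2_inv/= UK !addKr. Qed.

Let madd (a : Borel G) : measurable_fun setT (fun x : Borel G => a + x).
Proof. by apply: (measurable_Borel_add Gsc). Qed.

Lemma skew1_preserves A : measurable A -> (m \x lam)%E (skew1 @^-1` A) = (m \x lam)%E A.
Proof.
apply: (@skew_product_preserves _ _ _ _ _ m lam U (fun z x => psi1 z + x)) => //.
  by apply: (measurable_Borel_add Gsc) => //; exact: measurableT_comp.
by move=> z B mB; exact: lam_haar.1.
Qed.

Lemma skew2_preserves A : measurable A -> M (skew2 @^-1` A) = M A.
Proof.
apply: (@skew_product_preserves _ _ _ _ _ m (sigma_finite_product lam lam) U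
  (fun z p => (psi1 z + p.1, psi2 z + p.2))) => //.
  have := measurable_skew2; move/measurable_fun_pairP => [_].
  exact.
move=> z B; apply: (@skew_product_preserves _ _ _ _ _ lam lam (fun x => psi1 z + x)
  (fun _ y => psi2 z + y)) => //.
- by move=> C mC; exact: lam_haar.1.
- by apply: (measurable_Borel_add Gsc).
- by move=> _ C mC; exact: lam_haar.1.
Qed.

(* Invariance under the second copy of [G] makes [u] a function of the first two
   coordinates, where the ergodicity of [skew1] applies. *)
Lemma invariant_const (u : W -> R) : bmf u -> {ae M, forall w, u (skew2 w) = u w} ->
  (forall b : G, {ae M, forall w, u (translation (0, b) w) = u w}) ->
  exists c, {ae M, forall w, u w = c}.
Proof.
move=> bu uU utau.
have [K fK K0] := fin_meas_neq0 (haar_setT_neq0 lam_haar).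
pose L := fine (lam K).
have L0 : L != 0 by apply: contra K0 => /eqP L0; rewrite -(fin_meas_fineK fK) -/L L0.
(* The average of the last coordinate over one set [K] is a measurable function on [Z * G], defined
   at every point, that agrees with [u] almost everywhere. *)
pose uK p := L^-1 * \int[lam]_(g in K) u (p.1, (p.2, g)).
have bK : bmf uK.
  apply: bmfZ; apply: (@bmf_int1 _ _ _ _ _ lam K fK
    (fun q : Borel G * (Z * Borel G) => u (q.2.1, (q.2.2, q.1)))).
  apply: bmf_comp bu _; apply: measurable_fun_pair; first exact: measurableT_comp.
  by apply: measurable_fun_pair => //; exact: measurableT_comp.
have uE : {ae M, forall w, u w = uK (w.1, w.2.1)}.
  have : {ae (M \x lam)%E, forall p, u (translation (0, p.2) p.1) = u p.1}.
    apply: ae_prod2; last by apply: aeW => b; exact: utau.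
    apply: measurable_eq_set; last by apply: measurableT_comp => //; exact: bu.1.
    apply: (measurableT_comp bu.1).
    have m12 : measurable_fun setT (fun p : W * Borel G => p.1.2) by exact: measurableT_comp.
    apply: measurable_fun_pair; first exact: measurableT_comp.
    apply: measurable_fun_pair; apply: (measurable_Borel_add Gsc) => //.
      exact: (measurableT_comp measurable_fst m12).
      exact: measurable_snd.
    exact: (measurableT_comp measurable_snd m12).
  move=> /ae_fubini1; apply: filterS => -[z [g1 g2]] /= h.
  have {}h : {ae lam, forall g, u (z, (g1, g)) = u (z, (g1, g2))}.
    have mg : measurable_fun setT (fun x : Borel G => x - g2).
      by apply: (measurable_Borel_add Gsc).
    have := ae_comp mg (fun A mA => eq_trans (haar_translate lam_haar (- g2) mA)) h.
    by apply: filterS => g; rewrite /translation/= add0r subrK.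
  rewrite /uK/= (@Rint_ae _ _ _ lam K _ (cst (u (z, (g1, g2)))))//.
  - by rewrite Rintegral_cst ?mulrA; [rewrite mulrAC -/L mulVf// mul1r|exact: fK.1].
  - exact: fK.1.
  - have mg : measurable_fun setT (fun g : Borel G => (z, (g1, g)) : W).
      by apply: measurable_fun_pair => //; exact: measurable_fun_pair.
    exact: (bmf_comp bu mg).1.
have uKs : {ae (m \x lam)%E, forall p, uK (skew1 p) = uK p}.
  have h1 : {ae M, forall w, u (skew2 w) = uK ((skew2 w).1, (skew2 w).2.1)}.
    apply: (ae_comp (M' := M) measurable_skew2 _ uE) => A mA A0.
    exact: etrans (skew2_preserves mA) A0.
  have : {ae M, forall w, uK (skew1 (w.1, w.2.1)) = uK (w.1, w.2.1)}.
    move: uE h1 uU; apply: filterS3 => w e1 e2 e3.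
    by rewrite -e1 -e3 e2.
  move=> /ae_fubini1 h; apply: ae_prod1.
    by apply: measurable_eq_set; [exact: (bmf_comp bK measurable_skew1).1|exact: bK.1].
  apply: filterS h => z /ae_fubini1; apply: filterS => g1 /=.
  exact: (ae_cst (haar_setT_neq0 lam_haar)).
have [c uKc] := ergodic_ae_const measurable_skew1 skew1_preserves erg1 bK uKs.
exists c; have : {ae M, forall w, uK (w.1, w.2.1) = c}.
  have bKw : measurable_fun setT (fun w : W => uK (w.1, w.2.1)).
    have mp : measurable_fun setT (fun w : W => (w.1, w.2.1)).
      by apply: measurable_fun_pair => //; exact: measurableT_comp.
    exact: (bmf_comp bK mp).1.
  apply: ae_prod1; first exact: measurable_eq_set.
  move/ae_fubini1 : uKc; apply: filterS => z h; apply: ae_prod1.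
    apply: measurable_eq_set => //.
    exact: (measurableT_comp bKw (pair1_measurable z)).
  by apply: filterS h => g1 h; exact: aeW.
by apply: filterS2 uE => w -> ->.
Qed.

End SkewProducts.

Lemma ae_on_of_ae {R : realType} {d} {W : measurableType d}
    (M : {measure set W -> \bar R}) (P : W -> Prop) : {ae M, forall w, P w} -> ae_on M P.
Proof. by move=> [N [mN N0 PN]]; exists N. Qed.

Section MackeyEigenfunctions.
Context {R : realType} {G : topologicalZmodType} {d} {Z : measurableType d}.
Variable lam : {sigma_finite_measure set (Borel G) -> \bar R}.
Variable m : probability Z R.
Hypotheses (Gsc : @second_countable G) (Glc : locally_compact [set: G])
  (lam_haar : haar lam).
Variables (U : Z -> Z) (psi1 psi2 : Z -> Borel G).
Hypotheses (mU : measurable_fun setT U)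
  (mpU : forall A, measurable A -> m (U @^-1` A) = m A)
  (mpsi1 : measurable_fun setT psi1) (mpsi2 : measurable_fun setT psi2).
Hypothesis erg1 : ergodic (m \x lam)%E (skew1 U psi1).
Hypothesis mackey : mackey_weakly_mixing lam m U (fun z => (psi1 z : G, psi2 z : G)).
Let W := (Z * (Borel G * Borel G))%type.
Let M := sigma_finite_product m (sigma_finite_product lam lam).
Let tau : G * G -> W -> W := @translation G d Z.

Lemma translationC (h k : G * G) (w : W) : tau h (tau k w) = tau k (tau h w).
Proof. by rewrite /tau /translation/= (addrCA h.1) (addrCA h.2). Qed.

Lemma translation_skew2 (h : G * G) (w : W) :
  tau h (skew2 U psi1 psi2 w) = skew2 U psi1 psi2 (tau h w).
Proof.
by rewrite /tau /translation /skew2/= (addrCA h.1) (addrCA h.2).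
Qed.

Let ae_tau h (P : W -> Prop) : {ae M, forall w, P w} -> {ae M, forall w, P (tau h w)}.
Proof.
apply: (ae_comp (M' := M) (measurable_translation Gsc h)) => A mA A0.
exact: etrans (translation_preserves m Gsc lam_haar h mA) A0.
Qed.

Variables (e1 e2 : W -> R).
Hypotheses (be1 : bmf e1) (be2 : bmf e2)
  (eU : {ae M, forall w, e1 (skew2 U psi1 psi2 w) = e1 w /\ e2 (skew2 U psi1 psi2 w) = e2 w})
  (eT : forall b : G, exists c s, c ^+ 2 + s ^+ 2 = 1 /\ {ae M, forall w,
     e1 (tau (0, b) w) = c * e1 w - s * e2 w /\ e2 (tau (0, b) w) = s * e1 w + c * e2 w}).

(* For [h] in [G * G] the function [e (tau h w) * conj (e w)] is invariant, hence
   constant: [e] is an eigenfunction of the whole of [G * G]. *)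
Lemma mackey_eigenfunction_invariant (b0 : G) :
  {ae M, forall w, e1 (tau (0, b0) w) = e1 w}.
Proof.
apply: contrapT => ninv.
have bt (f : W -> R) h : bmf f -> bmf (fun w => f (tau h w)).
  by move=> bf; exact: bmf_comp bf (measurable_translation Gsc h).
have iconst := invariant_const Gsc lam_haar mU mpU mpsi1 mpsi2 erg1.
have [kap kapE] : exists kap, {ae M, forall w, e1 w ^+ 2 + e2 w ^+ 2 = kap}.
  apply: iconst; first by apply: bmfD; exact: bmf_sqr.
    by apply: filterS eU => w [-> ->].
  move=> b; have [c [s [cs1 h]]] := eT b; apply: filterS h => w [h1 h2].
  rewrite -/(tau (0, b) w) h1 h2.
  by rewrite -[RHS]mul1r -cs1; ring.
have e_neq0 : ~ {ae M, forall w, e1 w = 0 /\ e2 w = 0}.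
  move=> e0; apply: ninv; apply: filterS2 e0 (ae_tau (0, b0) e0) => w [-> _] [-> _].
  by [].
have kap0 : kap != 0.
  apply/eqP => k0; apply: e_neq0; apply: filterS kapE => w /eqP.
  by rewrite k0 paddr_eq0 ?sqr_ge0// !sqrf_eq0 => /andP[/eqP -> /eqP ->].
have /choice[P PE] : forall h, exists c, {ae M, forall w,
    e1 (tau h w) * e1 w + e2 (tau h w) * e2 w = c}.
  move=> h; apply: iconst.
  - by apply: bmfD; apply: bmfM => //; exact: bt.
  - apply: filterS2 eU (ae_tau h eU) => w [u1 u2] [v1 v2].
    by rewrite translation_skew2 u1 u2 v1 v2.
  - move=> b; have [c [s [cs1 eb]]] := eT b.
    apply: filterS2 eb (ae_tau h eb) => w [u1 u2] [v1 v2].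
    rewrite -/(tau (0, b) w) translationC u1 u2 v1 v2.
    by rewrite -[RHS]mul1r -cs1; ring.
have /choice[Q QE] : forall h, exists c, {ae M, forall w,
    e2 (tau h w) * e1 w - e1 (tau h w) * e2 w = c}.
  move=> h; apply: iconst.
  - by apply: bmfB; apply: bmfM => //; exact: bt.
  - apply: filterS2 eU (ae_tau h eU) => w [u1 u2] [v1 v2].
    by rewrite translation_skew2 u1 u2 v1 v2.
  - move=> b; have [c [s [cs1 eb]]] := eT b.
    apply: filterS2 eb (ae_tau h eb) => w [u1 u2] [v1 v2].
    rewrite -/(tau (0, b) w) translationC u1 u2 v1 v2.
    by rewrite -[RHS]mul1r -cs1; ring.
pose c h := P h / kap; pose s h := Q h / kap.
have eigen h : {ae M, forall w, e1 (tau h w) = c h * e1 w - s h * e2 w /\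
    e2 (tau h w) = s h * e1 w + c h * e2 w}.
  move: kapE (PE h) (QE h); apply: filterS3 => w k p q.
  split; apply: (mulIf kap0).
    rewrite /c /s mulrBl mulrAC divfK// [X in _ = _ - X]mulrAC divfK//.
    by rewrite -k -p -q; ring.
  rewrite /c /s mulrDl mulrAC divfK// [X in _ = _ + X]mulrAC divfK//.
  by rewrite -k -p -q; ring.
(* The translate of [e] has the same squared modulus [kap] at almost every point, so the multiplier
   has modulus 1. *)
have cs1 h : c h ^+ 2 + s h ^+ 2 = 1.
  apply: contrapT => n1; apply: e_neq0.
  move: kapE (ae_tau h kapE) (eigen h); apply: filterS3 => w k kt [u1 u2].
  exfalso; apply: n1; apply: (mulIf kap0).
  by rewrite mul1r -[RHS]kt u1 u2 -k; ring.
have char := eigencharacter Gsc Glc lam_haar be1 be2 e_neq0 eigen cs1.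
have c1 : forall h, c h = 1.
  apply: (mackey char); exists e1, e2; split; first exact: be1.1.
  split; first exact: be2.1.
  split.
    have [K1 h1] := be1.2; have [K2 h2] := be2.2.
    exists (Num.max K1 K2) => w; split; [apply: le_trans (h1 w) _|apply: le_trans (h2 w) _].
      by rewrite le_max lexx.
    by rewrite le_max lexx orbT.
  split.
    by move=> [N [mN [N0 NP]]]; apply: e_neq0; exists N; split.
  split; first exact: (ae_on_of_ae (M := M) eU).
  by move=> h; exact: (ae_on_of_ae (M := M) (eigen h)).
apply: ninv; apply: filterS (eigen (0, b0)) => w [-> _].
have := cs1 (0, b0); rewrite c1 expr1n => /eqP; rewrite -subr_eq0 addrAC subrr add0r.
by rewrite sqrf_eq0 => /eqP ->; rewrite mul1r mul0r subr0.
Qed.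

End MackeyEigenfunctions.

(** * Product measures tested on rectangles *)

Section FiniteRectangles.
Context {R : realType} {d1 d2} {W : measurableType d1} {Y : measurableType d2}.
Variables (M : {sigma_finite_measure set W -> \bar R}) (nu : probability Y R).

Lemma Rint_rectangle A D (f : W * Y -> R) : fin_meas M A -> measurable D -> bmf f ->
  \int[(M \x nu)%E]_(p in A `*` D) f p = \int[nu]_(y in D) \int[M]_(w in A) f (w, y).
Proof.
move=> fA mD bf; pose f' p := f p * \1_D p.2.
have bD : bmf (fun p : W * Y => (\1_D p.2 : R)).
  by apply: (bmf_comp (f := \1_D : Y -> R)) => //; exact: bmf_indic.
have bf' : bmf f' by exact: bmfM.
have -> : A `*` D = (A `*` setT) `&` (setT `*` D) by rewrite -setXI setIT setTI.
rewrite Rintegral_mkcondr patch_indic.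
have -> : f \* \1_(setT `*` D) = f'.
  by apply/funext => -[w y]; rewrite /f' /= indicE in_setX in_setT.
rewrite (Rint_strip nu fA bf') (Rint_fubini nu fA bf').
rewrite -[D in RHS]setTI Rintegral_mkcondr patch_indic; apply: eq_Rintegral => y _ /=.
rewrite /f' /= mulrC -RintZ//; last exact: bmf_section2.
by apply: eq_Rintegral => w _; rewrite mulrC.
Qed.

Definition fin_rectangles : set (set (W * Y)) := [set C | exists A D,
  [/\ fin_meas M A, measurable D & C = A `*` D]].

Lemma fin_rectangles_measurable : @measurable _ (W * Y)%type = <<s fin_rectangles >>.
Proof.
apply/seteqP; split; last first.
  apply: smallest_sub; first exact: sigma_algebra_measurable.
  by move=> _ [A [D [fA mD ->]]]; apply: measurableX => //; exact: fA.1.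
rewrite measurable_prod_measurableType; apply: smallest_sub.
  exact: smallest_sigma_algebra.
move=> _ [A mA [D mD <-]].
have /sigma_finiteP[E [ET _ fE]] := sigma_finiteT M.
pose W' := g_sigma_algebraType fin_rectangles.
have -> : A `*` D = \bigcup_n ((A `&` E n) `*` D).
  apply/seteqP; split => -[w y] /=.
    move=> [Aw Dy]; have [n _ nw] : (\bigcup_n E n) w by rewrite -ET.
    by exists n.
  by move=> [n _ [[Aw _] Dy]].
suff : measurable ((\bigcup_n ((A `&` E n) `*` D)) : set W') by [].
apply: bigcupT_measurable => n; apply: sub_sigma_algebra.
exists (A `&` E n), D; split => //; rewrite setIC.
exact: (fin_measI (M := M) (fE n) mA).
Qed.

Lemma fin_rectanglesI : setI_closed fin_rectangles.
Proof.
move=> _ _ [A [D [fA mD ->]]] [A' [D' [fA' mD' ->]]].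
exists (A `&` A'), (D `&` D'); split; [|exact: measurableI|by rewrite setXI].
by apply: fin_measI => //; exact: fA'.1.
Qed.

Lemma fin_rectangles_exhaustion : exists g : nat -> set (W * Y),
  (forall n, fin_rectangles (g n)) /\ \bigcup_n g n = setT.
Proof.
have /sigma_finiteP[E [ET _ fE]] := sigma_finiteT M.
exists (fun n => E n `*` setT); split.
  by move=> n; exists (E n), setT; split => //; exact: fE.
apply/seteqP; split => // -[w y] _.
by have [n _ nw] : (\bigcup_n E n) w; [rewrite -ET|exists n].
Qed.

Lemma fin_rectangleE A D : fin_meas M A -> measurable D ->
  sigma_finite_product M nu (A `*` D) = (fine (M A) * fine (nu D))%:E.
Proof.
move=> fA mD; rewrite [LHS]product_measure1E//; last exact: fA.1.
by rewrite EFinM !fin_meas_fineK//; exact: fin_meas_probability.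
Qed.

Lemma ae_cst_of_rectangles (f : W * Y -> R) c : bmf f ->
  (forall A D, fin_meas M A -> measurable D ->
     \int[(M \x nu)%E]_(p in A `*` D) f p = c * (fine (M A) * fine (nu D))) ->
  {ae (M \x nu)%E, forall p, f p = c}.
Proof.
move=> bf fc; have [g [Sg gT]] := fin_rectangles_exhaustion.
apply: (@ae_eq_of_pi_system _ _ _ (sigma_finite_product M nu) _ g
  _ (cst c) fin_rectangles_measurable fin_rectanglesI Sg gT) => //.
- move=> _ [A [D [fA mD ->]]]; split; first by apply: measurableX => //; exact: fA.1.
  exact: (eq_ind_r (fun x => x < +oo)%E (ltry _) (fin_rectangleE fA mD)).
- exact: bmf_cst.
- move=> _ [A [D [fA mD ->]]]; rewrite [LHS]fc// Rintegral_cst.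
    exact: (congr1 (fun x => c * fine x) (esym (fin_rectangleE fA mD))).
  by apply: measurableX => //; exact: fA.1.
Qed.

Lemma product_measure_unique_scaled (M' : {measure set (W * Y) -> \bar R}) (r : {nonneg R}) :
  (forall A D, fin_meas M A -> measurable D ->
     M' (A `*` D) = (r%:num%:E * (M A * nu D))%E) ->
  forall F, measurable F -> M' F = (r%:num%:E * (M \x nu)%E F)%E.
Proof.
move=> M'E; have [g [Sg gT]] := fin_rectangles_exhaustion.
move=> F mF; apply: (@measure_unique _ _ _ fin_rectangles g fin_rectangles_measurable
  fin_rectanglesI Sg gT M' (mscale r (sigma_finite_product M nu)) _ _ F mF).
- move=> _ [A [D [fA mD ->]]]; rewrite M'E//; congr *%E.
  by rewrite [RHS]product_measure1E//; exact: fA.1.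
- move=> n; have [A [D [fA mD ->]]] := Sg n; rewrite M'E//.
  by rewrite -(fin_meas_fineK fA) -(fin_meas_fineK (fin_meas_probability nu mD)) -!EFinM ltry.
Qed.

End FiniteRectangles.

Lemma ae_eq0_of_Rint_sqr {R : realType} {d} {Y : measurableType d} (nu : probability Y R)
    (f : Y -> R) : bmf f -> \int[nu]_y (f y ^+ 2) <= 0 -> {ae nu, forall y, f y = 0}.
Proof.
move=> bf f0; have b2 := bmf_sqr bf; have fT := fin_meas_probability nu measurableT.
have i0 : (\int[nu]_(y in setT) `|(f y ^+ 2)%:E|)%E = 0%E.
  have fin := integrable_fin_num measurableT (bmf_integrable fT b2).
  have -> : (\int[nu]_(y in setT) `|(f y ^+ 2)%:E|)%E = (\int[nu]_y (f y ^+ 2)%:E)%E.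
    by apply: eq_integral => y _; rewrite gee0_abs// lee_fin sqr_ge0.
  rewrite -(fineK fin); congr EFin; apply/eqP; rewrite eq_le f0/=.
  by apply: Rintegral_ge0 => y _; exact: sqr_ge0.
have := (@ae_eq_integral_abs _ _ _ nu setT measurableT (fun y => (f y ^+ 2)%:E) _).1.
move=> /(_ _ i0) h; apply: filterS (h _) => [y /(_ I)|]; last by apply/measurable_EFinP; exact: b2.1.
by move=> [] /eqP; rewrite sqrf_eq0 => /eqP.
Qed.

Lemma zero_one_of_indic {R : realType} {d} {W : measurableType d}
    (M : {measure set W -> \bar R}) (B : set W) (c : R) : measurable B ->
  {ae M, forall w, \1_B w = c} -> M B = 0%E \/ M (~` B) = 0%E.
Proof.
move=> mB Bc; have [c1|c1] := eqVneq c 1; [right|left].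
  apply/(ae_measure0 M (measurableC mB)); apply: filterS Bc => w; rewrite c1 indicE.
  by case: (boolP (w \in B)) => [/set_mem Bw _ //|_ /eqP]; rewrite eq_sym oner_eq0.
apply/(ae_measure0 M mB); apply: filterS Bc => w; rewrite indicE => Bw /mem_set wB.
by move: Bw c1; rewrite wB => <-; rewrite eqxx.
Qed.

Lemma measurable_ae_section {R : realType} {d1 d2} {T1 : measurableType d1}
    {T2 : measurableType d2} (m2 : {sigma_finite_measure set T2 -> \bar R})
    (P : T1 * T2 -> Prop) : measurable [set z | P z] ->
  measurable [set x | {ae m2, forall y, P (x, y)}].
Proof.
move=> mP; have mN := measurableC mP.
have -> : [set x | {ae m2, forall y, P (x, y)}] =
    (m2 \o xsection (~` [set z | P z])) @^-1` [set 0%E].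
  apply/seteqP; split => x /=.
    move=> h; apply/(ae_measure0 m2 (measurable_xsection x mN)).
    by apply: filterS h => y Pxy; rewrite /xsection/= inE.
  move/(ae_measure0 m2 (measurable_xsection x mN)); apply: filterS => y.
  by rewrite /xsection/= inE => /contrapT.
have := measurable_fun_xsection m2 mN measurableT (emeasurable_set1 0%E).
by rewrite setTI.
Qed.

(** * Ergodicity of the extension by [Y] and the first copy of [G] *)

Section SkewRokhlin.
Context {R : realType} {G : topologicalZmodType} {d dY} {Z : measurableType d}
  {Y : measurableType dY}.
Variable lam : {sigma_finite_measure set (Borel G) -> \bar R}.
Variables (m : probability Z R) (nu : probability Y R).
Hypotheses (Gsc : @second_countable G) (Glc : locally_compact [set: G])
  (lam_haar : haar lam).
Variables (U Ui : Z -> Z) (psi1 psi2 : Z -> Borel G).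
Hypotheses (mU : measurable_fun setT U) (mUi : measurable_fun setT Ui)
  (UK : cancel U Ui) (mpU : forall A, measurable A -> m (U @^-1` A) = m A)
  (mpsi1 : measurable_fun setT psi1) (mpsi2 : measurable_fun setT psi2).
Hypothesis erg1 : ergodic (m \x lam)%E (skew1 U psi1).
Hypothesis mackey : mackey_weakly_mixing lam m U (fun z => (psi1 z : G, psi2 z : G)).
Variable S : Borel G -> Y -> Y.
Hypotheses (mS : measurable_fun setT (fun p : Borel G * Y => S p.1 p.2))
  (S0 : forall y, S 0 y = y) (S_add : forall g h y, S (g + h) y = S g (S h y))
  (nuS : forall g A, measurable A -> nu (S g @^-1` A) = nu A)
  (S_ergodic : forall A, measurable A -> (forall g, S g @^-1` A = A) ->
     nu A = 0%E \/ nu (~` A) = 0%E).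
Let W := (Z * (Borel G * Borel G))%type.
Let M := sigma_finite_product m (sigma_finite_product lam lam).
Let tau (b : G) : W -> W := @translation G d Z (0, b).

Let mSg g : measurable_fun setT (S g).
Proof. exact: (measurableT_comp mS (pair1_measurable g)). Qed.

Definition skew_rokhlin (w : (Z * Y) * Borel G) : (Z * Y) * Borel G :=
  ((U w.1.1, S (psi2 w.1.1) w.1.2), psi1 w.1.1 + w.2).

Let iconst u bu uU uT := @invariant_const _ _ _ _ lam m Gsc lam_haar _ _ _ mU mpU mpsi1 mpsi2
  erg1 u bu uU uT.

Let tau0 w : tau 0 w = w.
Proof. by case: w => z [g h]; rewrite /tau /translation/= !add0r. Qed.

Let tau_add b c w : tau (b + c) w = tau b (tau c w).
Proof. by case: w => z [g h]; rewrite /tau /translation/= !add0r addrA. Qed.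

Section equivariant_function.
Variable a : W * Y -> R.
Hypothesis ea : equivariant (skew2 U psi1 psi2) tau S a.
Let t A y := \int[M]_(w in A) a (w, y).

Let bmf_t A : fin_meas M A -> bmf (t A).
Proof. by have [ba _ _] := ea => fA; exact: (bmf_int1 fA ba). Qed.

(** If the coboundary of the average had positive norm, the approximate eigenfunctions would have as
    a limit an eigenfunction not fixed by [b0], against [mackey_eigenfunction_invariant]. *)
Lemma equivariant_marginal_invariant A b0 : fin_meas M A ->
  {ae nu, forall y, t A (S b0 y) = t A y}.
Proof.
move=> fA; have [T0|T0] := leP (\int[nu]_y ((t A y - t A (S b0 y)) ^+ 2)) 0.
  have bt := bmfB (bmf_t fA) (bmf_comp (bmf_t fA) (mSg b0)).
  by apply: filterS (ae_eq0_of_Rint_sqr bt T0) => y /eqP; rewrite subr_eq0 => /eqP.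
have [r r0 app] := approximate_eigenfunction mSg nuS S_add iconst fA ea T0.
have k0 : 0 <= 2 * fine (M A) by rewrite mulr_ge0// fine_ge0.
have [e1 [e2 [[be1 be2] eU eT ninv]]] := eigenfunction_of_approximate
  (measurable_skew2 Gsc mU mpsi1 mpsi2) (measurable_skew2_inv Gsc mUi mpsi1 mpsi2)
  (skew2K psi1 psi2 UK) (skew2_preserves Gsc lam_haar mU mpU mpsi1 mpsi2)
  (fun b => measurable_translation Gsc (0, b))
  (fun b => translation_preserves m Gsc lam_haar (0, b)) tau0 tau_add fA k0 r0 app.
exfalso; apply: ninv.
exact: (mackey_eigenfunction_invariant Gsc Glc lam_haar mU mpU mpsi1 mpsi2 erg1 mackey be1 be2 eU eT).
Qed.

(** Every average over a set [A] is constant in [y] by ergodicity of [S], and the average over [Y]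
    is constant in [w], which identifies the constants. The integrals over rectangles [A * D] are
    then those of a constant function. *)
Lemma equivariant_ae_const : exists c, {ae (M \x nu)%E, forall p, a p = c}.
Proof.
have [ba aU aT] := ea; have fYT := fin_meas_probability nu measurableT.
have [c ac] : exists c, {ae M, forall w, \int[nu]_y a (w, y) = c}.
  apply: iconst; first exact: bmf_int2.
    by apply: aeW => w; apply: eq_Rintegral => y _; rewrite aU.
  move=> b; apply: aeW => w.
  have := Rint_preimage (mSg b) (nuS b) fYT (bmf_section1 w ba); rewrite preimage_setT => <-.
  by apply: eq_Rintegral => y _; rewrite -aT.
exists c; apply: ae_cst_of_rectangles => // A D fA mD.
have [cA tA] := action_ae_const lam_haar mS S_add S_ergodic (bmf_t fA)
  (fun g => equivariant_marginal_invariant g fA).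
have cAE : cA = c * fine (M A).
  rewrite -(Rint_probability_cst nu cA) -(@Rint_ae _ _ _ nu setT _ _ measurableT (bmf_t fA).1 _ tA)//.
  rewrite /t -(Rint_fubini nu fA ba) (@Rint_ae _ _ _ M A _ (cst c))//.
  - by rewrite Rintegral_cst//; exact: fA.1.
  - exact: fA.1.
  - exact: (bmf_int2 nu ba).1.
rewrite Rint_rectangle// (@Rint_ae _ _ _ nu D _ (cst cA))//; last exact: (bmf_t fA).1.
by rewrite Rintegral_cst// cAE mulrA.
Qed.

End equivariant_function.

Lemma skew_rokhlin_ergodic : ergodic ((m \x nu) \x lam)%E skew_rokhlin.
Proof.
move=> B mB QB; pose a (p : W * Y) : R := \1_B ((p.1.1, S p.1.2.2 p.2), p.1.2.1).
have ma : measurable_fun setT (fun p : W * Y => ((p.1.1, S p.1.2.2 p.2), p.1.2.1)).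
  have m2 : measurable_fun setT (fun p : W * Y => p.1.2) by exact: measurableT_comp.
  apply: measurable_fun_pair; last exact: (measurableT_comp measurable_fst m2).
  apply: measurable_fun_pair; first exact: measurableT_comp.
  have m3 : measurable_fun setT (fun p : W * Y => (p.1.2.2, p.2)).
    by apply: measurable_fun_pair => //; exact: (measurableT_comp measurable_snd m2).
  exact: (measurableT_comp mS m3).
have ea : equivariant (skew2 U psi1 psi2) tau S a.
  split.
  - exact: (bmf_comp (bmf_indic mB) ma).
  - move=> [z [g1 g2]] y; rewrite /a /skew2/= S_add -[in RHS]QB.
    by rewrite !indicE; congr (_ _ _).
  - by move=> b [z [g1 g2]] y; rewrite /a /tau /translation/= add0r (addrC b) S_add.
have [c ac] := equivariant_ae_const ea; apply: (@zero_one_of_indic _ _ _ _ _ c mB).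
have iB := (bmf_indic (R := R) mB).1.
pose P q := \1_B q = c; have mP : measurable [set q | P q] by apply: measurable_eq_set.
apply: (@ae_prod1 _ _ _ _ _ (sigma_finite_product m nu) lam P mP).
have mS1 (z : Z) : measurable_fun setT (fun q : Borel G * Y => ((z, q.2), q.1)).
  by apply: measurable_fun_pair => //; exact: measurable_fun_pair.
(* For fixed [g2] the map [S (- g2)] preserves [nu] and undoes the twist in [a]; the coordinate [g2]
   then disappears from the statement. *)
have B1 : {ae m, forall z, {ae nu, forall y, {ae lam, forall g, \1_B ((z, y), g) = c}}}.
  move/ae_fubini1 : ac; move/ae_fubini1; apply: filterS => z /ae_fubini1 h.
  apply: (ae_fubini2 (m1 := lam) (m2 := nu) (P := fun q => \1_B ((z, q.2), q.1) = c)).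
  apply: ae_prod1.
    by apply: measurable_eq_set => //; exact: (measurableT_comp iB (mS1 z)).
  apply: filterS h => g1 h; apply: (ae_cst (haar_setT_neq0 lam_haar)).
  apply: filterS h => g2 h.
  have := ae_comp (M := nu) (M' := nu) (mSg (- g2)) (fun A mA => eq_trans (nuS _ mA)) h.
  by apply: filterS => y; rewrite /a/= -S_add subrr S0.
exact: (@ae_prod1 _ _ _ _ _ m nu _ (measurable_ae_section lam mP) B1).
Qed.

End SkewRokhlin.

(** * Relative disjointness *)

Definition image_probability {R : realType} {d1 d2} {T1 : measurableType d1}
    {T2 : measurableType d2} (P : probability T1 R) (f : T1 -> T2)
    (mf : measurable_fun setT f) : probability T2 R :=
  distribution P (mfun_Sub (mem_set mf)).

Lemma image_probabilityE {R : realType} {d1 d2} {T1 : measurableType d1}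
    {T2 : measurableType d2} (P : probability T1 R) (f : T1 -> T2)
    (mf : measurable_fun setT f) A : image_probability P mf A = P (f @^-1` A).
Proof. by []. Qed.

Definition image_measure {R : realType} {d1 d2} {T1 : measurableType d1}
    {T2 : measurableType d2} (m : {measure set T1 -> \bar R}) (f : T1 -> T2)
    (mf : measurable_fun setT f) : {measure set T2 -> \bar R} :=
  @measure_function_pushforward__canonical__measure_function_Measure _ _ _ _ _ m f mf.

Lemma image_measureE {R : realType} {d1 d2} {T1 : measurableType d1}
    {T2 : measurableType d2} (m : {measure set T1 -> \bar R}) (f : T1 -> T2)
    (mf : measurable_fun setT f) A : image_measure m mf A = m (f @^-1` A).
Proof. by []. Qed.

Section RelativeDisjointness.
Context {R : realType} {G : topologicalZmodType} {d dY} {V : measurableType d}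
  {Y : measurableType dY}.
Variable lam : {sigma_finite_measure set (Borel G) -> \bar R}.
Variables (m : probability V R) (nu : probability Y R).
Hypotheses (Gsc : @second_countable G) (lam_haar : haar lam).
Variables (U Ui : V -> V) (psi : V -> Borel G).
Hypotheses (mU : measurable_fun setT U) (mUi : measurable_fun setT Ui)
  (UK : cancel U Ui) (mpU : forall A, measurable A -> m (U @^-1` A) = m A)
  (mpsi : measurable_fun setT psi).
Hypothesis erg : ergodic (m \x lam)%E (skew1 U psi).
Variable S : Borel G -> Y -> Y.
Hypotheses (mS : measurable_fun setT (fun p : Borel G * Y => S p.1 p.2))
  (S0 : forall y, S 0 y = y) (S_add : forall g h y, S (g + h) y = S g (S h y))
  (nuS : forall g A, measurable A -> nu (S g @^-1` A) = nu A).
Variable k : probability (V * Y)%type R.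
Hypotheses
  (k_inv : forall A, measurable A ->
     k ((fun q : V * Y => (U q.1, S (psi q.1) q.2)) @^-1` A) = k A)
  (k1 : forall A, measurable A -> k (A `*` setT) = m A)
  (k2 : forall D, measurable D -> k (setT `*` D) = nu D).

Let mSg g : measurable_fun setT (S g).
Proof. exact: (measurableT_comp mS (pair1_measurable g)). Qed.

Let KL := sigma_finite_product k lam.
Let pr (q : (V * Y) * Borel G) : V * Borel G := (q.1.1, q.2).
Let untwist (q : (V * Y) * Borel G) : Y := S (- q.2) q.1.2.

Let mpr : measurable_fun setT pr.
Proof. by apply: measurable_fun_pair => //; exact: measurableT_comp. Qed.

Let muntwist : measurable_fun setT untwist.
Proof.
have h : measurable_fun setT (fun q : (V * Y) * Borel G => (- q.2 : Borel G, q.1.2)).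
  apply: measurable_fun_pair; first exact: measurable_Borel_opp.
  exact: measurableT_comp.
exact: (measurableT_comp mS h).
Qed.

Let F (D : set Y) (C : set (V * Borel G)) := pr @^-1` C `&` untwist @^-1` D.

Let mF D C : measurable D -> measurable C -> measurable (F D C).
Proof.
move=> mD mC; apply: measurableI; rewrite -[X in measurable X]setTI.
  exact: mpr.
exact: muntwist.
Qed.

Let KL_pr C : measurable C -> KL (pr @^-1` C) = (m \x lam)%E C.
Proof.
move=> mC; rewrite (@product_measure_unique _ _ _ _ _ m lam (image_measure KL mpr))//.
move=> A B mA mB; rewrite image_measureE.
have -> : pr @^-1` (A `*` B) = (A `*` setT) `*` B.
  by apply/seteqP; split => -[[v y] g] //= [] // [].
have mAT : measurable (A `*` [set: Y]) by exact: measurableX.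
by rewrite [LHS]product_measure1E//= k1.
Qed.

Let twisted (q : (V * Y) * Borel G) : (V * Y) * Borel G :=
  ((U q.1.1, S (psi q.1.1) q.1.2), psi q.1.1 + q.2).

Let KL_twisted E : measurable E -> KL (twisted @^-1` E) = KL E.
Proof.
apply: (@skew_product_preserves _ _ _ _ _ k lam
  (fun q => (U q.1, S (psi q.1) q.2)) (fun q g => psi q.1 + g)) => //.
- apply: measurable_fun_pair; first exact: measurableT_comp.
  have h : measurable_fun setT (fun q : V * Y => (psi q.1, q.2)).
    by apply: measurable_fun_pair => //; exact: measurableT_comp.
  exact: (measurableT_comp mS h).
- apply: (measurable_Borel_add Gsc) => //; apply: measurableT_comp => //.
  exact: measurableT_comp.
- by move=> q A mA; exact: lam_haar.1.
Qed.

(** The untwisted point does not move: [S (- (psi v + g)) (S (psi v) y) = S (- g) y]. *)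
Let F_twisted D C : twisted @^-1` F D C = F D (skew1 U psi @^-1` C).
Proof.
apply/seteqP; split => -[[v y] g]; rewrite /F /untwist /twisted /pr /skew1/=;
by rewrite -S_add opprD addrAC addNr add0r.
Qed.

Let F_fin D C : measurable D -> fin_meas (m \x lam)%E C -> fin_meas KL (F D C).
Proof.
move=> mD [mC fC]; split; first exact: mF.
have mprC : measurable (pr @^-1` C) by rewrite -[X in measurable X]setTI; exact: mpr.
apply: le_lt_trans fC; rewrite -(KL_pr mC).
by apply: le_measure; rewrite ?inE//; [exact: mF|exact: subIsetl].
Qed.

Let F_le D C : measurable D -> fin_meas (m \x lam)%E C ->
  fine (KL (F D C)) <= fine ((m \x lam)%E C).
Proof.
move=> mD fC; rewrite -lee_fin (fin_meas_fineK (F_fin mD fC)).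
have -> : (fine ((m \x lam)%E C))%:E = KL (pr @^-1` C).
  rewrite (KL_pr fC.1); exact: (fin_meas_fineK (M := (m \x lam)%E) fC).
have mprC : measurable (pr @^-1` C).
  by rewrite -[X in measurable X]setTI; apply: mpr => //; exact: fC.1.
by apply: le_measure; rewrite ?inE//; [apply: mF => //; exact: fC.1|exact: subIsetl].
Qed.

Let F_const D : measurable D -> exists c, forall C, fin_meas (m \x lam)%E C ->
  fine (KL (F D C)) = c * fine ((m \x lam)%E C).
Proof.
move=> mD; pose M := sigma_finite_product m lam.
have add : fin_additive M (fun C => fine (KL (F D C))).
  move=> A B fA fB AB; have fFA := F_fin mD fA; have fFB := F_fin mD fB.
  rewrite -fineD; [|by rewrite ge0_fin_numE// fFA.2|by rewrite ge0_fin_numE// fFB.2].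
  congr fine; rewrite -measureU//.
  - by congr (KL _); rewrite /F preimage_setU setIUl.
  - exact: fFA.1.
  - exact: fFB.1.
  - by rewrite /F setIACA setIid -preimage_setI AB preimage_set0 set0I.
have bound : bounded_by_measure M (fun C => fine (KL (F D C))) 1.
  by move=> C fC; rewrite mul1r ger0_norm ?fine_ge0//; exact: F_le.
have [e [me eC eE]] := density_of_bounded ler01 add bound.
have be : bmf e by split => //; exists 1.
have mT := measurable_skew1 Gsc mU mpsi.
have mTi : measurable_fun setT (fun p : V * Borel G => (Ui p.1, - psi (Ui p.1) + p.2)).
  apply: measurable_fun_pair; first exact: measurableT_comp.
  apply: (measurable_Borel_add Gsc) => //; apply: measurable_Borel_opp.
  by apply: measurableT_comp => //; exact: measurableT_comp.
have TK : cancel (skew1 U psi) (fun p : V * Borel G => (Ui p.1, - psi (Ui p.1) + p.2)).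
  by case=> v g; rewrite /skew1/= UK addKr.
have pT := skew1_preserves Gsc lam_haar mU mpU mpsi.
have fT C : fin_meas M C -> fin_meas M (skew1 U psi @^-1` C).
  move=> fC; split; first by rewrite -[X in measurable X]setTI; apply: mT => //; exact: fC.1.
  by rewrite [X in (X < _)%E](pT C fC.1); exact: fC.2.
have einv : {ae M, forall p, e (skew1 U psi p) = e p}.
  apply: (ae_eq_of_preimages mT mTi TK _ be be) => // C fC.
  rewrite -(eE _ fC) -(eE _ (fT C fC)) -F_twisted KL_twisted//.
  by apply: mF => //; exact: fC.1.
have [c ec] := ergodic_ae_const (M := M) mT pT erg be einv.
exists c => C fC; rewrite (eE C fC) (@Rint_ae _ _ _ M C _ (cst c))//; last exact: fC.1.
by rewrite Rintegral_cst//; exact: fC.1.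
Qed.

(** This determines the constant of [F_const]: over [setT * K] only the second marginal of [k] and
    the invariance of [nu] enter. *)
Let F_strip D K : measurable D -> fin_meas lam K ->
  KL (F D (setT `*` K)) = (nu D * lam K)%E.
Proof.
move=> mD fK; have mTK : measurable ([set: V] `*` K) by apply: measurableX => //; exact: fK.1.
rewrite [LHS](@product_measure_unique _ _ _ _ _ k lam (k \x^ lam)%E); last exact: mF.
  rewrite -[RHS](integral_cst lam fK.1) integral_mkcond; apply: eq_integral => g _ /=.
  rewrite patchE; case: ifPn => [/set_mem Kg|/negP nKg].
    rewrite -(nuS (- g) mD) -k2; last by rewrite -[X in measurable X]setTI; exact: mSg.
    congr (k _); apply/seteqP; split => -[v y]; rewrite /ysection/= inE.
      by move=> [].
    by move=> [_ Dy].
  rewrite -[RHS](measure0 k); congr (k _); apply/seteqP; split => // -[v y].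
  by rewrite /ysection/= inE => -[[_ /mem_set]].
by move=> A B mA mB; exact: product_measure2E.
Qed.

Let lamK := fin_meas_neq0 (haar_setT_neq0 lam_haar).

Let KL_F D C : measurable D -> fin_meas (m \x lam)%E C ->
  KL (F D C) = (nu D * (m \x lam) C)%E.
Proof.
move=> mD fC; have [c cE] := F_const mD; have [K fK K0] := lamK.
have mK := fK.1; have TKE : (m \x lam)%E ([set: V] `*` K) = lam K.
  by rewrite product_measure1E//= -[m setT]/(m setT) (probability_setT m) mul1e.
have fTK : fin_meas (m \x lam)%E ([set: V] `*` K).
  by split; [exact: measurableX|rewrite TKE; exact: fK.2].
have K0' : fine (lam K) != 0 by apply: contra K0 => /eqP h; rewrite -(fin_meas_fineK fK) h.
have nuDK := fin_meas_fineK (fin_meas_probability nu mD).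
have cD : c = fine (nu D).
  have := cE _ fTK; rewrite TKE F_strip// -{1}nuDK -{1}(fin_meas_fineK fK) -EFinM/=.
  by move/(mulIf K0').
rewrite -[LHS](fin_meas_fineK (F_fin mD fC)) [X in X%:E](cE _ fC) cD EFinM nuDK.
by congr *%E; exact: (fin_meas_fineK (M := (m \x lam)%E) fC).
Qed.

(** Restricted to [v] in [E], the pair [(g, S (- g) y)] has law [m E] times [lam * nu]. The map
    [(g, y) |-> (g, S g y)] preserves [lam * nu] and gives back [y]; restricting [g] to a set [K] of
    finite nonzero measure then allows division by [lam K]. *)
Lemma invariant_rectangle E D : measurable E -> measurable D -> k (E `*` D) = (m E * nu D)%E.
Proof.
move=> mE mD; have [K fK K0] := lamK.
have mES : measurable ((E `*` [set: Y]) `*` [set: Borel G]).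
  by apply: measurableX => //; exact: measurableX.
pose th (q : (V * Y) * Borel G) := (q.2, untwist q).
have mth : measurable_fun setT th by exact: measurable_fun_pair.
have fE := fin_meas_probability m mE.
have r0 : 0 <= fine (m E) by exact: fine_ge0.
have kE C : measurable C -> image_measure (mrestr KL mES) mth C = (m E * (lam \x nu) C)%E.
  move=> mC; rewrite -(fin_meas_fineK fE).
  apply: (product_measure_unique_scaled (r := NngNum r0)) => // A B fA mB /=.
  have mEA : (m \x lam)%E (E `*` A) = (m E * lam A)%E.
    by rewrite product_measure1E//; exact: fA.1.
  have fEA : fin_meas (m \x lam)%E (E `*` A).
    split; first by apply: measurableX => //; exact: fA.1.
    by rewrite mEA -(fin_meas_fineK fE) -(fin_meas_fineK fA) -EFinM ltry.
  rewrite (fin_meas_fineK fE) muleA -mEA muleC -KL_F//.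
  transitivity (KL (th @^-1` (A `*` B) `&` ((E `*` setT) `*` setT))); first by [].
  by congr (KL _); apply/seteqP; split => -[[v y] g]; rewrite /F /th /pr/=; tauto.
have mtw : measurable_fun setT (fun p : Borel G * Y => (p.1, S p.1 p.2)).
  exact: measurable_fun_pair.
have mKD : measurable (K `*` D) by apply: measurableX => //; exact: fK.1.
have mtwKD : measurable ((fun p : Borel G * Y => (p.1, S p.1 p.2)) @^-1` (K `*` D)).
  by rewrite -[X in measurable X]setTI; exact: mtw.
have := kE _ mtwKD.
rewrite (@skew_product_preserves _ _ _ _ _ lam nu id S)//.
rewrite product_measure1E//; last exact: fK.1.
have -> : image_measure (mrestr KL mES) mth
    ((fun p : Borel G * Y => (p.1, S p.1 p.2)) @^-1` (K `*` D)) = KL ((E `*` D) `*` K).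
  transitivity (KL (th @^-1` ((fun p : Borel G * Y => (p.1, S p.1 p.2)) @^-1` (K `*` D))
    `&` ((E `*` setT) `*` setT))); [by []|congr (KL _)].
  apply/seteqP; split => -[[v y] g]; rewrite /th /untwist/= -S_add subrr S0; tauto.
have mED := measurableX mE mD.
rewrite [X in X = _ -> _]product_measure1E//; last exact: fK.1.
have kf := fin_meas_fineK (fin_meas_probability k mED).
have nf := fin_meas_fineK (fin_meas_probability nu mD).
have K0' : fine (lam K) != 0 by apply: contra K0 => /eqP h; rewrite -(fin_meas_fineK fK) h.
move=> h; have [h'] : (fine (k (E `*` D)) * fine (lam K))%:E =
    (fine (m E) * (fine (lam K) * fine (nu D)))%:E.
  by rewrite !EFinM kf nf (fin_meas_fineK fK) (fin_meas_fineK fE).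
rewrite -kf -nf -(fin_meas_fineK fE) -EFinM; congr EFin; apply: (mulIf K0').
by rewrite h'; ring.
Qed.

Lemma relatively_disjoint A : measurable A -> k A = (m \x nu)%E A.
Proof.
by move=> mA; rewrite (@product_measure_unique _ _ _ _ _ m nu k)//; exact: invariant_rectangle.
Qed.

End RelativeDisjointness.

(** * Ergodicity of the Rokhlin extension *)

Section RokhlinErgodic.
Context {R : realType} {G : topologicalZmodType} {d dY} {X : measurableType d}
  {Y : measurableType dY}.
Variable lam : {sigma_finite_measure set (Borel G) -> \bar R}.
Variables (mu : probability X R) (nu : probability Y R).
Hypotheses (Gsc : @second_countable G) (lam_haar : haar lam).
Variables (T : X -> X) (phi : X -> Borel G).
Hypotheses (mT : measurable_fun setT T)
  (muT : forall A, measurable A -> mu (T @^-1` A) = mu A)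
  (mphi : measurable_fun setT phi).
Hypothesis erg : ergodic (mu \x lam)%E (skew1 T phi).
Variable S : Borel G -> Y -> Y.
Hypotheses (mS : measurable_fun setT (fun p : Borel G * Y => S p.1 p.2))
  (S0 : forall y, S 0 y = y) (S_add : forall g h y, S (g + h) y = S g (S h y))
  (nuS : forall g A, measurable A -> nu (S g @^-1` A) = nu A)
  (S_ergodic : forall A, measurable A -> (forall g, S g @^-1` A = A) ->
     nu A = 0%E \/ nu (~` A) = 0%E).

Let mSg g : measurable_fun setT (S g).
Proof. exact: (measurableT_comp mS (pair1_measurable g)). Qed.

(** For each [y] the function [a] is invariant under the skew product, hence equal to a constant
    [c y]. Translating the group coordinate by [h] shows that [c] is invariant under [S], hence
    constant. *)
Lemma rokhlin_ergodic : ergodic (mu \x nu)%E (rokhlin T phi S).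
Proof.
move=> B mB TB; pose M := sigma_finite_product mu lam.
pose a (p : (X * Borel G) * Y) : R := \1_B (p.1.1, S p.1.2 p.2).
have ba : bmf a.
  apply: (bmf_comp (bmf_indic mB)); apply: measurable_fun_pair.
    exact: measurableT_comp.
  have h : measurable_fun setT (fun p : (X * Borel G) * Y => (p.1.2, p.2)).
    by apply: measurable_fun_pair => //; exact: measurableT_comp.
  exact: (measurableT_comp mS h).
have M0 : M setT != 0%E.
  have mu0 : mu setT != 0%E by rewrite probability_setT.
  apply/eqP => /(ae_measure0 M measurableT)/ae_fubini1/(ae_ex mu0)[x].
  by move=> /(ae_ex (haar_setT_neq0 lam_haar))[g]; apply.
have [A fA A0] := fin_meas_neq0 M0.
have /choice[c cE] : forall y, exists c, {ae M, forall w, a (w, y) = c}.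
  move=> y; apply: (ergodic_ae_const (M := M) (measurable_skew1 Gsc mT mphi)
    (skew1_preserves Gsc lam_haar mT muT mphi) erg (bmf_section2 y ba)).
  apply: aeW => -[x g]; rewrite /a /skew1/= S_add -[in RHS]TB.
  by rewrite !indicE; congr (_ _ _).
have cS h y : c (S h y) = c y.
  pose shift (w : X * Borel G) := (w.1, w.2 + h).
  have mshift2 : measurable_fun setT (fun w : X * Borel G => w.2 + h : Borel G).
    by apply: (measurable_Borel_add Gsc).
  have mshift : measurable_fun setT shift by exact: measurable_fun_pair.
  have Mshift C : measurable C -> M (shift @^-1` C) = M C.
    apply: (@skew_product_preserves _ _ _ _ _ mu lam id (fun _ g => g + h)) => //.
    by move=> _ D mD; exact: haar_translate.
  apply: (ae_cst M0); have := ae_comp (M := M) (M' := M) mshift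
    (fun C mC => eq_trans (Mshift C mC)) (cE y).
  apply: filterS2 (cE (S h y)) => -[x g] <- <-.
  by rewrite /a/= S_add.
(* The function [c] comes from a choice and carries no measurability; [t] is measurable and equals
   [c] up to the factor [fine (M A)]. *)
pose t y := \int[M]_(w in A) a (w, y).
have bt : bmf t by exact: (bmf_int1 fA ba).
have tE y : t y = c y * fine (M A).
  rewrite /t (@Rint_ae _ _ _ M A _ (cst (c y)) fA.1 (bmf_section2 y ba).1)//.
  by rewrite Rintegral_cst//; exact: fA.1.
have [kap tkap] : exists kap, {ae nu, forall y, t y = kap}.
  apply: (action_ae_const lam_haar mS S_add S_ergodic bt) => g.
  by apply: aeW => y; rewrite !tE cS.
have A0' : fine (M A) != 0 by apply: contra A0 => /eqP h; rewrite -(fin_meas_fineK fA) h.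
pose r := kap / fine (M A).
have ar : {ae (M \x nu)%E, forall p, a p = r}.
  apply: ae_prod2; first by apply: measurable_eq_set => //; exact: ba.1.
  apply: filterS tkap => y ty; apply: filterS (cE y) => w ->.
  by rewrite /r -ty tE mulfK.
have iB := (bmf_indic (R := R) mB).1.
have mr : measurable [set q : X * Y | \1_B q = r] by exact: measurable_eq_set.
apply: (@zero_one_of_indic _ _ _ _ _ r mB).
apply: (@ae_prod1 _ _ _ _ _ mu nu (fun q => \1_B q = r) mr).
move/ae_fubini1 : ar => /ae_fubini1; apply: filterS => x h.
apply: (ae_cst (haar_setT_neq0 lam_haar)); apply: filterS h => g h.
have := ae_comp (M := nu) (M' := nu) (mSg (- g)) (fun A mA => eq_trans (nuS _ mA)) h.
by apply: filterS => y; rewrite /a/= -S_add subrr S0.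
Qed.

End RokhlinErgodic.

(** * Square integrable functions and fibre averages *)

Section SquareIntegrable.
Context {R : realType} {d} {W : measurableType d}.

Definition square_integrable (m : set W -> \bar R) (f : W -> R) :=
  measurable_fun setT f /\ m.-integrable setT (fun w => (f w ^+ 2)%:E).

Lemma square_integrableM (m : {measure set W -> \bar R}) (f g : W -> R) :
  square_integrable m f -> square_integrable m g ->
  m.-integrable setT (fun w => (f w * g w)%:E).
Proof.
move=> [mf sf] [mg sg]; apply: (le_integrable measurableT _ _ (integrableD measurableT sf sg)).
  by apply/measurable_EFinP; exact: measurable_funM.
move=> w _ /=; rewrite lee_fin [leRHS]ger0_norm ?addr_ge0 ?sqr_ge0//.
rewrite normrM -(real_normK (num_real (f w))) -(real_normK (num_real (g w))) -subr_ge0.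
set a := `|f w|; set b := `|g w|.
have -> : a ^+ 2 + b ^+ 2 - a * b = (3 * (a - b) ^+ 2 + (a + b) ^+ 2) / 4 by field.
by apply: divr_ge0 => //; apply: addr_ge0; [apply: mulr_ge0 => //; exact: sqr_ge0|exact: sqr_ge0].
Qed.

Lemma square_integrable_cst (P : probability W R) (c : R) : square_integrable P (cst c).
Proof. by split => //; exact: (finite_measure_integrable_cst P (c ^+ 2)). Qed.

Lemma square_integrable_integrable (P : probability W R) (f : W -> R) :
  square_integrable P f -> P.-integrable setT (EFin \o f).
Proof.
move=> sf; have := square_integrableM sf (square_integrable_cst P 1).
by apply: eq_integrable => // w _ /=; rewrite mulr1.
Qed.

(** The variance is non-negative. *)
Lemma Rintegral_sqr_le (P : probability W R) (f : W -> R) : square_integrable P f ->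
  (((\int[P]_w f w)%R ^+ 2)%:E <= \int[P]_w (f w ^+ 2)%:E)%E.
Proof.
move=> sf; have fi := square_integrable_integrable sf; set c := \int[P]_w f w.
have cE : (\int[P]_w (f w)%:E = c%:E)%E by rewrite fineK//; exact: integrable_fin_num.
have i2 := sf.2.
have ci : P.-integrable setT (fun w => ((2 * c)%:E * (f w)%:E)%E) by exact: integrableZl.
have c2i : P.-integrable setT (EFin \o cst (c ^+ 2)) by exact: finite_measure_integrable_cst.
have : (0 <= \int[P]_w ((f w - c) ^+ 2)%:E)%E.
  by apply: integral_ge0 => w _; rewrite lee_fin sqr_ge0.
have -> : (\int[P]_w ((f w - c) ^+ 2)%:E = \int[P]_w (f w ^+ 2)%:E - (c ^+ 2)%:E)%E.
  under eq_integral => w _.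
    rewrite (_ : ((f w - c) ^+ 2)%:E =
      ((f w ^+ 2)%:E + ((- (2 * c))%:E * (f w)%:E + (c ^+ 2)%:E))%E); last first.
      by rewrite -EFinM -!EFinD; congr EFin; ring.
    over.
  have ci' : P.-integrable setT (fun w => ((- (2 * c))%:E * (f w)%:E)%E) by exact: integrableZl.
  have e1 : (\int[P]_w ((- (2 * c))%:E * (f w)%:E + (c ^+ 2)%:E) = - (c ^+ 2)%:E)%E.
    rewrite (integralD measurableT ci' c2i) (integralZl measurableT fi) cE.
    have -> : (\int[P]_w (EFin \o cst (c ^+ 2)%R) w = (c ^+ 2)%:E)%E.
      transitivity ((c ^+ 2)%:E * P setT)%E; first exact: (integral_cst P measurableT (c ^+ 2)%:E).
      by rewrite probability_setT mule1.
    by rewrite -EFinM -EFinD -EFinN; congr EFin; ring.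
  by rewrite (integralD measurableT i2 (integrableD measurableT ci' c2i)) e1.
have fin := integrable_fin_num measurableT i2.
by rewrite -(fineK fin) -EFinB !lee_fin subr_ge0.
Qed.

End SquareIntegrable.

Section ImageIntegrals.
Context {R : realType} {d1 d2} {T1 : measurableType d1} {T2 : measurableType d2}.
Variables (P : {measure set T1 -> \bar R}) (Q : {measure set T2 -> \bar R}) (p : T1 -> T2).
Hypotheses (mp : measurable_fun setT p) (PQ : forall A, measurable A -> P (p @^-1` A) = Q A).

Lemma integrable_image (h : T2 -> \bar R) : Q.-integrable setT h ->
  P.-integrable setT (h \o p).
Proof.
move/integrableP => [mh hoo]; apply/integrableP; split; first exact: measurableT_comp.
have mah : measurable_fun setT (fun y => `|h y|%E) by exact: measurableT_comp.
have := @ge0_integral_pushforward _ _ _ _ _ _ mp P setT (fun y => `|h y|%E) measurableT mah _.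
rewrite preimage_setT => /(_ _) /= <- //.
by rewrite (eq_measure_integral Q)// => A mA _; exact: PQ.
Qed.

Lemma integral_image (h : T2 -> \bar R) : Q.-integrable setT h ->
  (\int[P]_x h (p x) = \int[Q]_y h y)%E.
Proof.
move=> ih; have hi := integrable_image ih.
have mh : measurable_fun setT h by case/integrableP : ih.
have := @integral_pushforward _ _ _ _ _ _ mp P setT h mh _ measurableT.
rewrite preimage_setT => /(_ hi) /= <-.
by apply: eq_measure_integral => A mA _; exact: PQ.
Qed.

Lemma square_integrable_image (h : T2 -> R) : square_integrable Q h ->
  square_integrable P (fun x => h (p x)).
Proof. by move=> [mh ih]; split; [exact: measurableT_comp|exact: (integrable_image ih)]. Qed.

End ImageIntegrals.

Lemma product_image {R : realType} {d d1 d2} {W : measurableType d} {X : measurableType d1}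
    {Y : measurableType d2} (E : {sigma_finite_measure set W -> \bar R})
    (mu : {sigma_finite_measure set X -> \bar R})
    (nu : {sigma_finite_measure set Y -> \bar R}) (q : W -> X) : measurable_fun setT q ->
  (forall A, measurable A -> E (q @^-1` A) = mu A) ->
  forall A, measurable A ->
    (E \x nu)%E ((fun p : W * Y => (q p.1, p.2)) @^-1` A) = (mu \x nu)%E A.
Proof.
move=> mq Eq A mA.
have mp : measurable_fun setT (fun p : W * Y => (q p.1, p.2)).
  by apply: measurable_fun_pair => //; exact: measurableT_comp.
rewrite (@product_measure_unique _ _ _ _ _ mu nu (image_measure (sigma_finite_product E nu) mp))//.
move=> B C mB mC.
have mqB : measurable (q @^-1` B) by rewrite -[X in measurable X]setTI; exact: mq.
transitivity (sigma_finite_product E nu ((q @^-1` B) `*` C)); first by [].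
by rewrite [LHS]product_measure1E//; congr *%E; exact: Eq.
Qed.

Section FiberAverages.
Context {R : realType} {d1 d2} {X : measurableType d1} {Y : measurableType d2}.
Variables (mu : probability X R) (nu : probability Y R).

(** The conditional expectation on the base. For square integrable [f], the fibres on which the
    integral is only a default value form a null set. *)
Definition fiber_average (f : X * Y -> R) (x : X) : R := \int[nu]_y f (x, y).

Let sq_integrable (f : X * Y -> R) : square_integrable (mu \x nu)%E f ->
  (mu \x nu)%E.-integrable setT (EFin \o f).
Proof. exact: (@square_integrable_integrable _ _ _ (mu \x nu)%E). Qed.

Lemma measurable_fiber_average f : square_integrable (mu \x nu)%E f ->
  measurable_fun setT (fiber_average f).
Proof.
move=> /sq_integrable fi.
exact: (measurableT_comp (fine_measurable measurableT) (measurable_fubini_F fi)).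
Qed.

Lemma square_integrable_fiber_average f : square_integrable (mu \x nu)%E f ->
  square_integrable mu (fiber_average f).
Proof.
move=> sf; have mf := measurable_fiber_average sf; split => //.
apply: (le_integrable measurableT _ _ (integrable_fubini_F sf.2)).
  by apply/measurable_EFinP; exact: measurable_funX.
move=> x _; rewrite [leLHS]gee0_abs ?lee_fin ?sqr_ge0//.
rewrite [leRHS]gee0_abs; last by apply: integral_ge0 => y _; rewrite lee_fin sqr_ge0.
have mfx : measurable_fun setT (fun y => f (x, y)).
  exact: (measurableT_comp sf.1 (pair1_measurable x)).
(* On a fibre where the square is not integrable the bound is infinite; elsewhere it is the variance
   inequality on the fibre. *)
have [oo|oo] := ltP (fubini_F nu (fun z => (f z ^+ 2)%:E) x) +oo%E; last first.
  by move: oo; rewrite leye_eq => /eqP ->; rewrite leey.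
apply: Rintegral_sqr_le; split => //; apply/integrableP; split.
  by apply/measurable_EFinP; exact: measurable_funX.
by under eq_integral do rewrite gee0_abs ?lee_fin ?sqr_ge0//.
Qed.

Lemma ae_fiber_average f : square_integrable (mu \x nu)%E f ->
  {ae mu, forall x, nu.-integrable setT (fun y => (f (x, y))%:E)}.
Proof. by move=> /sq_integrable; exact: ae_integrable1. Qed.

Lemma fiber_averageE f x : nu.-integrable setT (fun y => (f (x, y))%:E) ->
  (\int[nu]_y (f (x, y))%:E = (fiber_average f x)%:E)%E.
Proof. by move=> fi; rewrite fineK//; exact: integrable_fin_num. Qed.

Lemma square_integrable_pullback {d} {W : measurableType d} (E : probability W R)
    (q : W -> X) (h : X * Y -> R) : measurable_fun setT q ->
  (forall A, measurable A -> E (q @^-1` A) = mu A) ->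
  square_integrable (mu \x nu)%E h ->
  square_integrable (E \x nu)%E (fun p => h (q p.1, p.2)).
Proof.
move=> mq Eq sh.
apply: (@square_integrable_image _ _ _ _ _ (E \x nu)%E (mu \x nu)%E
  (fun p : W * Y => (q p.1, p.2)) _ _ h sh).
  by apply: measurable_fun_pair => //; exact: measurableT_comp.
exact: product_image.
Qed.

Lemma square_integrable_fst {d} {W : measurableType d} (E : probability W R) (c : W -> R) :
  square_integrable E c -> square_integrable (E \x nu)%E (fun p => c p.1).
Proof.
move=> sc; apply: (@square_integrable_image _ _ _ _ _ (E \x nu)%E E fst _ _ c sc) => //.
move=> A mA; have -> : fst @^-1` A = A `*` [set: Y].
  by apply/seteqP; split => -[w y] //= [].
rewrite [LHS]product_measure1E//; transitivity (E A * 1)%E; last by rewrite mule1.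
by congr *%E; exact: probability_setT.
Qed.

(** The base [W] is an arbitrary extension [q] of [X], so that the fibre coordinates of a joining
    can be integrated out one at a time. *)
Lemma integral_fiber_average {d} {W : measurableType d} (E : probability W R)
    (q : W -> X) (c : W -> R) (h : X * Y -> R) : measurable_fun setT q ->
  (forall A, measurable A -> E (q @^-1` A) = mu A) ->
  square_integrable E c -> square_integrable (mu \x nu)%E h ->
  (\int[(E \x nu)]_p (c p.1 * h (q p.1, p.2))%:E =
   \int[E]_w (c w * fiber_average h (q w))%:E)%E.
Proof.
move=> mq Eq sc sh; have sc' := square_integrable_fst sc.
have sh' := square_integrable_pullback mq Eq sh.
rewrite -(integral12_prod_meas1 (square_integrableM sc' sh')).
have mav := measurable_fiber_average sh.
apply: ae_eq_integral => //.
- exact: measurable_fubini_F (square_integrableM sc' sh').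
- apply/measurable_EFinP; apply: measurable_funM; first exact: sc.1.
  exact: (measurableT_comp mav mq).
have := ae_comp (M := E) (M' := mu) mq (fun A mA => eq_trans (Eq A mA)) (ae_fiber_average sh).
apply: filterS => w hi _; rewrite /fubini_F /=.
rewrite EFinM -(fiber_averageE hi) -(integralZl measurableT hi).
by apply: eq_integral => y _; rewrite EFinM.
Qed.

Lemma L2_0_fiber_average f : L2_0 (mu \x nu)%E f -> L2_0 mu (fiber_average f).
Proof.
move=> [mf [i2 f0]]; have sf : square_integrable (mu \x nu)%E f by [].
have [m2 av2] := square_integrable_fiber_average sf; split => //; split => //.
rewrite -[RHS]f0.
have := integral_fiber_average (E := mu) (q := id) (c := cst 1) (@measurable_id _ _ setT) _
  (square_integrable_cst mu 1) sf.
move=> /(_ _) e; have {}e := e (fun A mA => erefl).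
under eq_integral => x _ do rewrite -[fiber_average f x]mul1r.
rewrite -e; apply: eq_integral => -[x y] _ /=; by rewrite mul1r.
Qed.

End FiberAverages.

Lemma measurable_iter {d} {X : measurableType d} (T : X -> X) n :
  measurable_fun setT T -> measurable_fun setT (iter n T).
Proof.
move=> mT; elim: n => [|n IH]; first exact: measurable_id.
exact: (measurableT_comp mT IH).
Qed.

Lemma automorphism_inverse {R : realType} {d} {X : measurableType d} (mu : set X -> \bar R)
    (T : X -> X) : automorphism mu T -> exists2 Ti, measurable_fun setT Ti & cancel T Ti.
Proof.
move=> [[Ti TK TiK] [_ [mim _]]]; exists Ti => // _ A mA; rewrite setTI.
have -> : Ti @^-1` A = T @` A; last exact: mim.
apply/seteqP; split => x /=; first by move=> Ax; exists (Ti x).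
by move=> [y Ay <-]; rewrite TK.
Qed.

Lemma measurable_cocycle_sum {G : topologicalZmodType} {d} {X : measurableType d}
    (phi : X -> Borel G) (T : X -> X) n : @second_countable G ->
  measurable_fun setT T -> measurable_fun setT phi ->
  measurable_fun setT (cocycle_sum phi T n : X -> Borel G).
Proof.
move=> Gsc mT mphi; elim: n => [|n IH].
  have -> : cocycle_sum phi T 0 = cst 0 by apply/funext => x; rewrite /cocycle_sum big_ord0.
  exact: measurable_cst.
have -> : cocycle_sum phi T n.+1 = (fun x => cocycle_sum phi T n x + phi (iter n T x)).
  by apply/funext => x; rewrite /cocycle_sum big_ord_recr.
apply: (measurable_Borel_add Gsc) => //.
exact: (measurableT_comp mphi (measurable_iter n mT)).
Qed.

Lemma iter_rokhlin {X Y : Type} {G : zmodType} (T : X -> X) (phi : X -> G)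
    (S : G -> Y -> Y) n p : (forall y, S 0 y = y) ->
  (forall g h y, S (g + h) y = S g (S h y)) ->
  iter n (rokhlin T phi S) p = (iter n T p.1, S (cocycle_sum phi T n p.1) p.2).
Proof.
move=> S0 S_add; elim: n => [|n IH].
  by rewrite /cocycle_sum big_ord0 S0; case: p.
by rewrite iterS IH /rokhlin/= -S_add /cocycle_sum big_ord_recr/= addrC.
Qed.

Lemma ergodic_factor {R : realType} {d1 d2} {W1 : measurableType d1} {W2 : measurableType d2}
    (P : set W1 -> \bar R) (Q : set W2 -> \bar R) (T1 : W1 -> W1) (T2 : W2 -> W2)
    (p : W1 -> W2) : measurable_fun setT p ->
  (forall A, measurable A -> P (p @^-1` A) = Q A) -> (forall w, p (T1 w) = T2 (p w)) ->
  ergodic P T1 -> ergodic Q T2.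
Proof.
move=> mp PQ pT eP A mA TA; rewrite -!PQ//; last exact: measurableC.
rewrite -preimage_setC; apply: eP.
  by rewrite -[X in measurable X]setTI; exact: mp.
rewrite -[in RHS]TA; apply/funext => w; apply: propext.
by rewrite /= pT.
Qed.

Lemma measurable_flip {d1 d2} {X : measurableType d1} {Y : measurableType d2} :
  measurable_fun setT (fun z : X * Y => (z.2, z.1)).
Proof. exact: measurable_fun_pair. Qed.

(** (E4) extends a joining by the cocycle of its first coordinate only; the flip makes it available
    for the second one. *)
Lemma ergodic_joining_flip {R : realType} {d} {X : measurableType d} (mu : set X -> \bar R)
    (T1 T2 : X -> X) (k : probability (X * X)%type R) : ergodic_joining mu T1 T2 k ->
  ergodic_joining mu T2 T1 (image_probability k measurable_flip).
Proof.
move=> [[kT [k1 k2]] ek].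
have mflip (A : set (X * X)) : measurable A -> measurable ((fun z : X * X => (z.2, z.1)) @^-1` A).
  by move=> mA; rewrite -[X in measurable X]setTI; exact: measurable_flip.
split; last exact: (ergodic_factor measurable_flip _ _ ek).
split; [|split] => A mA; rewrite image_probabilityE.
- exact: (kT _ (mflip A mA)).
- rewrite -k2//; congr (k _); by apply/seteqP; split => -[x y] [].
- rewrite -k1//; congr (k _); by apply/seteqP; split => -[x y] [].
Qed.

(** * Joinings of Rokhlin extensions *)

Section RokhlinJoinings.
Context {R : realType} {G : topologicalZmodType} {d dY} {X : measurableType d}
  {Y : measurableType dY}.
Variable lam : {sigma_finite_measure set (Borel G) -> \bar R}.
Variables (mu : probability X R) (nu : probability Y R).
Hypotheses (Gsc : @second_countable G) (Glc : locally_compact [set: G])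
  (lam_haar : haar lam).
Variables (T1 T2 T1i T2i : X -> X) (psi1 psi2 : X -> Borel G).
Hypotheses (mT1 : measurable_fun setT T1) (mT2 : measurable_fun setT T2)
  (mT1i : measurable_fun setT T1i) (mT2i : measurable_fun setT T2i)
  (T1K : cancel T1 T1i) (T2K : cancel T2 T2i)
  (mpsi1 : measurable_fun setT psi1) (mpsi2 : measurable_fun setT psi2).
Variable S : Borel G -> Y -> Y.
Hypotheses (mS : measurable_fun setT (fun p : Borel G * Y => S p.1 p.2))
  (S0 : forall y, S 0 y = y) (S_add : forall g h y, S (g + h) y = S g (S h y))
  (nuS : forall g A, measurable A -> nu (S g @^-1` A) = nu A)
  (S_ergodic : forall A, measurable A -> (forall g, S g @^-1` A = A) ->
     nu A = 0%E \/ nu (~` A) = 0%E).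
Variable k : probability ((X * Y) * (X * Y))%type R.
Hypothesis k_joining :
  ergodic_joining (mu \x nu)%E (rokhlin T1 psi1 S) (rokhlin T2 psi2 S) k.

Let V := (X * X)%type.
Let pV (z : (X * Y) * (X * Y)) : V := (z.1.1, z.2.1).
(** The coordinates are reordered so that each step adjoins one fibre point as the last factor of a
    product. *)
Let p1 (z : (X * Y) * (X * Y)) : V * Y := (pV z, z.2.2).
Let p2 (z : (X * Y) * (X * Y)) : (V * Y) * Y := (p1 z, z.1.2).
Let U (v : V) : V := (T1 v.1, T2 v.2).
Let Ui (v : V) : V := (T1i v.1, T2i v.2).

Lemma measurable_pV : measurable_fun setT pV.
Proof.
by apply: measurable_fun_pair; [exact: (measurableT_comp measurable_fst measurable_fst)|
  exact: (measurableT_comp measurable_fst measurable_snd)].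
Qed.

Let mp1 : measurable_fun setT p1.
Proof.
apply: measurable_fun_pair; first exact: measurable_pV.
exact: (measurableT_comp measurable_snd measurable_snd).
Qed.

Let mp2 : measurable_fun setT p2.
Proof.
apply: measurable_fun_pair; first exact: mp1.
exact: (measurableT_comp measurable_snd measurable_fst).
Qed.

Definition base_joining : probability V R := image_probability k measurable_pV.
Let eta := base_joining.

Let rok (z : (X * Y) * (X * Y)) := (rokhlin T1 psi1 S z.1, rokhlin T2 psi2 S z.2).

Let k_inv A : measurable A -> k (rok @^-1` A) = k A.
Proof. by move=> mA; rewrite k_joining.1.1. Qed.

Let mu_nu A : measurable A -> (mu \x nu)%E (A `*` setT) = mu A.
Proof.
move=> mA; rewrite product_measure1E//; transitivity (mu A * 1)%E; last by rewrite mule1.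
by congr *%E; exact: probability_setT.
Qed.

Let mu_nu2 A : measurable A -> (mu \x nu)%E (setT `*` A) = nu A.
Proof.
move=> mA; rewrite product_measure1E//; transitivity (1 * nu A)%E; last by rewrite mul1e.
by congr *%E; exact: probability_setT.
Qed.

Lemma base_joining_ergodic : ergodic_joining mu T1 T2 eta.
Proof.
have [[_ [k1 k2]] ek] := k_joining.
split; last exact: (ergodic_factor measurable_pV _ _ ek).
split; [|split] => A mA.
- have mA' : measurable (pV @^-1` A).
    by rewrite -[X in measurable X]setTI; exact: measurable_pV.
  exact: (k_inv mA').
- rewrite -mu_nu// -k1; last exact: measurableX.
  rewrite [LHS]image_probabilityE; congr (k _).
  by apply/seteqP; split => -[[x y] [x' y']] /=; tauto.
- rewrite -mu_nu// -k2; last exact: measurableX.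
  rewrite [LHS]image_probabilityE; congr (k _).
  by apply/seteqP; split => -[[x y] [x' y']] /=; tauto.
Qed.

Let mU : measurable_fun setT U.
Proof. by apply: measurable_fun_pair; exact: measurableT_comp. Qed.

Let mUi : measurable_fun setT Ui.
Proof. by apply: measurable_fun_pair; exact: measurableT_comp. Qed.

Let UK : cancel U Ui.
Proof. by case=> x x'; rewrite /U /Ui/= T1K T2K. Qed.

Let etaU A : measurable A -> eta (U @^-1` A) = eta A.
Proof. exact: base_joining_ergodic.1.1. Qed.

Hypothesis erg1 : ergodic (eta \x lam)%E (skew1 U (fun v => psi1 v.1)).
Hypothesis erg2 : ergodic (eta \x lam)%E (skew1 U (fun v => psi2 v.2)).
Hypothesis mackey : mackey_weakly_mixing lam eta U
  (fun v => (psi1 v.1 : G, psi2 v.2 : G)).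

Let mpsi1V : measurable_fun setT (fun v : V => psi1 v.1).
Proof. exact: measurableT_comp. Qed.

Let mpsi2V : measurable_fun setT (fun v : V => psi2 v.2).
Proof. exact: measurableT_comp. Qed.

Let law1 A : measurable A -> k (p1 @^-1` A) = (eta \x nu)%E A.
Proof.
apply: (@relatively_disjoint _ _ _ _ _ _ lam eta nu Gsc lam_haar U Ui (fun v => psi2 v.2)
  mU mUi UK etaU mpsi2V erg2 S mS S0 S_add nuS (image_probability k mp1)).
- move=> B mB; have mB' : measurable (p1 @^-1` B) by rewrite -[X in measurable X]setTI; exact: mp1.
  exact: (k_inv mB').
- move=> B mB; rewrite image_probabilityE [RHS]image_probabilityE; congr (k _).
  by apply/seteqP; split => -[[x y] [x' y']] /=; tauto.
- move=> D mD; rewrite image_probabilityE -mu_nu2// -k_joining.1.2.2; last exact: measurableX.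
  by congr (k _); apply/seteqP; split => -[[x y] [x' y']] /=; tauto.
Qed.

Let U2 (w : V * Y) : V * Y := (U w.1, S (psi2 w.1.2) w.2).
Let U2i (w : V * Y) : V * Y := (Ui w.1, S (- psi2 (Ui w.1).2) w.2).

Lemma joining_law A : measurable A -> k (p2 @^-1` A) = ((eta \x nu) \x nu)%E A.
Proof.
have mU2 : measurable_fun setT U2.
  apply: measurable_fun_pair; first exact: measurableT_comp.
  have h : measurable_fun setT (fun w : V * Y => (psi2 w.1.2, w.2)).
    apply: measurable_fun_pair => //.
    exact: (measurableT_comp mpsi2V measurable_fst).
  exact: (measurableT_comp mS h).
have mU2i : measurable_fun setT U2i.
  apply: measurable_fun_pair; first exact: measurableT_comp.
  have h : measurable_fun setT (fun w : V * Y => (- psi2 (Ui w.1).2 : Borel G, w.2)).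
    apply: measurable_fun_pair => //; apply: measurable_Borel_opp.
    exact: (measurableT_comp mpsi2V (measurableT_comp mUi measurable_fst)).
  exact: (measurableT_comp mS h).
have U2K : cancel U2 U2i.
  by case=> v y; rewrite /U2 /U2i/= UK T2K -S_add addNr S0.
have U2eta B : measurable B -> (eta \x nu)%E (U2 @^-1` B) = (eta \x nu)%E B.
  apply: (@skew_product_preserves _ _ _ _ _ eta nu U (fun v => S (psi2 v.2))) => //.
    have h : measurable_fun setT (fun w : V * Y => (psi2 w.1.2, w.2)).
      apply: measurable_fun_pair => //.
      exact: (measurableT_comp mpsi2V measurable_fst).
    exact: (measurableT_comp mS h).
  by move=> v D mD; exact: nuS.
have erg := skew_rokhlin_ergodic Gsc Glc lam_haar mU mUi UK etaU mpsi1V mpsi2V erg1 mackey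
  mS S0 S_add nuS S_ergodic.
have mpsi : measurable_fun setT (fun w : V * Y => psi1 w.1.1).
  exact: (measurableT_comp mpsi1V measurable_fst).
apply: (@relatively_disjoint _ _ _ _ _ _ lam (eta \x nu)%E nu Gsc lam_haar U2 U2i
  (fun w => psi1 w.1.1) mU2 mU2i U2K U2eta mpsi erg S mS S0 S_add nuS (image_probability k mp2)).
- move=> B mB; have mB' : measurable (p2 @^-1` B) by rewrite -[X in measurable X]setTI; exact: mp2.
  exact: (k_inv mB').
- move=> B mB; apply: etrans (law1 mB); rewrite image_probabilityE; congr (k _).
  by apply/seteqP; split => -[[x y] [x' y']] /=; tauto.
- move=> D mD; rewrite image_probabilityE -mu_nu2// -k_joining.1.2.1; last exact: measurableX.
  by congr (k _); apply/seteqP; split => -[[x y] [x' y']] /=; tauto.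
Qed.

Lemma integral_joining f g : square_integrable (mu \x nu)%E f -> square_integrable (mu \x nu)%E g ->
  (\int[k]_z (f z.1 * g z.2)%:E =
   \int[eta]_v (fiber_average nu f v.1 * fiber_average nu g v.2)%:E)%E.
Proof.
move=> sf sg; have [_ [eta1 eta2]] := base_joining_ergodic.1.
have e1 A : measurable A -> eta (fst @^-1` A) = mu A.
  by move=> mA; rewrite -eta1//; congr (eta _); apply/seteqP; split => -[x y] //= [].
have e2 A : measurable A -> eta (snd @^-1` A) = mu A.
  by move=> mA; rewrite -eta2//; congr (eta _); apply/seteqP; split => -[x y] //= [].
pose F (q : (V * Y) * Y) := f (q.1.1.1, q.2); pose H (w : V * Y) := g (w.1.2, w.2).
have mq1 : measurable_fun setT (fun w : V * Y => w.1.1).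
  exact: (measurableT_comp measurable_fst measurable_fst).
have eq1 A : measurable A -> (eta \x nu)%E ((fun w : V * Y => w.1.1) @^-1` A) = mu A.
  move=> mA; rewrite -e1//.
  have mA1 : measurable (fst @^-1` A : set V).
    by rewrite -[X in measurable X]setTI; exact: measurable_fst.
  have -> : (fun w : V * Y => w.1.1) @^-1` A = (fst @^-1` A) `*` setT.
    by apply/seteqP; split => -[v y] /=; tauto.
  rewrite [LHS]product_measure1E//; transitivity (eta (fst @^-1` A) * 1)%E; last by rewrite mule1.
  by congr *%E; exact: probability_setT.
have sH : square_integrable (eta \x nu)%E H.
  exact: (@square_integrable_pullback _ _ _ _ _ mu nu _ _ eta snd g measurable_snd e2 sg).
have sF : square_integrable ((eta \x nu) \x nu)%E F.
  exact: (@square_integrable_pullback _ _ _ _ _ mu nu _ _ (eta \x nu)%E _ f mq1 eq1 sf).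
have sH' : square_integrable ((eta \x nu) \x nu)%E (fun q : (V * Y) * Y => H q.1).
  exact: (@square_integrable_fst _ _ _ nu _ _ (eta \x nu)%E H sH).
have sfV : square_integrable eta (fun v => fiber_average nu f v.1).
  exact: (square_integrable_image (P := eta) (Q := mu) measurable_fst e1
    (square_integrable_fiber_average sf)).
(* The factors are exchanged because [f] lives on the fibre point adjoined last, which has to be
   integrated out before that of [g]. *)
transitivity (\int[((eta \x nu) \x nu)]_q (H q.1 * F q)%:E)%E.
  rewrite -(integral_image mp2 joining_law (square_integrableM sH' sF)).
  by apply: eq_integral => -[[x y] [x' y']] _; rewrite /H /F/= mulrC.
rewrite (@integral_fiber_average _ _ _ _ _ mu nu _ _ (eta \x nu)%E _ H f mq1 eq1 sH sf).
rewrite -(@integral_fiber_average _ _ _ _ _ mu nu _ _ eta snd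
  (fun v => fiber_average nu f v.1) g measurable_snd e2 sfV sg).
by apply: eq_integral => -[v y] _; rewrite /H /= mulrC.
Qed.
End RokhlinJoinings.

Unset Implicit Arguments.
Set Strict Implicit.

Theorem theorem4p1
  (R : realType)
  (* the base system: an ergodic automorphism with AOP on a standard space *)
  (dX : measure_display) (X : measurableType dX) (mu : probability X R)
  (T : X -> X)
  (HX : standard_borel R X) (HT : automorphism mu T) (HAOP : AOP mu T)
  (* G : locally compact second countable abelian group, with Haar measure *)
  (G : topologicalZmodType)
  (HGhaus : hausdorff_space G) (HGlc : locally_compact [set: G])
  (HGsc : @second_countable G)
  (lam : {sigma_finite_measure set (Borel G) -> \bar R})
  (Hlam : haar lam)
  (* an ergodic cocycle phi *)
  (phi : X -> Borel G) (Hphim : measurable_fun setT phi)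
  (Hphierg : ergodic (mu \x lam)%E
     (fun p : (X * Borel G)%type => (T p.1, phi p.1 + p.2)))
  (* (E4) *)
  (HE4 : forall r s : nat, prime r -> prime s -> r != s ->
     forall eta : probability (X * X)%type R,
       ergodic_joining mu (iter r T) (iter s T) eta ->
       ergodic (eta \x lam)%E
         (fun w : ((X * X) * Borel G)%type =>
            ((iter r T w.1.1, iter s T w.1.2),
             cocycle_sum phi T r w.1.1 + w.2)))
  (* (E5) *)
  (HE5 : forall r s : nat, prime r -> prime s -> r != s ->
     forall eta : probability (X * X)%type R,
       ergodic_joining mu (iter r T) (iter s T) eta ->
       mackey_weakly_mixing lam eta
         (fun z : (X * X)%type => (iter r T z.1, iter s T z.2))
         (fun z : (X * X)%type =>
            ((cocycle_sum phi T r z.1 : G), (cocycle_sum phi T s z.2 : G)))) :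
  forall (dY : measure_display) (Y : measurableType dY) (nu : probability Y R)
    (S : Borel G -> Y -> Y),
    standard_borel R Y ->
    measurable_fun setT (fun p : (Borel G * Y)%type => S p.1 p.2) ->
    (forall y, S 0 y = y) ->
    (forall g h y, S (g + h) y = S g (S h y)) ->
    (forall g A, measurable A -> nu (S g @^-1` A) = nu A) ->
    (forall A, measurable A -> (forall g, S g @^-1` A = A) ->
       nu A = 0%E \/ nu (~` A) = 0%E) ->
    AOP (mu \x nu)%E (rokhlin T phi S).
Proof.
move=> dY Y nu S _ mS S0 S_add nuS S_ergodic.
have [Ti mTi TK] := automorphism_inverse HT; have [_ [mT [_ muT]]] := HT.
have rokE n : iter n (rokhlin T phi S) = rokhlin (iter n T) (cocycle_sum phi T n) S.
  by apply/funext => p; rewrite iter_rokhlin.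
have mphin n := measurable_cocycle_sum n HGsc mT Hphim.
have iterK n : cancel (iter n T) (iter n Ti).
  by elim: n => [//|n IH] x; rewrite iterSr/= TK IH.
split; first exact: rokhlin_ergodic Hphierg _ mS S0 S_add nuS S_ergodic.
move=> f g Lf Lg eps eps0.
have [N HN] := HAOP.2 _ _ (L2_0_fiber_average Lf) (L2_0_fiber_average Lg) eps eps0.
exists N => r s pr ps rs Nr Ns k; rewrite !rokE => kj.
have ej := base_joining_ergodic kj.
pose eta := base_joining k.
have erg1 := HE4 r s pr ps rs eta ej.
have erg2 : ergodic (eta \x lam)%E (skew1 (fun v : X * X => (iter r T v.1, iter s T v.2))
    (fun v => cocycle_sum phi T s v.2)).
  have sr : s != r by rewrite eq_sym.
  (* Flipping twice is the identity, so [p] maps the extension over the flipped joining onto the one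
     over [eta], measure included. *)
  pose p (w : (X * X) * Borel G) := ((w.1.2, w.1.1), w.2).
  have mp : measurable_fun setT p.
    apply: measurable_fun_pair; last exact: measurable_snd.
    exact: (measurableT_comp (@measurable_flip _ _ X X) measurable_fst).
  apply: (ergodic_factor mp _ _ (HE4 s r ps pr sr _ (ergodic_joining_flip ej))) => //.
  move=> A mA; apply: (@product_image _ _ _ _ _ _ _ (image_probability eta measurable_flip)
    eta lam (fun z => (z.2, z.1)) measurable_flip _ A mA) => B mB.
  have flipK : (fun z : X * X => (z.2, z.1)) @^-1` ((fun z => (z.2, z.1)) @^-1` B) = B.
    by apply/seteqP; split => -[x y].
  exact: (congr1 (fun C => eta C) flipK).
rewrite (integral_joining HGsc HGlc Hlam (measurable_iter r mT) (measurable_iter s mT)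
  (measurable_iter r mTi) (measurable_iter s mTi) (iterK r) (iterK s) (mphin r) (mphin s)
  mS S0 S_add nuS S_ergodic kj erg1 erg2 (HE5 r s pr ps rs eta ej) _ _).
- exact: (HN r s pr ps rs Nr Ns _ ej).
- by case: Lf => mf [f2 _].
- by case: Lg => mg [g2 _].
Qed.
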